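(* Let $I\subset\mathbb{R}$ be a compact interval with non-empty interior such that the uniform Hölder exponent of $H(\cdot)$ over $I$ satisfies $\rho_H^{\mathrm{unif}}(I)>\max_{t\in I}H(t)$. Let $\beta\in(0,\alpha/4)$ be fixed. For every positive integer $j\ge -2\log_2(2^{-1}|I|)$, where $|I|$ is the length of $I$, let $\nu_j=\{k\in\mathbb{Z}:[2^{-j}k,2^{-j}(k+1)]\subseteq I\}$, $n_j=\mathrm{card}(\nu_j)$ (one has $n_j\ge1$), and set $$\widehat{\underline{H}}_j(I)=\frac{1}{-j\beta}\log_2\Big(\frac{1}{n_j}\sum_{k\in\nu_j}|d_{j,k}|^\beta\Big),\qquad D_j=\max\{|d_{j,k}| : [2^{-j}k,2^{-j}(k+1)]\subseteq I\},$$ $$\widehat{\alpha}_j=\Big(\widehat{\underline{H}}_j(I)+j^{-1}\log_2(D_j)\Big)^{-1}.$$ Then, almost surely, $\widehat{\alpha}_j\to\alpha$ as $j\to+\infty$.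
   Context: Fix $\alpha\in(1,2)$. $\{Z_\alpha(s):s\in\mathbb{R}\}$ is a symmetric $\alpha$-stable (S$\alpha$S) Lévy process with càdlàg paths on a probability space $(\Omega,\mathcal{F},\mathbb{P})$, normalized so that for $f\in L^\alpha(\mathbb{R})$ the stable stochastic integral $\int_{\mathbb{R}}f(s)\,Z_\alpha(ds)$ has characteristic function $\xi\mapsto\exp(-|\xi|^\alpha\int_{\mathbb{R}}|f(s)|^\alpha ds)$. For real $x,\kappa$, $(x)_+^\kappa=x^\kappa$ if $x>0$ and $(x)_+^\kappa=0$ otherwise. $X=\{X(u,v):(u,v)\in\mathbb{R}\times(1/\alpha,1)\}$ is the S$\alpha$S field $X(u,v)=\int_{\mathbb{R}}\{(u-s)_+^{v-1/\alpha}-(-s)_+^{v-1/\alpha}\}Z_\alpha(ds)$. It is always taken in a version (known to exist, $\Omega$ being suitably chosen) such that for every $\omega\in\Omega$ the path $(u,v)\mapsto X(u,v,\omega)$ is continuous and, for all compact intervals $\mathcal{I}\subset\mathbb{R}$, $\mathcal{H}\subset(1/\alpha,1)$, $\sup\{|X(u,v_1,\omega)-X(u,v_2,\omega)|/|v_1-v_2| : u\in\mathcal{I},\,v_1,v_2\in\mathcal{H}\}<+\infty$ (convention $0/0=0$). $H:\mathbb{R}\to[\underline{H},\overline{H}]$ is a continuous function, where $[\underline{H},\overline{H}]$ is a compact subinterval of $(1/\alpha,1)$. The Linear Multifractional Stable Motion is $Y(t)=X(t,H(t))$, $t\in\mathbb{R}$. The analyzing wavelet $\psi:\mathbb{R}\to\mathbb{R}$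 is continuous, not identically zero, vanishes outside $[0,1]$, and satisfies $\int_{\mathbb{R}}\psi(s)ds=\int_{\mathbb{R}}s\psi(s)ds=0$. The wavelet coefficients of $Y$ are $d_{j,k}=2^j\int_{\mathbb{R}}Y(t)\psi(2^jt-k)\,dt$, $(j,k)\in\mathbb{Z}^2$. For a compact interval $I$ with non-empty interior and a continuous $g:\mathbb{R}\to\mathbb{R}$, the uniform Hölder exponent is $\rho_g^{\mathrm{unif}}(I)=\sup\{\gamma\in[0,1] : \sup_{t_1,t_2\in I}|g(t_1)-g(t_2)|/|t_1-t_2|^\gamma<+\infty\}$. *)

(* Defs.v *)
From HB Require Import structures.
From mathcomp Require Export all_boot all_order all_algebra finmap.
From mathcomp Require Export all_classical all_reals all_analysis.

Set Implicit Arguments.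
Unset Strict Implicit.
Unset Printing Implicit Defensive.

Import Order.TTheory GRing.Theory Num.Theory.
Import numFieldNormedType.Exports.

Local Open Scope classical_set_scope.
Local Open Scope ring_scope.

Definition log2 (R : realType) (x : R) : R := ln x / ln 2.

(* (x)_+^kappa; the test matters since powR is not 0 on negative bases. *)
Definition pospow (R : realType) (x kappa : R) : R :=
  if 0 < x then x `^ kappa else 0.

(* E[exp(i xi W)] = exp(- sigma_alpha |xi|^alpha), as real and imaginary
   parts; sigma_alpha is the alpha-th power of the scale parameter. *)
Definition has_SaS_law d (T : measurableType d) (R : realType)
    (P : probability T R) (alpha sigma_alpha : R) (W : T -> R) : Prop :=
  forall xi : R,
    ('E_P[fun w => cos (xi * W w)])%E
      = (expR (- (sigma_alpha * `|xi| `^ alpha)))%:E /\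
    ('E_P[fun w => sin (xi * W w)])%E = 0%E.

(* Some of the B i may be setT, so the product rule for the whole family
   contains the product rule for every subfamily. *)
Definition independent_increments d (T : measurableType d) (R : realType)
    (P : probability T R) (Z : R -> {RV P >-> R}) : Prop :=
  forall (n : nat) (t : nat -> R) (B : nat -> set R),
    {homo t : i j / (i <= j)%N >-> i <= j} ->
    (forall i, measurable (B i)) ->
    P [set w | forall i, (i < n)%N -> B i (Z (t i.+1) w - Z (t i) w)]
    = (\prod_(i < n) P [set w | B i (Z (t i.+1) w - Z (t i) w)%R])%E.

Definition cadlag (R : realType) (f : R -> R) : Prop :=
  forall t : R, f u @[u --> t^'+] --> f t /\ cvg (f u @[u --> t^'-]).

Record SaS_Levy_process d (T : measurableType d) (R : realType)
    (P : probability T R) (alpha : R) (Z : R -> {RV P >-> R}) : Prop := {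
  SaS_Levy_start : {ae P, forall w, Z 0 w = 0} ;
  SaS_Levy_indep : independent_increments Z ;
  SaS_Levy_law : forall s t : R,
    has_SaS_law P alpha `|t - s| (fun w => Z t w - Z s w) ;
  SaS_Levy_cadlag : forall w, cadlag (fun t => Z t w)
}.

(* A triple (c, a, b) with a <= b stands for the function c 1_{]a, b]}. *)
Definition step_valid (R : realType) (s : seq (R * R * R)) : bool :=
  all (fun p => p.1.2 <= p.2) s.

Definition step_fun (R : realType) (s : seq (R * R * R)) (x : R) : R :=
  \sum_(p <- s) p.1.1 * \1_(`]p.1.2, p.2]%classic) x.

Definition step_integral d (T : measurableType d) (R : realType)
    (P : probability T R) (Z : R -> {RV P >-> R})
    (s : seq (R * R * R)) (w : T) : R :=
  \sum_(p <- s) p.1.1 * (Z p.2 w - Z p.1.2 w).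

Definition cvg_in_probability d (T : measurableType d) (R : realType)
    (P : probability T R) (W_ : nat -> T -> R) (W : T -> R) : Prop :=
  forall eps : R, 0 < eps ->
    P [set w | eps <= `|W_ n w - W w|] @[n --> \oo] --> 0%E.

(* W is a version of the integral of f with respect to Z, i.e. the limit in
   probability of the integrals of step functions tending to f in L^alpha. *)
Definition is_stable_integral d (T : measurableType d) (R : realType)
    (P : probability T R) (alpha : R) (Z : R -> {RV P >-> R})
    (f : R -> R) (W : T -> R) : Prop :=
  [/\ f \in Lfun (@lebesgue_measure R) alpha%:E,
      measurable_fun [set: T] W &
      exists s : nat -> seq (R * R * R),
        [/\ forall n, step_valid (s n),
            (\int[lebesgue_measure]_x (`|step_fun (s n) x - f x| `^ alpha)%:E)%E
              @[n --> \oo] --> 0%E &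
            cvg_in_probability P (fun n => step_integral Z (s n)) W]].

(* Only the values X u v for 1/alpha < v < 1 are constrained. *)
Definition lfsm_field d (T : measurableType d) (R : realType)
    (P : probability T R) (alpha : R) (Z : R -> {RV P >-> R})
    (X : R -> R -> T -> R) : Prop :=
  forall u v : R, alpha^-1 < v < 1 ->
    is_stable_integral alpha Z
      (fun s => pospow (u - s) (v - alpha^-1) - pospow (- s) (v - alpha^-1))
      (X u v).

Definition continuous_paths (T : Type) (R : realType) (alpha : R)
    (X : R -> R -> T -> R) : Prop :=
  forall w, {within [set: R] `*` `]alpha^-1, 1[%classic,
    continuous (fun p : R * R => X p.1 p.2 w)}.

(* Division by 0 yields 0, so the convention 0/0 = 0 is built in. *)
Definition lipschitz_paths (T : Type) (R : realType) (alpha : R)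
    (X : R -> R -> T -> R) : Prop :=
  forall w (a b c d : R), alpha^-1 < c -> d < 1 ->
    has_ubound [set r : R | exists u v1 v2 : R,
      [/\ u \in `[a, b], v1 \in `[c, d], v2 \in `[c, d] &
          r = `|X u v1 w - X u v2 w| / `|v1 - v2|]].

Record analyzing_wavelet (R : realType) (psi : R -> R) : Prop := {
  wavelet_continuous : continuous psi ;
  wavelet_neq0 : exists s, psi s != 0 ;
  wavelet_support : forall s, s \notin `[0, 1] -> psi s = 0 ;
  wavelet_moment0 : (\int[lebesgue_measure]_s psi s = 0)%R ;
  wavelet_moment1 : (\int[lebesgue_measure]_s (s * psi s) = 0)%R
}.

(* d_{j,k} for the path y. *)
Definition wavelet_coef (R : realType) (psi y : R -> R) (j k : int) : R :=
  2 ^ j * (\int[lebesgue_measure]_t (y t * psi (2 ^ j * t - k%:~R)))%R.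

(* rho_g^unif([a, b]). *)
Definition unif_Holder_exponent (R : realType) (g : R -> R) (a b : R) : R :=
  sup [set gamma : R | 0 <= gamma <= 1 /\
    has_ubound [set r : R | exists t1 t2 : R,
      [/\ t1 \in `[a, b], t2 \in `[a, b] &
          r = `|g t1 - g t2| / `|t1 - t2| `^ gamma]]].

(* nu_j for I = [a, b]. The set is finite; fset_set turns it into a {fset}. *)
Definition nu (R : realType) (a b : R) (j : nat) : {fset int} :=
  fset_set [set k : int |
    `[2 ^- j * k%:~R, 2 ^- j * (k + 1)%:~R]%classic `<=` `[a, b]%classic].

Definition H_hat (R : realType) (beta a b : R) (d : int -> int -> R)
    (j : nat) : R :=
  (- (j%:R * beta))^-1 *
  log2 ((#|` nu a b j|%:R)^-1 * \sum_(k <- nu a b j) `|d j k| `^ beta).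

(* The default value 0 of the maximum is harmless: all terms are >= 0. *)
Definition D_max (R : realType) (a b : R) (d : int -> int -> R) (j : nat) : R :=
  \big[Num.max/0]_(k <- nu a b j) `|d j k|.

Definition alpha_hat (R : realType) (beta a b : R) (d : int -> int -> R)
    (j : nat) : R :=
  (H_hat beta a b d j + j%:R^-1 * log2 (D_max a b d j))^-1.

(* Main.v *)
(* Freezing the exponent at the left end u of each dyadic cell replaces d_{j,k}
   by the coefficient W_{j,k} of the field X(., H(u)), at a cost O(2^(- j gamma))
   with gamma > max H, because X is Lipschitz in v.  W_{j,k} is symmetric stable
   with kernel 2^(- j (v - 1/alpha)) Phi((s - u) 2^j), v = H(u), where
   Phi(x) = int (y - x)_+^(v - 1/alpha) psi(y) dy, so its scale parameter is of
   order 2^(- j v alpha).  Writing m = min H over I, four estimates with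
   probabilities summable in j give mean |d|^beta = 2^(- j beta (m + o(1))) and
   max |d| = 2^(- j (m - 1/alpha + o(1))): the tail bound x^(- alpha) (both upper
   bounds), a small ball bound and the fact that a positive proportion of the
   cells has H <= m + eps (lower bound of the mean), and a lower bound of the
   maximum over well separated cells.  The two vanishing moments make the part of
   the kernel far from its cell small, so separated coefficients are nearly
   independent; independence is exploited only through characteristic functions
   of step integrals, by majorizing the indicator of a small value by the
   trigonometric polynomial gtest. *)
From HB Require Import structures.
Require Import Defs.
From mathcomp Require Import ring lra measurable_realfun.

Set Implicit Arguments.
Unset Strict Implicit.
Unset Printing Implicit Defensive.

Import Order.TTheory GRing.Theory Num.Theory.
Import numFieldNormedType.Exports.
Local Open Scope classical_set_scope.
Local Open Scope ring_scope.

(** * Expectation of bounded variables *)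

Section bounded_expectation.
Context d (T : measurableType d) (R : realType) (P : probability T R).
Implicit Types f g : T -> R.

(** Two obstacles shape the proof. The field is known only through limits in probability of step
    integrals, so no stochastic Fubini theorem is at hand: every integral against psi is treated as
    the limit of its Riemann sums, whose terms are finite combinations of values of X and, in
    parallel, of kernels. Above, this holds because v stays below a number less than 1, which keeps
    the decay of Phi integrable at a fixed rate. Below, it is obtained by duality: a Beta integral
    turns the pairing of Phi with a power into the integral of psi against (y - z)_+^2, which is
    free of kappa up to a factor bounded from below. All expectations are those of bounded
    variables; unbounded ones are truncated. Consistency rests on a cancellation: the mean
    contributes m to the inverse of the estimator, the maximum 1/alpha - m. *)

Definition bounded_measurable f :=
  measurable_fun [set: T] f /\ exists M : R, forall w, `|f w| <= M.

Definition pr (A : set T) : R := fine (P A).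
Definition Ex f : R := (\int[P]_w f w)%R.

Lemma prE (A : set T) : measurable A -> P A = (pr A)%:E.
Proof. by move=> mA; rewrite /pr fineK// fin_num_measure. Qed.

Lemma pr_setT : pr setT = 1.
Proof. by rewrite /pr probability_setT. Qed.

Lemma pr_le1 (A : set T) : measurable A -> pr A <= 1.
Proof. by move=> mA; rewrite -lee_fin -prE// probability_le1. Qed.

Lemma le_pr (A B : set T) : measurable A -> measurable B -> A `<=` B ->
  pr A <= pr B.
Proof.
move=> mA mB AB; rewrite -lee_fin -!prE//; apply: le_measure => //; exact/mem_set.
Qed.

Lemma prU (A B : set T) : measurable A -> measurable B ->
  pr (A `|` B) <= pr A + pr B.
Proof.
move=> mA mB; rewrite -lee_fin EFinD -!prE//; last exact: measurableU.
exact: measureU2.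
Qed.

Lemma pr_bigcup (I : Type) (r : seq I) (A : I -> set T) :
  (forall i, measurable (A i)) ->
  pr (\big[setU/set0]_(i <- r) A i) <= \sum_(i <- r) pr (A i).
Proof.
move=> mA; elim: r => [|i r IH]; first by rewrite !big_nil /pr measure0.
rewrite !big_cons; apply: (le_trans (prU _ _)) => //.
  exact: bigsetU_measurable.
by rewrite lerD2l.
Qed.

Lemma bm_integrable f : bounded_measurable f -> P.-integrable setT (EFin \o f).
Proof.
move=> [mf [M fM]]; apply: measurable_bounded_integrable => //.
  by rewrite ltey_eq fin_num_measure.
exists M; split; first exact: num_real.
by move=> x Mx w _ /=; apply: (le_trans (fM w)); exact: ltW.
Qed.

Lemma bm_cst c : bounded_measurable (fun=> c).
Proof. by split=> //; exists `|c|. Qed.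

Lemma bmD f g : bounded_measurable f -> bounded_measurable g ->
  bounded_measurable (fun w => f w + g w).
Proof.
move=> [mf [M fM]] [mg [N gN]]; split; first exact: measurable_funD.
by exists (M + N) => w; rewrite (le_trans (ler_normD _ _))// lerD.
Qed.

Lemma bmM f g : bounded_measurable f -> bounded_measurable g ->
  bounded_measurable (fun w => f w * g w).
Proof.
move=> [mf [M fM]] [mg [N gN]]; split; first exact: measurable_funM.
by exists (M * N) => w; rewrite normrM ler_pM.
Qed.

Lemma bmZ c f : bounded_measurable f -> bounded_measurable (fun w => c * f w).
Proof. by move=> bf; apply: bmM => //; exact: bm_cst. Qed.

Lemma bmN f : bounded_measurable f -> bounded_measurable (fun w => - f w).
Proof.
by move=> [mf [M fM]]; split; [exact: measurableT_comp|exists M => w; rewrite normrN].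
Qed.

Lemma bmB f g : bounded_measurable f -> bounded_measurable g ->
  bounded_measurable (fun w => f w - g w).
Proof. by move=> bf bg; apply: bmD => //; exact: bmN. Qed.

Lemma bm_sum I (r : seq I) (p : pred I) (F : I -> T -> R) :
  (forall i, bounded_measurable (F i)) ->
  bounded_measurable (fun w => \sum_(i <- r | p i) F i w).
Proof.
move=> bF; elim: r => [|i r IH].
  by under eq_fun do rewrite big_nil; exact: bm_cst.
under eq_fun do rewrite big_cons; case: (p i) => //; exact: bmD.
Qed.

Lemma bm_prod I (r : seq I) (p : pred I) (F : I -> T -> R) :
  (forall i, bounded_measurable (F i)) ->
  bounded_measurable (fun w => \prod_(i <- r | p i) F i w).
Proof.
move=> bF; elim: r => [|i r IH].
  by under eq_fun do rewrite big_nil; exact: bm_cst.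
under eq_fun do rewrite big_cons; case: (p i) => //; exact: bmM.
Qed.

Lemma bm_indic (A : set T) : measurable A -> bounded_measurable (\1_A).
Proof.
move=> mA; split; first exact: measurable_indic.
by exists 1 => w; rewrite indicE; case: (w \in A); rewrite ?normr1 ?normr0.
Qed.

Lemma bm_cos f : measurable_fun [set: T] f ->
  bounded_measurable (fun w => cos (f w)).
Proof.
move=> mf; split; last by exists 1 => w; exact: cos_max.
by apply: measurableT_comp => //; apply: continuous_measurable_fun; exact: continuous_cos.
Qed.

Lemma bm_sin f : measurable_fun [set: T] f ->
  bounded_measurable (fun w => sin (f w)).
Proof.
move=> mf; split; last by exists 1 => w; exact: sin_max.
by apply: measurableT_comp => //; apply: continuous_measurable_fun; exact: continuous_sin.
Qed.

Lemma ExD f g : bounded_measurable f -> bounded_measurable g ->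
  Ex (fun w => f w + g w) = Ex f + Ex g.
Proof. by move=> bf bg; apply: RintegralD => //; exact: bm_integrable. Qed.

Lemma ExB f g : bounded_measurable f -> bounded_measurable g ->
  Ex (fun w => f w - g w) = Ex f - Ex g.
Proof. by move=> bf bg; apply: RintegralB => //; exact: bm_integrable. Qed.

Lemma ExZ c f : bounded_measurable f -> Ex (fun w => c * f w) = c * Ex f.
Proof. by move=> bf; apply: RintegralZl => //; exact: bm_integrable. Qed.

Lemma Ex_cst c : Ex (fun=> c) = c.
Proof. by rewrite /Ex Rintegral_cst// -[fine _]/(pr setT) pr_setT mulr1. Qed.

Lemma Ex_sum I (r : seq I) (F : I -> T -> R) :
  (forall i, bounded_measurable (F i)) ->
  Ex (fun w => \sum_(i <- r) F i w) = \sum_(i <- r) Ex (F i).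
Proof.
move=> bF; elim: r => [|i r IH].
  by under [X in Ex X]eq_fun do rewrite big_nil; rewrite Ex_cst big_nil.
under [X in Ex X]eq_fun do rewrite big_cons.
by rewrite ExD ?IH ?big_cons//; exact: bm_sum.
Qed.

Lemma le_Ex f g : bounded_measurable f -> bounded_measurable g ->
  (forall w, f w <= g w) -> Ex f <= Ex g.
Proof. by move=> bf bg fg; apply: le_Rintegral => //; exact: bm_integrable. Qed.

Lemma Ex_ge0 f : (forall w, 0 <= f w) -> 0 <= Ex f.
Proof. by move=> f0; exact: Rintegral_ge0. Qed.

Lemma le_normr_Ex f M : bounded_measurable f -> (forall w, `|f w| <= M) ->
  `|Ex f| <= M.
Proof.
move=> bf fM; rewrite ler_norml; apply/andP; split.
  rewrite -(Ex_cst (- M)); apply: le_Ex => //; first exact: bm_cst.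
  by move=> w; have := fM w; rewrite ler_norml => /andP[].
rewrite -(Ex_cst M); apply: le_Ex => //; first exact: bm_cst.
by move=> w; have := fM w; rewrite ler_norml => /andP[].
Qed.

Lemma Ex_indic (A : set T) : measurable A -> Ex (\1_A) = pr A.
Proof. by move=> mA; rewrite /Ex /pr /Rintegral integral_indic// setIT. Qed.

Lemma pr_le_Ex (A : set T) f : measurable A -> bounded_measurable f ->
  (forall w, \1_A w <= f w) -> pr A <= Ex f.
Proof. by move=> mA bf Af; rewrite -Ex_indic// le_Ex//; exact: bm_indic. Qed.

Lemma pr_markov (A : set T) f t : measurable A -> bounded_measurable f ->
  0 < t -> (forall w, 0 <= f w) -> (forall w, A w -> t <= f w) ->
  pr A <= Ex f / t.
Proof.
move=> mA bf t0 f0 Af; rewrite ler_pdivlMr// mulrC -Ex_indic// -ExZ; last exact: bm_indic.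
apply: le_Ex => //; first by apply: bmZ; exact: bm_indic.
move=> w; rewrite indicE; have [/set_mem/Af|_] := boolP (w \in A).
  by rewrite mulr1.
by rewrite mulr0.
Qed.

End bounded_expectation.

Arguments bm_cst {d T R} c.

Lemma ler_norm_eps (R : realFieldType) (x C : R) :
  (forall e, 0 < e -> `|x| <= e * C) -> x = 0.
Proof.
move=> xC; apply/eqP; rewrite -normr_le0; apply/ler_addgt0Pl => e e0.
rewrite addr0; have C1 : 0 < `|C| + 1 by rewrite ltr_wpDl.
apply: (le_trans (xC (e / (`|C| + 1)) _)); first by rewrite divr_gt0.
rewrite mulrAC ler_pdivrMr//; apply: ler_wpM2l; first exact: ltW.
by rewrite (le_trans (ler_norm _))// lerDl.
Qed.

(** * From independent events to expectations of products *)

Section independence.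
Context d (T : measurableType d) (R : realType) (P : probability T R).
Local Notation Ex := (@Ex d T R P).
Local Notation pr := (@pr d T R P).

(** Quantization of the range: the set where (g + M) / e lies between the integers q and q + 1
    receives the value q e - M; as |g| <= M, finitely many q occur. *)
Lemma bounded_simple_approx (g : R -> R) (M e : R) :
  measurable_fun [set: R] g -> (forall x, `|g x| <= M) -> 0 < e ->
  exists m (B : nat -> set R) (a : nat -> R), (forall q, measurable (B q)) /\
    forall x, `|g x - \sum_(q < m) a q * \1_(B q) x| <= e.
Proof.
move=> mg gM e0.
pose h x := (g x + M) / e.
have h0 x : 0 <= h x.
  by apply: divr_ge0; [move: (gM x); rewrite ler_norml => /andP[]; lra|exact: ltW].
have mh : measurable_fun setT h.
  by apply: measurable_funM => //; apply: measurable_funD.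
exists (Num.truncn (2 * M / e)).+1, (fun q => [set x | q%:R <= h x < q.+1%:R]),
  (fun q => q%:R * e - M); split.
  move=> q; have -> : [set x | q%:R <= h x < q.+1%:R] =
      setT `&` h @^-1` `[q%:R, q.+1%:R[%classic.
    by rewrite setTI; apply/seteqP; split=> x /=; rewrite in_itv.
  by apply: mh => //; exact: measurable_itv.
move=> x; have hq := Num.Theory.truncn_itv (h0 x).
have qlt : (Num.truncn (h x) < (Num.truncn (2 * M / e)).+1)%N.
  rewrite ltnS; apply: Num.Theory.le_truncn; rewrite /h ler_pM2r ?invr_gt0//.
  by have := gM x; rewrite ler_norml => /andP[]; lra.
rewrite (bigD1 (Ordinal qlt))//= big1 ?addr0; last first.
  move=> i /eqP iq; rewrite indicE; case: (boolP (_ \in _)); rewrite ?mulr0//.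
  rewrite inE /= => /andP[i1 i2]; exfalso; apply: iq; apply/val_inj => /=.
  apply/esym/eqP; rewrite Num.Theory.truncn_eq//; first by rewrite i1.
rewrite indicE mem_set/= ?mulr1//.
move: hq; set q := _%:R; rewrite -natr1 -/q => /andP[].
rewrite /h ler_pdivlMr// ltr_pdivrMr// => H1 H2.
by rewrite ler_norml; apply/andP; split; move: H1 H2; rewrite ?mulrDl ?mul1r; lra.
Qed.


Lemma bm_comp (g : R -> R) (D : T -> R) : measurable_fun [set: T] D ->
  measurable_fun [set: R] g -> (exists M : R, forall x, `|g x| <= M) ->
  bounded_measurable (g \o D).
Proof.
by move=> mD mg [M gM]; split; [exact: measurableT_comp|exists M => w; exact: gM].
Qed.

(** Both sides are linear in [g] and continuous for the uniform norm, so the identity passes from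
    indicators to simple functions and on to bounded measurable ones. [F] stands for the product
    over the other slots. *)
Lemma Ex_indep_slot (F D : T -> R) (g : R -> R) c : bounded_measurable F ->
  measurable_fun [set: T] D ->
  (forall B, measurable B ->
    Ex (fun w => F w * \1_B (D w)) = c * Ex (fun w => \1_B (D w))) ->
  measurable_fun [set: R] g -> (exists M : R, forall x, `|g x| <= M) ->
  Ex (fun w => F w * g (D w)) = c * Ex (g \o D).
Proof.
move=> bF mD FB mg [M gM].
have bg : bounded_measurable (g \o D) by apply: bm_comp => //; exists M.
have [mF [MF FM]] := bF.
apply/eqP; rewrite -subr_eq0; apply/eqP.
apply: (@ler_norm_eps _ _ (MF + `|c|)) => e e0.
have [m [B [a [mB gB]]]] := bounded_simple_approx mg gM e0.
pose S w := \sum_(q < m) a q * \1_(B q) (D w).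
have bI q : bounded_measurable (fun w => \1_(B q) (D w) : R).
  by apply: (@bm_comp (\1_(B q))) => //; case: (@bm_indic _ _ R _ (mB q)).
have bS : bounded_measurable S by apply: bm_sum => i; apply: bmZ.
have ES : Ex (fun w => F w * S w) = c * Ex S.
  rewrite /S; under [X in Ex X]eq_fun do rewrite mulr_sumr.
  rewrite !Ex_sum; last 2 first.
  - by move=> i; apply: bmZ.
  - by move=> i; apply: bmM => //; apply: bmZ.
  rewrite mulr_sumr; apply: eq_bigr => q _.
  under [X in Ex X]eq_fun do rewrite mulrCA.
  by rewrite !ExZ ?FB// 1?mulrCA//; exact: bmM.
have -> : Ex (fun w => F w * g (D w)) - c * Ex (g \o D) =
    Ex (fun w => F w * (g (D w) - S w)) - c * Ex (fun w => g (D w) - S w).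
  rewrite (ExB P bg bS).
  under [X in _ = Ex X - _]eq_fun do rewrite mulrBr.
  by rewrite (ExB P (bmM bF bg) (bmM bF bS)) ES; lra.
have bgS : bounded_measurable (fun w => g (D w) - S w) by exact: bmB.
rewrite (le_trans (ler_normB _ _))// mulrDr lerD//.
  apply: le_normr_Ex; first exact: bmM.
  by move=> w; rewrite normrM mulrC ler_pM// gB.
rewrite normrM mulrC ler_pM//; apply: le_normr_Ex => // w; exact: gB.
Qed.

(** The product rule is known for events; the slots are freed from being indicators one at a
    time. *)
Lemma Ex_prod_indep (n : nat) (D : nat -> T -> R) (g : nat -> R -> R) :
  (forall i, measurable_fun [set: T] (D i)) ->
  (forall B : nat -> set R, (forall i, measurable (B i)) ->
    pr [set w | forall i, (i < n)%N -> B i (D i w)] =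
    \prod_(i < n) pr [set w | B i (D i w)]) ->
  (forall i, measurable_fun [set: R] (g i)) ->
  (forall i, exists M : R, forall x, `|g i x| <= M) ->
  Ex (fun w => \prod_(i < n) g i (D i w)) = \prod_(i < n) Ex (g i \o D i).
Proof.
move=> mD indep mg bg.
(* Invariant: the slots from [m] on carry indicators, those below [m] are arbitrary. At [m = 0] this
   is the hypothesis [indep], at [m = n] the claim. *)
suff H m : forall g : nat -> R -> R,
    (forall i, measurable_fun [set: R] (g i)) ->
    (forall i, exists M : R, forall x, `|g i x| <= M) ->
    (forall i, (m <= i < n)%N -> exists2 B, measurable B & g i = \1_B) ->
    Ex (fun w => \prod_(i < n) g i (D i w)) = \prod_(i < n) Ex (g i \o D i).
  by apply: (H n) => // i; rewrite ltnNge andbC; case: (_ <= _)%N.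
elim: m => {mg bg g} [|m IH] g mg bg gB.
  have /choice[B HB] : forall i, exists B, measurable B /\ ((i < n)%N -> g i = \1_B).
    move=> i; have [lin|nin] := ltnP i n; last by exists setT; split.
    by have [//|B mB ->] := gB i; exists B.
  have mB i := (HB i).1.
  have mDB i : measurable [set w | B i (D i w)].
    by rewrite -[X in measurable X]setTI; exact: mD.
  transitivity (pr [set w | forall i, (i < n)%N -> B i (D i w)]).
    have mA : measurable [set w | forall i, (i < n)%N -> B i (D i w)].
      rewrite [X in measurable X](_ : _ = \bigcap_(i in [set i | (i < n)%N]) [set w | B i (D i w)]) //.
      by apply: bigcap_measurableType.
    rewrite -Ex_indic//; congr Ex; apply/funext => w; rewrite indicE.
    have [/set_mem /= h|/negP h] := boolP (w \in _).
      rewrite big1// => i _; rewrite (HB i).2// indicE mem_set//; exact: h.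
    have [i /not_implyP[lin nB]] : exists i, ~ ((i < n)%N -> B i (D i w)).
      by apply/existsNP => h'; apply: h; exact/mem_set.
    rewrite (bigD1 (Ordinal lin))//= (HB i).2// indicE memNset// mul0r//.
  rewrite indep//; apply: eq_bigr => i _.
  by rewrite -Ex_indic// (HB i).2.
have [lmn|nmn] := ltnP m n; last first.
  apply: IH => // i /andP[mi lin].
  by have := leq_ltn_trans (leq_trans nmn mi) lin; rewrite ltnn.
pose Om := Ordinal lmn.
rewrite (bigD1 Om)//=.
under [X in Ex X]eq_fun do rewrite (bigD1 Om)//= mulrC.
rewrite [RHS]mulrC; apply: Ex_indep_slot => //.
  by apply: bm_prod => i; apply: bm_comp.
move=> B mB.
pose g' i := if i == m then \1_B else g i.
have E1 (i : 'I_n) : i != Om -> g' i = g i.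
  by rewrite /g' -val_eqE /= => /negbTE ->.
have E2 : g' Om = \1_B by rewrite /g' eqxx.
transitivity (Ex (fun w => \prod_(i < n) g' i (D i w))).
  congr Ex; apply/funext => w; rewrite [RHS](bigD1 Om)//= mulrC E2.
  by congr (_ * _); apply: eq_bigr => i iO; rewrite E1.
rewrite IH; first by rewrite [LHS](bigD1 Om)//= mulrC E2; congr (_ * _);
    apply: eq_bigr => i iO; rewrite E1.
- by move=> i; rewrite /g'; case: ifP => // _; exact: measurable_indic.
- move=> i; rewrite /g'; case: ifP => // _; exists 1 => x.
  by rewrite indicE; case: (_ \in _); rewrite ?normr1 ?normr0.
- move=> i /andP[mi lin]; rewrite /g'; case: ifPn => [_|im]; first by exists B.
  by apply: gB; rewrite lin andbT ltn_neqAle eq_sym im.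
Qed.

End independence.

(** * The law of stable integrals of step functions *)

Section trig_independence.
Context d (T : measurableType d) (R : realType) (P : probability T R).
Local Notation Ex := (@Ex d T R P).
Local Notation pr := (@pr d T R P).

(** Product of characteristic functions in real form: as every sine has mean 0, the addition
    formulas leave only the product of the cosines. *)
Lemma Ex_cos_indep (n : nat) (D : nat -> T -> R) (c phi : nat -> R) :
  (forall i, measurable_fun [set: T] (D i)) ->
  (forall B : nat -> set R, (forall i, measurable (B i)) ->
    pr [set w | forall i, (i < n)%N -> B i (D i w)] =
    \prod_(i < n) pr [set w | B i (D i w)]) ->
  (forall i, Ex (fun w => cos (c i * D i w)) = phi i) ->
  (forall i, Ex (fun w => sin (c i * D i w)) = 0) ->
  Ex (fun w => cos (\sum_(i < n) c i * D i w)) = \prod_(i < n) phi i.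
Proof.
move=> mD indep Ecos Esin.
have mcos k : measurable_fun [set: R] (fun x => cos (k * x)).
  by apply: (@bm_cos _ _ _ ( *%R k) _).1; exact: mulrl_measurable.
have msin k : measurable_fun [set: R] (fun x => sin (k * x)).
  by apply: (@bm_sin _ _ _ ( *%R k) _).1; exact: mulrl_measurable.
(* The first [m] terms are gathered in a cosine or a sine while the other slots carry arbitrary
   bounded functions, so that the cosine or sine of term [m] can be put into slot [m]. *)
suff H m : (m <= n)%N -> forall g : nat -> R -> R,
    (forall i, measurable_fun [set: R] (g i)) ->
    (forall i, exists M : R, forall x, `|g i x| <= M) ->
    Ex (fun w => cos (\sum_(0 <= i < m) c i * D i w) *
        \prod_(m <= i < n) g i (D i w)) =
      (\prod_(0 <= i < m) phi i) * \prod_(m <= i < n) Ex (g i \o D i) /\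
    Ex (fun w => sin (\sum_(0 <= i < m) c i * D i w) *
        \prod_(m <= i < n) g i (D i w)) = 0.
  have [] := H n (leqnn n) (fun _ => cst 0).
  - by move=> i; exact: measurable_cst.
  - by move=> i; exists 0 => x; rewrite /cst normr0.
  rewrite [X in _ * X]big_geq// mulr1 big_mkord => <- _; congr Ex.
  by apply/funext => w; rewrite [X in _ * X]big_geq// mulr1 big_mkord.
elim: m => [_|m IH mn] g mg bg.
  split.
    rewrite [X in X * _]big_geq// mul1r big_mkord -Ex_prod_indep//; congr Ex.
    by apply/funext => w; rewrite [X in cos X]big_geq// cos0 mul1r big_mkord.
  rewrite -[RHS](Ex_cst P 0); congr Ex; apply/funext => w.
  by rewrite [X in sin X]big_geq// sin0 mul0r.
pose upd (h : R -> R) i := if i == m then h else g i.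
have mupd h : measurable_fun [set: R] h ->
    forall i, measurable_fun [set: R] (upd h i).
  by move=> mh i; rewrite /upd; case: ifP.
have bupd h : (exists M : R, forall x, `|h x| <= M) ->
    forall i, exists M : R, forall x, `|upd h i x| <= M.
  by move=> mh i; rewrite /upd; case: ifP.
have updE h i : (m < i)%N -> upd h i = g i.
  by move=> mi; rewrite /upd gtn_eqF.
have bdS (A : T -> R) : measurable_fun [set: T] A -> forall h : nat -> R -> R, (forall i, measurable_fun [set: R] (h i)) ->
    (forall i, exists M : R, forall x, `|h i x| <= M) ->
    bounded_measurable (fun w => cos (A w) * \prod_(m <= i < n) h i (D i w)) /\
    bounded_measurable (fun w => sin (A w) * \prod_(m <= i < n) h i (D i w)).
  move=> mA h mh bh; split; apply: bmM; (try by [exact: bm_cos|exact: bm_sin]);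
  by apply: bm_prod => i; apply: bm_comp.
have mA : measurable_fun [set: T] (fun w => \sum_(0 <= i < m) c i * D i w).
  apply: measurable_sum => i; apply: measurable_funM => //.
have bc k : exists M : R, forall x, `|cos (k * x)| <= M by exists 1 => x; exact: cos_max.
have bs k : exists M : R, forall x, `|sin (k * x)| <= M by exists 1 => x; exact: sin_max.
have [cc sc] := IH (ltnW mn) _ (mupd _ (mcos (c m))) (bupd _ (bc (c m))).
have [cs ss] := IH (ltnW mn) _ (mupd _ (msin (c m))) (bupd _ (bs (c m))).
have [Bcc Bsc] := bdS _ mA _ (mupd _ (mcos (c m))) (bupd _ (bc (c m))).
have [Bcs Bss] := bdS _ mA _ (mupd _ (msin (c m))) (bupd _ (bs (c m))).
have PE h w : \prod_(m <= i < n) upd h i (D i w) =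
    h (D m w) * \prod_(m.+1 <= i < n) g i (D i w).
  rewrite big_ltn// {1}/upd eqxx; congr (_ * _).
  by apply: eq_big_nat => i /andP[mi _]; rewrite updE.
have PE' h : \prod_(m <= i < n) Ex (upd h i \o D i) =
    Ex (h \o D m) * \prod_(m.+1 <= i < n) Ex (g i \o D i).
  rewrite big_ltn// {1}/upd eqxx; congr (_ * _).
  by apply: eq_big_nat => i /andP[mi _]; rewrite updE.
split.
- transitivity (Ex (fun w => cos (\sum_(0 <= i < m) c i * D i w) *
      (\prod_(m <= i < n) upd (fun x => cos (c m * x)) i (D i w)) -
    sin (\sum_(0 <= i < m) c i * D i w) *
      (\prod_(m <= i < n) upd (fun x => sin (c m * x)) i (D i w)))).
    congr Ex; apply/funext => w; rewrite !PE big_nat_recr//= cosD; ring.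
  rewrite ExB// cc ss subr0 PE' (_ : Ex (_ \o _) = phi m); last exact: Ecos.
  by rewrite big_nat_recr//= mulrA.
- transitivity (Ex (fun w => sin (\sum_(0 <= i < m) c i * D i w) *
      (\prod_(m <= i < n) upd (fun x => cos (c m * x)) i (D i w)) +
    cos (\sum_(0 <= i < m) c i * D i w) *
      (\prod_(m <= i < n) upd (fun x => sin (c m * x)) i (D i w)))).
    congr Ex; apply/funext => w; rewrite !PE big_nat_recr//= sinD; ring.
  rewrite ExD// sc cs PE' (_ : Ex (_ \o _) = 0); last exact: Esin.
  by rewrite mul0r mulr0 addr0.
Qed.

End trig_independence.

Section step_law.
Context d (T : measurableType d) (R : realType) (P : probability T R).
Context (alpha : R) (Z : R -> {RV P >-> R}).
Local Notation Ex := (@Ex d T R P).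
Local Notation pr := (@pr d T R P).
Implicit Types s : seq (R * R * R).

(** The [alpha]-th power of the norm of L^alpha. No root is taken: this is the parameter
    [sigma_alpha] of the integral of [f], and it is additive over disjoint supports. *)
Definition pnorm (f : R -> R) : \bar R :=
  (\int[lebesgue_measure]_x (`|f x| `^ alpha)%:E)%E.

Definition nodes s := sort <=%R (flatten [seq [:: p.1.2; p.2] | p <- s]).
(** Constant past the last node, hence nondecreasing on all of [nat] as [independent_increments]
    demands; for an empty list every node is 0. *)
Definition node s (i : nat) := nth 0 (nodes s) (minn i (size (nodes s)).-1).

Lemma node_homo s : {homo node s : i j / (i <= j)%N >-> i <= j}.
Proof.
move=> i j ij; rewrite /node.
have sorts : sorted <=%R (nodes s) by apply: sort_sorted; exact: le_total.
case n0 : (size (nodes s)) => [|n].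
  by rewrite !nth_default ?n0.
apply: (sorted_leq_nth le_trans lexx) => //; rewrite ?inE ?n0/=.
- by rewrite ltnS geq_minr.
- by rewrite ltnS geq_minr.
- by rewrite leq_min geq_minr andbT (leq_trans (geq_minl _ _)).
Qed.

Lemma node_surj s x : x \in nodes s ->
  exists2 k, (k < size (nodes s))%N & x = node s k.
Proof.
move=> /(nthP 0)[k ks <-]; exists k => //; rewrite /node; congr nth.
by apply/esym/minn_idPl; case: (size _) ks.
Qed.

(** The increments up to [x] telescope. Nodes may repeat, but a later cell whose right end is still
    at most [x] has length 0. *)
Lemma telescope_node (F : R -> R) s x : x \in nodes s ->
  \sum_(i < size (nodes s)) (node s i.+1 <= x)%R%:R *
    (F (node s i.+1) - F (node s i)) = F x - F (node s 0).
Proof.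
move=> /node_surj[k ks ->].
rewrite -(big_mkord xpredT (fun i => (node s i.+1 <= node s k)%R%:R *
  (F (node s i.+1) - F (node s i)))).
rewrite (big_cat_nat (n := k))//=; last exact: ltnW.
rewrite [X in _ + X]big_nat_cond [X in _ + X]big1 ?addr0; last first.
  move=> i; rewrite andbT => /andP[ki _].
  have [h|] := boolP (_ <= _); last by rewrite mul0r.
  have -> : node s i.+1 = node s i; last by rewrite subrr mulr0.
  apply/eqP; rewrite eq_le (le_trans h (node_homo _ _))//=.
  exact: node_homo.
rewrite (eq_big_nat _ _ (F2 := fun i => F (node s i.+1) - F (node s i))).
  by rewrite telescope_sumr.
by move=> i /andP[_ ik]; rewrite (@node_homo s _ _ _)// mul1r.
Qed.

Lemma indic_ocE (a b x : R) : a <= b ->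
  \1_(`]a, b]%classic) x = (x <= b)%R%:R - (x <= a)%R%:R :> R.
Proof.
move=> ab; rewrite indicE mem_setE in_itv/=.
by case: (ltP a x) => [|/le_trans/(_ ab) ->]; rewrite ?subr0 ?subrr.
Qed.

(** Passage from overlapping intervals to the common partition. [F] is arbitrary in order to serve
    twice: with [F = Z] for the integral, and with the truth value of x <= z as a function of z for
    the step function itself. *)
Lemma step_sum_nodes (F : R -> R) s : step_valid s ->
  \sum_(p <- s) p.1.1 * (F p.2 - F p.1.2) =
  \sum_(i < size (nodes s)) step_fun s (node s i.+1) *
    (F (node s i.+1) - F (node s i)).
Proof.
move=> vs; rewrite /step_fun.
under [RHS]eq_bigr do rewrite mulr_suml.
rewrite exchange_big/= [LHS]big_seq [RHS]big_seq; apply: eq_bigr => -[[c a] b] ps /=.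
have ab : a <= b by move/allP: vs => /(_ _ ps).
have an : a \in nodes s.
  rewrite mem_sort; apply/flattenP; exists [:: a; b]; rewrite ?inE ?eqxx//.
  by apply/mapP; exists (c, a, b).
have bn : b \in nodes s.
  rewrite mem_sort; apply/flattenP; exists [:: a; b]; rewrite ?inE ?eqxx ?orbT//.
  by apply/mapP; exists (c, a, b).
under eq_bigr do rewrite -mulrA; rewrite -mulr_sumr; congr (_ * _).
transitivity (F b - F (node s 0) - (F a - F (node s 0))); first by ring.
rewrite -!telescope_node// -sumrB; apply: eq_bigr => i _.
by rewrite -mulrBl indic_ocE.
Qed.

Lemma step_fun_nodes s x : step_valid s ->
  step_fun s x = \sum_(i < size (nodes s)) step_fun s (node s i.+1) *
    \1_(`]node s i, node s i.+1]%classic) x.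
Proof.
move=> vs; rewrite {1}/step_fun.
transitivity (\sum_(p <- s) p.1.1 * ((x <= p.2)%R%:R - (x <= p.1.2)%R%:R : R)).
  rewrite big_seq [RHS]big_seq; apply: eq_bigr => p ps; rewrite indic_ocE//.
  by move/allP: vs => /(_ _ ps).
rewrite (step_sum_nodes (fun z => (x <= z)%R%:R))//; apply: eq_bigr => i _.
by rewrite indic_ocE// node_homo.
Qed.

(** The half-open cells are disjoint: at most one term is nonzero, and the power can be taken term
    by term. *)
Lemma step_fun_pow s x : 0 < alpha -> step_valid s ->
  `|step_fun s x| `^ alpha = \sum_(i < size (nodes s))
    `|step_fun s (node s i.+1)| `^ alpha * \1_(`]node s i, node s i.+1]%classic) x.
Proof.
move=> a0 vs; rewrite {1}step_fun_nodes//.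
have [[i xi]|nx] := pselect (exists i : 'I_(size (nodes s)), x \in `]node s i, node s i.+1]%classic).
  have H (k : 'I_(size (nodes s))) : k != i -> \1_(`]node s k, node s k.+1]%classic) x = 0 :> R.
    move=> ki; rewrite indicE; case: (boolP (_ \in _)) => // xk; exfalso.
    move: xi xk; rewrite !mem_setE !in_itv/= => /andP[i1 i2] /andP[k1 k2].
    move: ki; rewrite -val_eqE /= neq_ltn => /orP[ki|ik].
      have := @node_homo s _ _ ki; rewrite leNgt => /negP; apply.
      exact: lt_le_trans i1 k2.
    have := @node_homo s _ _ ik; rewrite leNgt => /negP; apply.
    exact: lt_le_trans k1 i2.
  rewrite (bigD1 i)//= big1; last by move=> k ki; rewrite H// mulr0.
  rewrite (bigD1 i)//= big1; last by move=> k ki; rewrite H// mulr0.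
  by rewrite !indicE xi !mulr1 !addr0.
have H (k : 'I_(size (nodes s))) : \1_(`]node s k, node s k.+1]%classic) x = 0 :> R.
  by rewrite indicE; case: (boolP (_ \in _)) => // xk; exfalso; apply: nx; exists k.
rewrite !big1; last 2 first.
- by move=> k _; rewrite H mulr0.
- by move=> k _; rewrite H mulr0.
by rewrite normr0 powR0// gt_eqF.
Qed.

Lemma pnorm_step s : 0 < alpha -> step_valid s ->
  pnorm (step_fun s) = (\sum_(i < size (nodes s))
    `|step_fun s (node s i.+1)| `^ alpha * (node s i.+1 - node s i))%:E.
Proof.
move=> a0 vs; rewrite /pnorm; under eq_integral do rewrite step_fun_pow// -sumEFin.
rewrite ge0_integral_sum//=; last first.
  by move=> i; apply/measurable_EFinP; apply: measurable_funM;
    [exact: measurable_cst|apply: measurable_indic; exact: measurable_itv].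
rewrite -sumEFin; apply: eq_bigr => i _.
under eq_integral do rewrite EFinM.
rewrite ge0_integralZl_EFin//; last first.
  by apply/measurable_EFinP; apply: measurable_indic; exact: measurable_itv.
rewrite integral_indic//= setIT EFinM lebesgue_measure_itv/= lte_fin.
have := @node_homo s _ _ (leqnSn i); rewrite le_eqVlt => /predU1P[->|->] //.
by rewrite ltxx subrr.
Qed.

Lemma step_integral_cos s (xi : R) : 0 < alpha -> SaS_Levy_process alpha Z ->
  step_valid s ->
  Ex (fun w => cos (xi * step_integral Z s w)) =
  expR (- (`|xi| `^ alpha * fine (pnorm (step_fun s)))).
Proof.
move=> a0 [_ indep law _] vs.
rewrite pnorm_step//=.
pose D i w := Z (node s i.+1) w - Z (node s i) w.
pose c i := xi * step_fun s (node s i.+1).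
pose phi i := expR (- ((node s i.+1 - node s i) * `|c i| `^ alpha)).
transitivity (Ex (fun w => cos (\sum_(i < size (nodes s)) c i * D i w))).
  congr Ex; apply/funext => w; rewrite /step_integral (step_sum_nodes (fun z => Z z w))//.
  by rewrite mulr_sumr; congr cos; apply: eq_bigr => i _; rewrite mulrA.
rewrite (Ex_cos_indep (phi := phi)).
- rewrite -expR_sum; congr expR; rewrite mulr_sumr -sumrN.
  apply: eq_bigr => i _; rewrite /c normrM powRM//; ring.
- move=> i; exact: measurable_funB.
- move=> B mB; rewrite /pr indep//; last exact: node_homo.
  have -> : (\prod_(i < size (nodes s)) P [set w | B i (D i w)] =
      (\prod_(i < size (nodes s)) fine (P [set w | B i (D i w)]))%:E)%E; last by [].
  rewrite -prodEFin; apply: eq_bigr => i _; rewrite fineK// fin_num_measure//.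
  rewrite -[X in measurable X]setTI; apply: measurable_funB => //.
- move=> i; have [+ _] := law (node s i) (node s i.+1) (c i).
  rewrite unlock /Ex /Rintegral => -> /=; rewrite /phi ger0_norm// subr_ge0.
  exact: node_homo.
- move=> i; have [_ +] := law (node s i) (node s i.+1) (c i).
  by rewrite unlock /Ex /Rintegral => -> /=.
Qed.

End step_law.

(** * Symmetric stable variables *)

Section SaS_law.
Context d (T : measurableType d) (R : realType) (P : probability T R).
Context (alpha sigma : R) (W : T -> R).
Local Notation Ex := (@Ex d T R P).
Local Notation pr := (@pr d T R P).
Context (alpha_ge1 : 1 <= alpha) (sigma_ge0 : 0 <= sigma).
Context (mW : measurable_fun [set: T] W).
Context (W_cos : forall xi, Ex (fun w => cos (xi * W w)) =
  expR (- (`|xi| `^ alpha * sigma))).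

Lemma bm_cosM (f : T -> R) xi : measurable_fun [set: T] f ->
  bounded_measurable (fun w => cos (xi * f w)).
Proof. by move=> mf; apply: bm_cos; apply: measurable_funM. Qed.

Lemma expRN_ge1B (x : R) : 1 - x <= expR (- x).
Proof. exact: expR_ge1Dx. Qed.

Lemma measurable_norm_ge (f : T -> R) x : measurable_fun [set: T] f ->
  measurable [set w | x <= `|f w|].
Proof.
move=> mf; rewrite -[X in measurable X]setTI.
have -> : [set w | x <= `|f w|] = (fun w => `|f w|) @^-1` `[x, +oo[%classic.
  by apply/seteqP; split=> w /=; rewrite in_itv/= andbT.
by apply: (measurableT_comp (@normr_measurable R setT) mf) => //; exact: measurable_itv.
Qed.

Lemma measurable_norm_le (f : T -> R) x : measurable_fun [set: T] f ->
  measurable [set w | `|f w| <= x].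
Proof.
move=> mf; rewrite -[X in measurable X]setTI.
have -> : [set w | `|f w| <= x] = (fun w => `|f w|) @^-1` `]-oo, x]%classic.
  by apply/seteqP; split=> w /=; rewrite in_itv.
by apply: (measurableT_comp (@normr_measurable R setT) mf) => //; exact: measurable_itv.
Qed.

Lemma cos1_lt1 : cos (1 : R) < 1.
Proof.
rewrite -[ltRHS]cos0 ltr_cos ?in_itv/= ?lexx ?ltr01 ?pi_ge0//.
by rewrite ler01 (le_trans _ (pi_ge2 R))// ler1n.
Qed.

(** For 1 <= |W| / x <= 2, inside [0, pi] where cos decreases, 1 - cos (W / x) is at least 1 - cos
    1, while its mean is 1 - exp (- x^(- alpha) sigma). *)
Lemma SaS_layer x : 0 < x ->
  pr ([set w | x <= `|W w|] `&` ~` [set w | 2 * x <= `|W w|]) <=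
  (1 - cos 1)^-1 * (x `^ (- alpha) * sigma).
Proof.
move=> x0.
have c1 : 0 < 1 - cos (1 : R) by rewrite subr_gt0 cos1_lt1.
pose f w := 1 - cos (x^-1 * W w).
have bf : bounded_measurable f by apply: bmB; [exact: bm_cst|exact: bm_cosM].
have f0 w : 0 <= f w by rewrite subr_ge0 cos_le1.
apply: (@le_trans _ _ (Ex f / (1 - cos 1))).
  apply: pr_markov => //.
    apply: measurableI; first exact: measurable_norm_ge.
    by apply: measurableC; exact: measurable_norm_ge.
  move=> w [/= xW /negP]; rewrite -ltNge => Wx.
  rewrite /f lerD2l lerN2 -[X in cos X]/(x^-1 * W w) -(cos_norm (x^-1 * W w)).
  have H1 : 1 <= `|x^-1 * W w|.
    by rewrite normrM gtr0_norm ?invr_gt0// ler_pdivlMl// mulr1.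
  have H2 : `|x^-1 * W w| <= 2.
    by rewrite normrM gtr0_norm ?invr_gt0// ler_pdivrMl// mulrC ltW.
  have I1 : (1 : R) \in `[0, pi].
    by rewrite in_itv/= ler01 (le_trans _ (pi_ge2 R))// ler1n.
  have IW : `|x^-1 * W w| \in `[0, pi] by rewrite in_itv/= normr_ge0 (le_trans H2 (pi_ge2 R)).
  by move: H1; rewrite le_eqVlt => /predU1P[<-//|H1]; rewrite ltW// ltr_cos.
rewrite mulrC; apply: ler_wpM2l; first by rewrite invr_ge0 ltW.
rewrite /f (ExB P (bm_cst 1)); last exact: bm_cosM.
rewrite Ex_cst W_cos gtr0_norm ?invr_gt0//.
have -> : x^-1 `^ alpha = x `^ (- alpha) by rewrite -powR_inv1 ?ltW// -powRrM mulN1r.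
have := expRN_ge1B (x `^ (- alpha) * sigma); lra.
Qed.

(** The event is cut into layers 2^n x <= |W| < 2^(n+1) x. Since alpha >= 1 their bounds decrease at
    least like 2^(- n) and add up to at most twice the first one. *)
Lemma SaS_tail x : 0 < x ->
  pr [set w | x <= `|W w|] <= 2 / (1 - cos 1) * (x `^ (- alpha) * sigma).
Proof.
move=> x0.
have c1 : 0 < 1 - cos (1 : R) by rewrite subr_gt0 cos1_lt1.
pose A n := [set w | 2 ^+ n * x <= `|W w|].
have mA n : measurable (A n) by exact: measurable_norm_ge.
pose B n := A 0 `&` ~` A n.
have mB n : measurable (B n) by apply: measurableI => //; exact: measurableC.
(* 2 - 2 * 2^(- n) is the sum of 2^(- i) over i < n. *)
have BL n : pr (B n) <= (1 - cos 1)^-1 * (x `^ (- alpha) * sigma) * (2 - 2 * 2^-1 ^+ n).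
  elim: n => [|n IH].
    by rewrite expr0 mulr1 subrr mulr0 /B setICr /pr measure0.
  have BS : B n.+1 `<=` B n `|` (A n `&` ~` A n.+1).
    move=> w [A0 An1]; have [An|An] := pselect (A n w); first by right.
    by left.
  have An : pr (A n `&` ~` A n.+1) <=
      (1 - cos 1)^-1 * (x `^ (- alpha) * sigma) * 2^-1 ^+ n.
    rewrite /A exprS -[2 * _ * x]mulrA.
    apply: (le_trans (SaS_layer _)); first by rewrite mulr_gt0// exprn_gt0.
    rewrite -mulrA; apply: ler_wpM2l; first by rewrite invr_ge0 ltW.
    have -> : (2 ^+ n * x) `^ (- alpha) * sigma =
        (x `^ (- alpha) * sigma) * (2 ^+ n) `^ (- alpha).
      by rewrite powRM ?exprn_ge0 ?(ltW x0)//; ring.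
    apply: ler_wpM2l; first by rewrite mulr_ge0 ?powR_ge0.
    rewrite powRN exprVn lef_pV2 ?posrE ?powR_gt0 ?exprn_gt0//.
    by rewrite le1r_powR// exprn_ege1// ler1n.
  apply: (le_trans (le_pr P (mB n.+1) _ BS)).
    by apply: measurableU => //; apply: measurableI => //; exact: measurableC.
  apply: (le_trans (prU _ _ _)) => //.
    by apply: measurableI => //; exact: measurableC.
  apply: (le_trans (lerD IH An)); rewrite -mulrDr.
  apply: ler_wpM2l; first by rewrite !mulr_ge0// ?invr_ge0 ?powR_ge0 ?(ltW c1).
  by rewrite exprS; lra.
(* The layers exhaust the event, so its probability is the limit along the increasing [B n]. *)
have BU : [set w | x <= `|W w|] = \bigcup_n B n.
  apply/seteqP; split=> [w /= xw|w [n _ []]]; last by rewrite /A /= expr0 mul1r.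
  have [n nw] : exists n, `|W w| / x < n%:R.
    exists (Num.truncn (`|W w| / x)).+1.
    by have /andP[] := Num.Theory.truncn_itv (divr_ge0 (normr_ge0 (W w)) (ltW x0)).
  exists n => //; split; first by rewrite /A /= expr0 mul1r.
  rewrite /A /=; apply/negP; rewrite -ltNge -ltr_pdivrMr//; apply: (lt_le_trans nw).
  by rewrite -natrX ler_nat ltnW// ltn_expl.
have ndB : nondecreasing_seq B.
  move=> m n mn; apply/subsetPset => w [A0 Am]; split=> // An; apply: Am.
  rewrite /A /=; apply: (le_trans _ An); rewrite ler_pM2r//.
  by rewrite ler_eXn2l// ltr1n.
have mBU : measurable (\bigcup_n B n) by exact: bigcupT_measurable.
have := @nondecreasing_cvg_mu _ _ _ P B mB mBU ndB.
rewrite -lee_fin -prE ?BU// => cvB.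
apply: (cvge_le _ cvB).
apply: nearW => n /=; rewrite prE// lee_fin (le_trans (BL n))//.
have -> : 2 / (1 - cos 1) * (x `^ (- alpha) * sigma) =
    (1 - cos 1)^-1 * (x `^ (- alpha) * sigma) * 2 by ring.
apply: ler_wpM2l; first by rewrite !mulr_ge0// ?invr_ge0 ?powR_ge0 ?(ltW c1).
have : (0 : R) <= 2^-1 ^+ n by rewrite exprn_ge0// invr_ge0.
by lra.
Qed.

(** A bound through characteristic functions instead of densities. On the event each cos (n xi W), 1
    <= n <= N, is at least cos 1, hence so is their average; its second moment is at most 1 / N from
    the diagonal plus the characteristic function at frequencies of modulus >= xi. *)
Lemma SaS_small_ball (N : nat) xi : (0 < N)%N -> 0 < xi ->
  pr [set w | `|W w| <= (N%:R * xi)^-1] <=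
  (cos 1 ^+ 2)^-1 * (N%:R^-1 + expR (- (xi `^ alpha * sigma))).
Proof.
move=> N0 xi0.
have N0R : 0 < N%:R :> R by rewrite ltr0n.
have c1 := cos1_gt0 R.
pose C (n : nat) w := cos (n.+1%:R * xi * W w).
pose A w := N%:R^-1 * \sum_(n < N) C n w.
have bC n : bounded_measurable (C n) by exact: bm_cosM.
have bA : bounded_measurable A by apply: bmZ; exact: bm_sum.
have Cphi k : k != 0 -> Ex (fun w => cos (k%:~R * xi * W w)) <= expR (- (xi `^ alpha * sigma)).
  move=> k0; rewrite W_cos ler_expR lerN2; apply: ler_wpM2r => //.
  apply: ge0_ler_powR; rewrite ?nnegrE ?normr_ge0 ?(ltW xi0) ?(le_trans ler01)//.
  rewrite normrM (gtr0_norm xi0) ler_peMl ?(ltW xi0)//.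
  by rewrite -intr_norm -[1]/(1%:~R) ler_int; case: k k0 => [[]|].
have CC (n m : 'I_N) : Ex (fun w => C n w * C m w) <=
    expR (- (xi `^ alpha * sigma)) + (n == m)%:R.
  (* Product to sum: the multiple n + m + 2 of xi is never 0, and n - m vanishes only on the
     diagonal. *)
  have E : Ex (fun w => C n w * C m w) = 2^-1 *
      (Ex (fun w => cos ((n%:Z + m%:Z + 2)%:~R * xi * W w)) +
       Ex (fun w => cos ((n%:Z - m%:Z)%:~R * xi * W w))).
    have bc (k : R) : bounded_measurable (fun w => cos (k * W w)) by exact: bm_cosM.
    rewrite -(ExD P (bc _) (bc _)) -(ExZ P _ (bmD (bc _) (bc _))).
    congr Ex; apply/funext => w.
    have -> : (n%:Z + m%:Z + 2)%:~R * xi * W w =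
      n.+1%:R * xi * W w + m.+1%:R * xi * W w.
      by rewrite !intrD -[n.+1%:R]natr1 -[m.+1%:R]natr1 !pmulrn; ring.
    have -> : (n%:Z - m%:Z)%:~R * xi * W w =
      n.+1%:R * xi * W w - m.+1%:R * xi * W w.
      by rewrite intrB -[n.+1%:R]natr1 -[m.+1%:R]natr1 !pmulrn; ring.
    by rewrite cosD cosB /C; field.
  rewrite E; have n2 : n%:Z + m%:Z + 2 != 0 by rewrite gt_eqF// ltr_wpDl// addr_ge0.
  have H1 := Cphi _ n2.
  move: H1; case: eqP => [<-|/eqP nm] H1.
    rewrite subrr; under [X in _ + Ex X]eq_fun do rewrite !mul0r cos0.
    rewrite Ex_cst/=; have := expR_ge0 (- (xi `^ alpha * sigma)). by lra.
  have H2 : n%:Z - m%:Z != 0 by rewrite subr_eq0; apply: contra nm => /eqP[/val_inj ->].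
  by have := Cphi _ H2; rewrite /=; lra.
have EA : Ex (fun w => A w * A w) <= N%:R^-1 + expR (- (xi `^ alpha * sigma)).
  have -> : Ex (fun w => A w * A w) = N%:R^-2 * \sum_(n < N) \sum_(m < N) Ex (fun w => C n w * C m w).
    transitivity (Ex (fun w => N%:R^-2 * \sum_(n < N) \sum_(m < N) C n w * C m w)).
      congr Ex; apply/funext => w; rewrite /A mulrACA -exprVn expr2; congr (_ * _).
      by rewrite mulr_suml; apply: eq_bigr => i _; rewrite mulr_sumr.
    rewrite ExZ; last by do 2 (apply: bm_sum => ?); exact: bmM.
    rewrite Ex_sum; last by move=> i; apply: bm_sum => ?; exact: bmM.
    by congr (_ * _); apply: eq_bigr => i _; rewrite Ex_sum// => j; exact: bmM.
  apply: (@le_trans _ _ (N%:R^-2 * \sum_(n < N) \sum_(m < N) (expR (- (xi `^ alpha * sigma)) + (n == m)%:R))).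
    apply: ler_wpM2l; first by rewrite invr_ge0 exprn_ge0.
    by apply: ler_sum => n _; apply: ler_sum => m _; exact: CC.
  set c := expR _.
  have inner (n : 'I_N) : \sum_(m < N) (c + (n == m)%:R) = N%:R * c + 1.
    rewrite big_split/= sumr_const card_ord mulr_natl; congr (_ + _).
    by rewrite (bigD1 n)//= eqxx big1 ?addr0// => m nm; rewrite eq_sym (negbTE nm).
  under eq_bigr do rewrite inner.
  rewrite sumr_const card_ord -[X in _ * X <= _]mulr_natl.
  rewrite le_eqVlt; apply/orP; left; apply/eqP; field.
  by rewrite gt_eqF.
apply: (@le_trans _ _ (Ex (fun w => A w * A w) / cos 1 ^+ 2)); last first.
  by rewrite mulrC; apply: ler_wpM2l => //; rewrite invr_ge0 exprn_ge0// ltW.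
apply: pr_markov; rewrite ?exprn_gt0//.
- exact: measurable_norm_le.
- exact: bmM.
- by move=> w; rewrite -expr2 sqr_ge0.
move=> w /= Ww.
have A1 : cos 1 <= A w.
  rewrite /A ler_pdivlMl// mulr_natl -[X in _ *+ X](card_ord N) -sumr_const.
  apply: ler_sum => n _; rewrite /C -[leRHS]cos_norm.
  set t := `|_|.
  have t1 : t <= 1.
    rewrite /t !normrM (gtr0_norm xi0) ger0_norm ?ler0n//.
    apply: (@le_trans _ _ (N%:R * xi * (N%:R * xi)^-1)); last first.
      by rewrite divff// mulf_neq0 ?gt_eqF.
    apply: ler_pM => //; first by rewrite mulr_ge0 ?ler0n ?(ltW xi0).
    by rewrite ler_pM2r// ler_nat.
  have pi1 : (1 : R) <= pi by rewrite (le_trans _ (pi_ge2 R))// ler1n.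
  have I1 : (1 : R) \in `[0, pi] by rewrite in_itv/= ler01.
  have It : t \in `[0, pi] by rewrite in_itv/= normr_ge0 (le_trans t1 pi1).
  by move: t1; rewrite le_eqVlt => /predU1P[->//|t1]; rewrite ltW// ltr_cos.
by rewrite expr2; apply: ler_pM => //; exact: ltW.
Qed.

End SaS_law.

(** * Maximum of stable integrals *)

Section step_operations.
Context d (T : measurableType d) (R : realType) (P : probability T R).
Context (Z : R -> {RV P >-> R}).
Implicit Types s : seq (R * R * R).

Definition step_scale (c : R) s : seq (R * R * R) :=
  [seq (c * p.1.1, p.1.2, p.2) | p <- s].

Definition clamp (l r x : R) := Num.min (Num.max x l) r.

(** Clamping both ends collapses an interval that misses ]l, r] to an empty one, which is still
    valid and contributes 0. *)
Definition step_restrict (l r : R) s : seq (R * R * R) :=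
  [seq (p.1.1, clamp l r p.1.2, clamp l r p.2) | p <- s].

Lemma step_scale_valid c s : step_valid s -> step_valid (step_scale c s).
Proof. by rewrite /step_valid all_map. Qed.

Lemma step_fun_scale c s x : step_fun (step_scale c s) x = c * step_fun s x.
Proof.
by rewrite /step_fun big_map mulr_sumr; apply: eq_bigr => p _; rewrite /= mulrA.
Qed.

Lemma step_integral_scale c s w :
  step_integral Z (step_scale c s) w = c * step_integral Z s w.
Proof.
by rewrite /step_integral big_map mulr_sumr; apply: eq_bigr => p _; rewrite /= mulrA.
Qed.

Lemma step_cat_valid s s' : step_valid s -> step_valid s' -> step_valid (s ++ s').
Proof. by rewrite /step_valid all_cat => -> ->. Qed.

Lemma step_fun_cat s s' x : step_fun (s ++ s') x = step_fun s x + step_fun s' x.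
Proof. by rewrite /step_fun big_cat. Qed.

Lemma step_integral_cat s s' w :
  step_integral Z (s ++ s') w = step_integral Z s w + step_integral Z s' w.
Proof. by rewrite /step_integral big_cat. Qed.

Lemma clamp_le l r x y : x <= y -> clamp l r x <= clamp l r y.
Proof.
by move=> xy; rewrite /clamp le_min !ge_min ge_max !le_max xy !lexx !orbT.
Qed.

Lemma step_restrict_valid l r s : step_valid s -> step_valid (step_restrict l r s).
Proof.
rewrite /step_valid all_map => /allP vs; apply/allP => p ps /=.
by apply: clamp_le; exact: vs.
Qed.

Lemma step_fun_restrict l r s x : l <= r -> step_valid s ->
  step_fun (step_restrict l r s) x = step_fun s x * \1_(`]l, r]%classic) x.
Proof.
move=> lr /allP vs; rewrite /step_fun big_map mulr_suml big_seq [RHS]big_seq.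
apply: eq_bigr => -[[c a] b] ps; rewrite -mulrA; congr (_ * _).
have /= ab := vs _ ps; rewrite !indicE !mem_setE !in_itv/= /clamp.
rewrite !(lt_min, gt_min, le_min, ge_min, lt_max, gt_max, le_max, ge_max).
rewrite -natrM mulnb; congr (_ : bool)%:R.
case: (ltP a x) (ltP l x) (ltP r x) (leP x b) (leP x l) (leP x r) =>
  h1 [] h2 [] h3 [] h4 [] h5 [] h6 //=; lra.
Qed.

Lemma measurable_step_integral s : measurable_fun [set: T] (step_integral Z s).
Proof.
apply: measurable_sum => p; apply: measurable_funM => //; exact: measurable_funB.
Qed.

Lemma measurable_step_fun s : measurable_fun [set: R] (step_fun s).
Proof.
by apply: measurable_sum => p; apply: measurable_funM.
Qed.

End step_operations.


(** * Joint small values of step integrals with disjoint supports *)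

Section max_lower_bound.
Context d (T : measurableType d) (R : realType) (P : probability T R).
Context (alpha : R) (alpha12 : 1 < alpha < 2).
Context (Z : R -> {RV P >-> R}) (hZ : SaS_Levy_process alpha Z).
Local Notation Ex := (@Ex d T R P).
Local Notation pr := (@pr d T R P).
Implicit Types s : seq (R * R * R).

Definition step_scale_par s : R := fine (pnorm alpha (step_fun s)).
Local Notation pn := step_scale_par.

Let alpha0 : 0 < alpha. Proof. by case/andP: alpha12 => /(lt_trans ltr01). Qed.

Lemma pnormE s : step_valid s -> pnorm alpha (step_fun s) = (pn s)%:E.
Proof. by move=> vs; rewrite /pn pnorm_step. Qed.

Lemma pn_ge0 s : 0 <= pn s.
Proof. by apply: fine_ge0; apply: integral_ge0 => x _; rewrite lee_fin powR_ge0. Qed.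

Lemma measurable_pow (f : R -> R) : measurable_fun [set: R] f ->
  measurable_fun [set: R] (fun x => (`|f x| `^ alpha)%:E).
Proof.
move=> mf; apply/measurable_EFinP.
apply: (measurableT_comp (@measurable_powR R alpha)).
exact: (measurableT_comp (@normr_measurable R setT) mf).
Qed.

Lemma pn_scale c s : step_valid s -> pn (step_scale c s) = `|c| `^ alpha * pn s.
Proof.
move=> vs; rewrite /pn /pnorm; under eq_integral do
  rewrite step_fun_scale normrM powRM// EFinM.
rewrite ge0_integralZl_EFin//.
- by rewrite -/(pnorm alpha (step_fun s)) pnormE.
- by apply: measurable_pow; exact: measurable_step_fun.
Qed.

Lemma pn_cat s s' : step_valid s -> step_valid s' ->
  (forall x, step_fun s x * step_fun s' x = 0) ->
  pn (s ++ s') = pn s + pn s'.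
Proof.
move=> vs vs' ss'.
suff H : pnorm alpha (step_fun (s ++ s')) = (pn s + pn s')%:E by rewrite {1}/pn H.
rewrite EFinD; transitivity (pnorm alpha (step_fun s) + pnorm alpha (step_fun s'))%E;
  last by congr (_ + _)%E; exact: pnormE.
rewrite /pnorm -ge0_integralD//; last 2 first.
- by apply: measurable_pow; exact: measurable_step_fun.
- by apply: measurable_pow; exact: measurable_step_fun.
apply: eq_integral => x _; rewrite step_fun_cat -EFinD; congr EFin.
move/eqP: (ss' x); rewrite mulf_eq0 => /orP[]/eqP ->.
  by rewrite add0r normr0 powR0 ?gt_eqF// add0r.
by rewrite addr0 normr0 powR0 ?gt_eqF// addr0.
Qed.

Lemma step_cos s xi : step_valid s ->
  Ex (fun w => cos (xi * step_integral Z s w)) = expR (- (`|xi| `^ alpha * pn s)).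
Proof. by move=> vs; exact: step_integral_cos. Qed.

Lemma step_cos1 s : step_valid s ->
  Ex (fun w => cos (step_integral Z s w)) = expR (- pn s).
Proof.
move=> vs; have := step_cos 1 vs; rewrite normr1 powR1 mul1r => <-.
by congr Ex; apply/funext => w; rewrite mul1r.
Qed.

(* 0 <= gtest, and gtest >= 1 near 0, yet its mean at a symmetric stable
   variable of small scale parameter y is at most 1 - c y. *)
Definition gtest (b t : R) := 1 - 4^-1 * (1 - cos t) * (1 - cos t - b).

(** Written in cos t and cos (2 t), the mean of [gtest] is read off the characteristic function. *)
Lemma gtestE b t : gtest b t =
  (1 - (3 / 2 - b) / 4) + (2 - b) / 4 * cos t - 8^-1 * cos (2 * t).
Proof.
have -> : cos (2 * t) = 2 * cos t ^+ 2 - 1.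
  by rewrite mulr_natl cos_mulr2n; ring.
by rewrite /gtest; field.
Qed.

Lemma gtest_ge0 b t : 0 <= b -> 0 <= gtest b t.
Proof.
move=> b0; rewrite /gtest; have := cos_le1 t; have := cos_geN1 t.
move: (cos t) => c c1 c2.
have h1 : 0 <= (1 - c) * b by rewrite mulr_ge0// subr_ge0.
have h2 : 0 <= (1 + c) * (3 - c) by rewrite mulr_ge0//; lra.
by move: h1 h2; rewrite !mulrDl !mulrDr; lra.
Qed.

Lemma gtest_ge1 b t : 1 - cos t <= b -> 1 <= gtest b t.
Proof.
rewrite /gtest; have := cos_le1 t; move: (cos t) => c c1 cb.
have h1 : 0 <= (1 - c) * (b - (1 - c)) by rewrite mulr_ge0// subr_ge0.
by move: h1; rewrite -subr_ge0 => h1; rewrite -subr_ge0; lra.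
Qed.

Lemma Ex_gtestE b s xi : step_valid s ->
  Ex (fun w => gtest b (xi * step_integral Z s w)) =
  (1 - (3 / 2 - b) / 4) + (2 - b) / 4 * expR (- (`|xi| `^ alpha * pn s)) -
  8^-1 * expR (- (2 `^ alpha * (`|xi| `^ alpha * pn s))).
Proof.
move=> vs; set c := 1 - _.
have mS := measurable_step_integral Z s.
have bc (k : R) : bounded_measurable (fun w => cos (k * step_integral Z s w)) by exact: bm_cosM.
under [X in Ex X]eq_fun do rewrite gtestE mulrA -/c.
rewrite (ExB P (bmD (bm_cst c) (bmZ _ (bc _))) (bmZ _ (bc _))).
rewrite (ExD P (bm_cst c) (bmZ _ (bc _))) !(ExZ P _ (bc _)) Ex_cst.
by rewrite !step_cos// normrM powRM// (@gtr0_norm _ 2)// mulrA.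
Qed.

Let b : R := (4 - 2 `^ alpha) / 4.

Lemma two_powR_lt4 : (2 : R) < 2 `^ alpha < 4.
Proof.
case/andP: alpha12 => a1 a2; apply/andP; split.
  by rewrite -[ltLHS]powRr1// /powR !pnatr_eq0/= ltr_expR ltr_pM2r// ln_gt0// ltr1n.
have -> : 4 = 2 `^ 2 :> R by rewrite powR_mulrn// -natrX.
by rewrite /powR !pnatr_eq0/= ltr_expR ltr_pM2r// ln_gt0// ltr1n.
Qed.

(** The second order term costs at most y^2 / 2, and y <= b / 4 lets half of the slope b / 4 absorb
    it. *)
Lemma Ex_gtest s xi : step_valid s -> 0 < xi -> xi `^ alpha * pn s <= b / 4 ->
  Ex (fun w => gtest b (xi * step_integral Z s w)) <=
  expR (- (b / 8 * (xi `^ alpha * pn s))).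
Proof.
move=> vs xi0; set y := _ * pn s => yb.
have y0 : 0 <= y by rewrite mulr_ge0 ?powR_ge0 ?pn_ge0.
have /andP[p2 p4] := two_powR_lt4.
rewrite Ex_gtestE// (gtr0_norm xi0) -/y.
apply: (@le_trans _ _ (1 - b / 8 * y)); last exact: expRN_ge1B.
have e1 : expR (- y) <= 1 - y + y ^+ 2.
  rewrite expRN; have h := expR_ge1Dx y.
  rewrite -[leLHS]div1r ler_pdivrMr ?expR_gt0//.
  apply: (@le_trans _ _ ((1 - y + y ^+ 2) * (1 + y))).
    by rewrite -subr_ge0 (_ : _ - _ = y ^+ 3) ?exprn_ge0//; ring.
  apply: ler_wpM2l => //; nra.
have e2 := expRN_ge1B (2 `^ alpha * y).
have bE : 2 `^ alpha = 4 - 4 * b by rewrite /b; field.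
clearbody b; move: p2 p4 e2; rewrite bE => p2 p4 e2.
move: (expR (- y)) e1 => E1 e1; move: (expR (- (_ * y))) e2 => E2 e2; rewrite -/y.
have : (2 - b) * E1 <= (2 - b) * (1 - y + y ^+ 2) by apply: ler_wpM2l => //; lra.
have : y ^+ 2 <= b / 4 * y by rewrite expr2 ler_wpM2r.
nra.
Qed.

(** Induction on [r] with a spectator cosine. The head factor is a combination of cosines;
    multiplied by the spectator it becomes a combination of cosines of integrals of [s'] plus
    multiples of the head, and these are again disjoint from the rest of [r]. *)
Lemma Ex_gtest_prod (r : seq (R * seq (R * R * R))) s' :
  (forall q, q \in r -> step_valid q.2) -> step_valid s' ->
  pairwise (fun q q' => `[< forall x, step_fun q.2 x * step_fun q'.2 x = 0 >]) r ->
  (forall q, q \in r -> forall x, step_fun q.2 x * step_fun s' x = 0) ->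
  Ex (fun w => \prod_(q <- r) gtest b (q.1 * step_integral Z q.2 w) *
    cos (step_integral Z s' w)) =
  \prod_(q <- r) Ex (fun w => gtest b (q.1 * step_integral Z q.2 w)) *
  expR (- pn s').
Proof.
elim: r s' => [|q r IH] s' vr vs' pw rs'.
  rewrite big_nil mul1r -step_cos1//; congr Ex; apply/funext => w.
  by rewrite big_nil mul1r.
move: pw => /= /andP[/allP qr pwr].
have vq : step_valid q.2 by apply: vr; rewrite inE eqxx.
have vr' q' : q' \in r -> step_valid q'.2 by move=> q'r; apply: vr; rewrite inE q'r orbT.
pose S c := s' ++ step_scale (c * q.1) q.2.
have vS c : step_valid (S c) by apply: step_cat_valid => //; exact: step_scale_valid.
have SI c w : step_integral Z (S c) w = step_integral Z s' w + c * (q.1 * step_integral Z q.2 w).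
  by rewrite step_integral_cat step_integral_scale mulrA.
have pS c : pn (S c) = pn s' + `|c| `^ alpha * (`|q.1| `^ alpha * pn q.2).
  rewrite pn_cat//; last 2 first.
  - exact: step_scale_valid.
  - by move=> x; rewrite step_fun_scale mulrCA [step_fun s' x * _]mulrC rs' ?mulr0// inE eqxx.
  by rewrite pn_scale// normrM powRM// -mulrA.
have IHS c := IH (S c) vr' (vS c) pwr.
have {}IHS c : Ex (fun w => \prod_(q <- r) gtest b (q.1 * step_integral Z q.2 w) *
    cos (step_integral Z s' w + c * (q.1 * step_integral Z q.2 w))) =
    \prod_(q <- r) Ex (fun w => gtest b (q.1 * step_integral Z q.2 w)) *
    (expR (- pn s') * expR (- (`|c| `^ alpha * (`|q.1| `^ alpha * pn q.2)))).
  rewrite -expRD -opprD -pS -IHS; last first.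
    move=> q' q'r x; rewrite step_fun_cat step_fun_scale mulrDr rs' ?inE ?q'r ?orbT//.
    by rewrite add0r mulrCA [step_fun q'.2 x * _]mulrC (asboolW (qr _ q'r)) mulr0.
  by congr Ex; apply/funext => w; rewrite SI.
have bc (f : T -> R) : measurable_fun [set: T] f -> bounded_measurable (fun w => cos (f w)) by exact: bm_cos.
have mS s := measurable_step_integral Z s.
set Q := \prod_(q <- r) Ex _ in IHS *.
pose Pr w := \prod_(q <- r) gtest b (q.1 * step_integral Z q.2 w).
have bg (q' : R * seq (R * R * R)) : bounded_measurable (fun w => gtest b (q'.1 * step_integral Z q'.2 w)).
  under eq_fun do rewrite gtestE.
  apply: bmB; [apply: bmD; [exact: bm_cst|]|]; apply: bmZ; apply: bm_cos.
    exact: measurable_funM.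
  by do 2 apply: measurable_funM => //.
have bP : bounded_measurable Pr by apply: bm_prod => q'; exact: bg.
pose F c w := Pr w * cos (step_integral Z s' w + c * (q.1 * step_integral Z q.2 w)).
have bF c : bounded_measurable (F c).
  apply: bmM => //; apply: bc; apply: measurable_funD => //.
  by do 2 apply: measurable_funM => //.
set c0 := 1 - (3 / 2 - b) / 4; set c1 := (2 - b) / 4.
(* Product to sum: the head enters with the multiples 0, 1, -1, 2 and -2; opposite ones have the
   same mean. *)
transitivity (Ex (fun w => c0 * F 0 w + (c1 / 2 * F 1 w + (c1 / 2 * F (-1) w +
    ((- 8^-1 / 2) * F 2 w + (- 8^-1 / 2) * F (-2) w))))).
  congr Ex; apply/funext => w; rewrite big_cons -/(Pr w) gtestE -/c0 -/c1 /F.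
  rewrite mul0r addr0 !mulNr !mul1r !cosB !cosD.
  by move: (cos (step_integral _ s' _)) (sin (step_integral _ s' _)) => *; field.
have bZ k c : bounded_measurable (fun w => k * F c w) by exact: bmZ.
rewrite (ExD P (bZ _ _) (bmD (bZ _ _) (bmD (bZ _ _) (bmD (bZ _ _) (bZ _ _))))).
rewrite (ExD P (bZ _ _) (bmD (bZ _ _) (bmD (bZ _ _) (bZ _ _)))).
rewrite (ExD P (bZ _ _) (bmD (bZ _ _) (bZ _ _))) (ExD P (bZ _ _) (bZ _ _)).
rewrite !(ExZ P _ (bF _)).
rewrite /F !IHS normr0 powR0 ?gt_eqF// mul0r oppr0 expR0 mulr1 !normrN normr1.
rewrite powR1 mul1r big_cons -/Q.
rewrite Ex_gtestE// -/c0 -/c1 (@gtr0_norm _ 2)//; by field.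
Qed.

Lemma one_sub_cos_small (e : R) : 0 < e ->
  exists2 t0 : R, 0 < t0 & forall t, `|t| <= t0 -> 1 - cos t <= e.
Proof.
move=> e0; have /cvgrPdist_le/(_ _ e0) := @continuous_cos R 0.
move=> /nbhs_ballP[r /= r0 h]; exists (r / 2); first by rewrite divr_gt0.
move=> t tr; have := h t; rewrite /ball/= sub0r normrN => /(_ _).
rewrite cos0 => H; apply: (le_trans (ler_norm _)); apply: H.
by apply: (le_lt_trans tr); rewrite ltr_pdivrMr// ltr_pMr// ltr1n.
Qed.

(** The indicator of the event is at most the product of the [gtest] factors, whose mean is the
    product of the means. *)
Lemma pr_all_small : exists c t0 : R, [/\ 0 < c, 0 < t0 &
  forall r : seq (R * seq (R * R * R)),
  (forall q, q \in r -> [/\ step_valid q.2, 0 < q.1 & pn q.2 <= t0 * q.1 `^ alpha]) ->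
  pairwise (fun q q' => `[< forall x, step_fun q.2 x * step_fun q'.2 x = 0 >]) r ->
  pr [set w | forall q, q \in r -> `|step_integral Z q.2 w| <= q.1] <=
  expR (- (c * \sum_(q <- r) pn q.2 / q.1 `^ alpha))].
Proof.
have /andP[_ p4] := two_powR_lt4.
have b0 : 0 < b by rewrite /b divr_gt0// subr_gt0.
have [t t0 ct] := one_sub_cos_small b0.
have ta : 0 < t `^ alpha by rewrite powR_gt0.
(* [Ex_gtest] is used at frequency t / q.1, where 1 - cos <= b on [- t, t]: there y = t^alpha pn /
   q.1^alpha, and the second constant expresses y <= b / 4. *)
exists (b / 8 * t `^ alpha), (b / 4 / t `^ alpha); split.
- by rewrite mulr_gt0// divr_gt0.
- by rewrite divr_gt0// divr_gt0.
move=> r hr pw.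
pose r' := [seq (t / q.1, q.2) | q <- r].
have mS s := measurable_step_integral Z s.
have := @Ex_gtest_prod r' [::].
have -> : pn [::] = 0.
  by rewrite /pn pnorm_step//= big_ord0.
rewrite oppr0 expR0 mulr1 => H.
have {}H : Ex (fun w => \prod_(q <- r) gtest b (t / q.1 * step_integral Z q.2 w)) =
    \prod_(q <- r) Ex (fun w => gtest b (t / q.1 * step_integral Z q.2 w)).
  transitivity (Ex (fun w => \prod_(q <- r') gtest b (q.1 * step_integral Z q.2 w) *
    cos (step_integral Z [::] w))).
    congr Ex; apply/funext => w; rewrite big_map.
    by rewrite [X in cos X]/step_integral big_nil cos0 mulr1.
  rewrite H//; last 3 first.
  - by move=> q /mapP[q' q'r ->]; have [] := hr _ q'r.
  - by rewrite pairwise_map; move: pw; rewrite /relpre.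
  - by move=> q _ x; rewrite [X in _ * X]/step_fun big_nil mulr0.
  by rewrite big_map.
have bg q : bounded_measurable (fun w => gtest b (t / q.1 * step_integral Z q.2 w)).
  under eq_fun do rewrite gtestE.
  apply: bmB; [apply: bmD; [exact: bm_cst|]|]; apply: bmZ; apply: bm_cos.
    exact: measurable_funM.
  by do 2 apply: measurable_funM => //.
apply: (@le_trans _ _ (\prod_(q <- r) Ex (fun w => gtest b (t / q.1 * step_integral Z q.2 w)))).
  rewrite -H; apply: pr_le_Ex.
  - have -> : [set w | forall q, q \in r -> `|step_integral Z q.2 w| <= q.1] =
      \big[setI/setT]_(q <- r) [set w | `|step_integral Z q.2 w| <= q.1].
      rewrite -bigcap_seq; apply/seteqP; split => w /= h q; exact: h.
    by apply: bigsetI_measurable => q _; exact: measurable_norm_le.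
  - exact: bm_prod.
  - move=> w; rewrite indicE; case: (boolP (w \in _)); rewrite ?inE/= => hw.
      apply: (@le_trans _ _ (\prod_(q <- r) (1 : R))); first by rewrite big1_eq.
      rewrite big_seq [leRHS]big_seq; apply: ler_prod => q qr; rewrite ler01/=.
      apply: gtest_ge1; apply: ct; have [_ q0 _] := hr _ qr.
      rewrite normrM gtr0_norm ?divr_gt0// mulrAC ler_pdivrMr//.
      by apply: ler_wpM2l; [exact: ltW|exact: hw].
    by apply: prodr_ge0 => q _; apply: gtest_ge0; exact: ltW.
rewrite mulr_sumr -sumrN expR_sum big_seq [leRHS]big_seq.
apply: ler_prod => q qr; have [vq q0 pq] := hr _ qr.
rewrite Ex_ge0/=; last by move=> w; apply: gtest_ge0; exact: ltW.
have tq : (t / q.1) `^ alpha = t `^ alpha / q.1 `^ alpha.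
  rewrite powRM ?invr_ge0 ?ltW//; congr (_ * _).
  by rewrite -powR_inv1 ?ltW// -powRrM mulN1r powRN.
apply: (le_trans (Ex_gtest _ _ _)) => //.
- by rewrite divr_gt0.
- rewrite tq mulrAC ler_pdivrMr ?powR_gt0//.
  have := ler_wpM2l (ltW ta) pq.
  by rewrite [X in _ <= X](_ : _ = b / 4 * q.1 `^ alpha)//; field; rewrite gt_eqF.
rewrite ler_expR lerN2 tq le_eqVlt; apply/orP; left; apply/eqP; ring.
Qed.

End max_lower_bound.

(** * Stable integrals as limits of step integrals *)

Section pnorm_theory.
Context (R : realType) (alpha : R) (alpha12 : 1 < alpha < 2).
Local Notation pnorm := (pnorm alpha).

Lemma alpha_gt0 : 0 < alpha.
Proof. by case/andP: alpha12 => /(lt_trans ltr01). Qed.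

Lemma powR_alpha_lt4 : 2 `^ alpha <= 4.
Proof. by have /andP[_ /ltW] := two_powR_lt4 alpha12. Qed.

Lemma powR_normD (x y : R) :
  `|x + y| `^ alpha <= 4 * (`|x| `^ alpha + `|y| `^ alpha).
Proof.
have a0 := ltW alpha_gt0.
wlog xy : x y / `|x| <= `|y|.
  by move=> H; have [/H//|/ltW/H] := leP `|x| `|y|; rewrite addrC [X in 4 * X]addrC.
apply: (@le_trans _ _ ((2 * `|y|) `^ alpha)).
  apply: ge0_ler_powR; rewrite ?nnegrE ?mulr_ge0//.
  by rewrite (le_trans (ler_normD _ _))//; lra.
rewrite powRM//; apply: ler_pM; rewrite ?powR_ge0 ?powR_alpha_lt4//.
by rewrite lerDr powR_ge0.
Qed.

Lemma pnorm_ge0 f : (0 <= pnorm f)%E.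
Proof. by apply: integral_ge0 => x _; rewrite lee_fin powR_ge0. Qed.

Lemma le_pnorm (f g : R -> R) : measurable_fun [set: R] f -> measurable_fun [set: R] g ->
  (forall x, `|f x| <= `|g x|) -> (pnorm f <= pnorm g)%E.
Proof.
move=> mf mg fg; apply: ge0_le_integral => //.
- exact: measurable_pow.
- exact: measurable_pow.
- move=> x _; rewrite lee_fin; apply: ge0_ler_powR; rewrite ?nnegrE//.
  exact: ltW alpha_gt0.
Qed.

Lemma pnormZ (c : R) (f : R -> R) : measurable_fun [set: R] f ->
  pnorm (fun x => c * f x) = ((`|c| `^ alpha)%:E * pnorm f)%E.
Proof.
move=> mf; rewrite /pnorm; under eq_integral do rewrite normrM powRM// EFinM.
rewrite ge0_integralZl_EFin//; last exact: measurable_pow.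
Qed.

Lemma pnormN (f : R -> R) : pnorm (fun x => - f x) = pnorm f.
Proof. by rewrite /pnorm; under eq_integral do rewrite normrN. Qed.

Lemma pnormD (f g : R -> R) : measurable_fun [set: R] f -> measurable_fun [set: R] g ->
  (pnorm (fun x => f x + g x)%R <= 4%:E * (pnorm f + pnorm g))%E.
Proof.
move=> mf mg; have mpf := measurable_pow alpha mf; have mpg := measurable_pow alpha mg.
rewrite /pnorm -ge0_integralD// -ge0_integralZl_EFin//; last exact: emeasurable_funD.
apply: ge0_le_integral => //.
- by apply: measurable_pow; exact: measurable_funD.
- by apply: measurable_funeM; exact: emeasurable_funD.
- by move=> x _; rewrite -EFinD -EFinM lee_fin powR_normD.
- by move=> x _; rewrite -EFinD lee_fin addr_ge0// powR_ge0.
Qed.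

Lemma pnormD_fin (f g : R -> R) a b : measurable_fun [set: R] f -> measurable_fun [set: R] g ->
  (pnorm f <= a%:E)%E -> (pnorm g <= b%:E)%E ->
  (pnorm (fun x => f x + g x)%R <= (4 * (a + b))%:E)%E.
Proof.
move=> mf mg fa gb; apply: (le_trans (pnormD mf mg)).
rewrite EFinM [(a + b)%:E]EFinD; apply: lee_wpmul2l; first by rewrite lee_fin.
by rewrite leeD.
Qed.

End pnorm_theory.

Lemma cvge0_near_le (R : realType) (u : nat -> \bar R) (e : R) : 0 < e ->
  u n @[n --> \oo] --> 0%E -> \forall n \near \oo, (u n <= e%:E)%E.
Proof.
move=> e0 u0.
have H : nbhs (0%E : \bar R) [set x | (x < e%:E)%E] by apply: open_ereal_lt'; rewrite lte_fin.
have : \forall n \near \oo, (u n < e%:E)%E by exact: (u0 _ H).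
by apply: filterS => n /ltW.
Qed.

Section stable_approximation.
Context d (T : measurableType d) (R : realType) (P : probability T R).
Context (alpha : R) (alpha12 : 1 < alpha < 2).
Context (Z : R -> {RV P >-> R}).
Local Notation pr := (@pr d T R P).
Local Notation pnorm := (pnorm alpha).

(** A single [e] bounds the distance to the kernel, the deviation and its probability. In this form
    the notion passes easily to sums, multiples and limits. *)
Definition stab_approx (f : R -> R) (W : T -> R) := forall e, 0 < e ->
  exists s, [/\ step_valid s, (pnorm (fun x => step_fun s x - f x)%R <= e%:E)%E &
    pr [set w | e <= `|step_integral Z s w - W w| ] <= e].

Let mI := measurable_step_integral Z.

Lemma stable_integral_approx f W : is_stable_integral alpha Z f W ->
  stab_approx f W.
Proof.
move=> [_ mW [s [vs sf sW]]] e e0.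
have /filterI/(_ (cvge0_near_le e0 (sW _ e0))) := cvge0_near_le e0 sf.
move=> /filter_ex[n [H1 H2]]; exists (s n); split => //.
by rewrite -lee_fin -prE//; apply: measurable_norm_ge; exact: measurable_funB.
Qed.

Lemma stab_approx0 : stab_approx (fun=> 0) (fun=> 0).
Proof.
move=> e e0; exists [::]; split => //.
- rewrite /pnorm; under eq_integral => x _.
    rewrite /step_fun big_nil subr0 normr0 powR0 ?gt_eqF ?(alpha_gt0 alpha12)//; over.
  by rewrite integral0 lee_fin ltW.
- rewrite (_ : [set w | _] = set0) ?/pr ?measure0 ?ltW//.
  by apply/seteqP; split => w //=; rewrite /step_integral big_nil subr0 normr0 leNgt e0.
Qed.

Lemma stab_approxD (f g : R -> R) (V W : T -> R) :
  measurable_fun [set: R] f -> measurable_fun [set: R] g ->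
  measurable_fun [set: T] V -> measurable_fun [set: T] W ->
  stab_approx f V -> stab_approx g W ->
  stab_approx (fun x => f x + g x) (fun w => V w + W w).
Proof.
move=> mf mg mV mW aV aW e e0.
have e8 : 0 < e / 8 by rewrite divr_gt0.
have [s [vs sf sV]] := aV _ e8; have [s' [vs' sg sW]] := aW _ e8.
exists (s ++ s'); split; first exact: step_cat_valid.
- have -> : (fun x => step_fun (s ++ s') x - (f x + g x)) =
      (fun x => (step_fun s x - f x) + (step_fun s' x - g x)).
    by apply/funext => x; rewrite step_fun_cat; ring.
  apply: (le_trans (pnormD_fin alpha12 _ _ sf sg)).
  + by apply: measurable_funB => //; exact: measurable_step_fun.
  + by apply: measurable_funB => //; exact: measurable_step_fun.
  + by rewrite lee_fin; lra.
have mA : measurable [set w | e / 8 <= `|step_integral Z s w - V w|].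
  by apply: measurable_norm_ge; exact: measurable_funB.
have mB : measurable [set w | e / 8 <= `|step_integral Z s' w - W w|].
  by apply: measurable_norm_ge; exact: measurable_funB.
have mC : measurable [set w | e <= `|step_integral Z (s ++ s') w - (V w + W w)|].
  by apply: measurable_norm_ge; apply: measurable_funB => //; exact: measurable_funD.
apply: (le_trans (le_pr P mC (measurableU _ _ mA mB) _)).
  move=> w /= ew; apply/orP; rewrite -implyNb; apply/implyP; rewrite -ltNge => lt1.
  have : `|step_integral Z (s ++ s') w - (V w + W w)| <=
      `|step_integral Z s w - V w| + `|step_integral Z s' w - W w|.
    by rewrite step_integral_cat (le_trans _ (ler_normD _ _))// le_eqVlt; apply/orP; left; apply/eqP; congr `|_|; ring.
  lra.
by apply: (le_trans (prU _ mA mB)); lra.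
Qed.

Lemma stab_approxZ (c : R) (f : R -> R) (W : T -> R) : measurable_fun [set: R] f -> measurable_fun [set: T] W ->
  stab_approx f W -> stab_approx (fun x => c * f x) (fun w => c * W w).
Proof.
(* [k] dominates 1, |c| and |c|^alpha, which are needed for the probability, the deviation and the
   norm respectively. *)
move=> mf mW aW e e0; set k := 1 + `|c| + `|c| `^ alpha.
have k0 : 0 < k by rewrite /k addrAC ltr_wpDr// ltr_wpDr// powR_ge0.
have k1 : 1 <= k by rewrite /k -addrA lerDl addr_ge0// powR_ge0.
have ek0 : 0 < e / k by rewrite divr_gt0.
have [s [vs sf sW]] := aW _ ek0.
exists (step_scale c s); split; first exact: step_scale_valid.
- have -> : (fun x => step_fun (step_scale c s) x - c * f x) =
      (fun x => c * (step_fun s x - f x)).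
    by apply/funext => x; rewrite step_fun_scale; ring.
  rewrite pnormZ; last by apply: measurable_funB => //; exact: measurable_step_fun.
  apply: (@le_trans _ _ ((`|c| `^ alpha)%:E * (e / k)%:E)%E).
    by apply: lee_wpmul2l => //; rewrite lee_fin powR_ge0.
  rewrite -EFinM lee_fin mulrCA ler_piMr ?(ltW e0)// ler_pdivrMr// mul1r.
  by rewrite /k lerDr addr_ge0.
have mA : measurable [set w | e / k <= `|step_integral Z s w - W w|].
  by apply: measurable_norm_ge; exact: measurable_funB.
have mC : measurable [set w | e <= `|step_integral Z (step_scale c s) w - c * W w|].
  by apply: measurable_norm_ge; apply: measurable_funB => //; exact: measurable_funM.
apply: (le_trans (le_pr P mC mA _)).
  move=> w /=; rewrite step_integral_scale -mulrBr normrM => H.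
  rewrite ler_pdivrMr//; apply: (le_trans H); rewrite mulrC ler_wpM2l// /k.
  by rewrite addrAC lerDr addr_ge0// powR_ge0.
by apply: (le_trans sW); rewrite ler_pdivrMr// ler_peMr// ltW.
Qed.

Lemma stab_approx_sum (I : Type) (r : seq I) (c : I -> R) (f : I -> R -> R) (W : I -> T -> R) :
  (forall i, measurable_fun [set: R] (f i)) -> (forall i, measurable_fun [set: T] (W i)) ->
  (forall i, stab_approx (f i) (W i)) ->
  stab_approx (fun x => \sum_(i <- r) c i * f i x) (fun w => \sum_(i <- r) c i * W i w).
Proof.
move=> mf mW aW.
have E0 (V : Type) (F : I -> V -> R) :
    (fun x => \sum_(i <- [::]) c i * F i x) = (fun=> 0).
  by apply/funext => x; rewrite big_nil.
have E1 (V : Type) (F : I -> V -> R) i l : (fun x => \sum_(j <- i :: l) c j * F j x) =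
    (fun x => c i * F i x + \sum_(j <- l) c j * F j x).
  by apply/funext => x; rewrite big_cons.
elim: r => [|i r IH]; first by rewrite !E0; exact: stab_approx0.
rewrite !E1.
apply: stab_approxD => //; [exact: measurable_funM| |exact: measurable_funM| |exact: stab_approxZ].
- by apply: measurable_sum => j; exact: measurable_funM.
- by apply: measurable_sum => j; exact: measurable_funM.
Qed.

(** Meant for Riemann sums: [g] is a finite combination of kernels and [V] the same combination of
    values of the field. *)
Lemma stab_approx_lim (f : R -> R) (W : T -> R) : measurable_fun [set: R] f -> measurable_fun [set: T] W ->
  (forall e, 0 < e -> exists (g : R -> R) (V : T -> R), [/\ measurable_fun [set: R] g,
    measurable_fun [set: T] V, stab_approx g V,
    (pnorm (fun x => g x - f x)%R <= e%:E)%E &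
    pr [set w | e <= `|V w - W w| ] <= e]) -> stab_approx f W.
Proof.
move=> mf mW lim e e0.
have e8 : 0 < e / 8 by rewrite divr_gt0.
have [g [V [mg mV aV gf gV]]] := lim _ e8; have [s [vs sf sV]] := aV _ e8.
exists s; split => //.
- have -> : (fun x => step_fun s x - f x) =
      (fun x => (step_fun s x - g x) + (g x - f x)).
    by apply/funext => x; ring.
  apply: (le_trans (pnormD_fin alpha12 _ _ sf gf)).
  + by apply: measurable_funB => //; exact: measurable_step_fun.
  + exact: measurable_funB.
  + by rewrite lee_fin; lra.
have mA : measurable [set w | e / 8 <= `|step_integral Z s w - V w|].
  by apply: measurable_norm_ge; exact: measurable_funB.
have mB : measurable [set w | e / 8 <= `|V w - W w|].
  by apply: measurable_norm_ge; exact: measurable_funB.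
have mC : measurable [set w | e <= `|step_integral Z s w - W w|].
  by apply: measurable_norm_ge; exact: measurable_funB.
apply: (le_trans (le_pr P mC (measurableU _ _ mA mB) _)).
  move=> w /= ew; apply/orP; rewrite -implyNb; apply/implyP; rewrite -ltNge => lt1.
  have := ler_distD (V w) (step_integral Z s w) (W w); lra.
by apply: (le_trans (prU _ mA mB)); lra.
Qed.

End stable_approximation.

(** * Tail, small ball and maximum bounds for stable integrals *)

Section stable_bounds.
Context d (T : measurableType d) (R : realType) (P : probability T R).
Context (alpha : R) (alpha12 : 1 < alpha < 2).
Context (Z : R -> {RV P >-> R}) (hZ : SaS_Levy_process alpha Z).
Local Notation pr := (@pr d T R P).
Local Notation pnorm := (pnorm alpha).
Local Notation pn := (step_scale_par alpha).
Local Notation stab_approx := (stab_approx alpha Z).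

Let mI := measurable_step_integral Z.
Let mS (s : seq (R * R * R)) := measurable_step_fun s.

Lemma pn_near (f : R -> R) s (e sigma : R) : measurable_fun [set: R] f ->
  step_valid s -> (pnorm (fun x => step_fun s x - f x)%R <= e%:E)%E ->
  (pnorm f <= sigma%:E)%E -> pn s <= 4 * (sigma + e).
Proof.
move=> mf vs sf fs; rewrite -lee_fin -(pnormE alpha12 vs).
have -> : step_fun s = (fun x => f x + (step_fun s x - f x)).
  by apply/funext => x; ring.
by apply: pnormD_fin => //; exact: measurable_funB.
Qed.

Lemma near_pn (f : R -> R) s (e sigma : R) : measurable_fun [set: R] f ->
  step_valid s -> (pnorm (fun x => step_fun s x - f x)%R <= e%:E)%E ->
  (sigma%:E <= pnorm f)%E -> sigma <= 4 * (pn s + e).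
Proof.
move=> mf vs sf fs; rewrite -lee_fin; apply: (le_trans fs).
have -> : f = (fun x => step_fun s x + - (step_fun s x - f x)).
  by apply/funext => x; ring.
have mfN : measurable_fun [set: R] (fun x => - (step_fun s x - f x)).
  by apply: measurable_funN; exact: measurable_funB.
have fsN : (pnorm (fun x => - (step_fun s x - f x))%R <= e%:E)%E by rewrite pnormN.
have sE : (pnorm (step_fun s) <= (pn s)%:E)%E by rewrite (pnormE alpha12 vs).
exact: (pnormD_fin alpha12 (mS s) mfN sE fsN).
Qed.

Lemma step_tail s x : step_valid s -> 0 < x ->
  pr [set w | x <= `|step_integral Z s w|] <= 2 / (1 - cos 1) * (x `^ (- alpha) * pn s).
Proof.
move=> vs x0; apply: SaS_tail => //; last by move=> xi; exact: step_cos.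
- by apply: ltW; case/andP: alpha12.
- exact: pn_ge0.
Qed.

(** 64 = 2 * 4 * 8: the 2 of [SaS_tail], the bound 2^alpha <= 4 for the threshold x / 2, and a step
    scale of at most 4 (sigma + sigma). The summand 1 pays for the approximation. *)
Definition tail_const : R := 1 + 64 / (1 - cos 1).

Lemma tail_const_gt0 : 0 < tail_const.
Proof. by rewrite ltr_wpDr// divr_ge0// subr_ge0 cos_le1. Qed.

Lemma half_powRN x : 0 < x -> (x / 2) `^ (- alpha) <= 4 * x `^ (- alpha).
Proof.
move=> x0; rewrite powRM ?(ltW x0) ?invr_ge0// mulrC; apply: ler_wpM2r; first exact: powR_ge0.
rewrite powRN -(powR_inv1 (ler0n _ 2)) -powRrM mulN1r powRN invrK.
exact: powR_alpha_lt4.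
Qed.

Lemma stab_approx_tail (f : R -> R) (W : T -> R) sigma x :
  measurable_fun [set: R] f -> measurable_fun [set: T] W -> stab_approx f W ->
  0 < sigma -> (pnorm f <= sigma%:E)%E -> 0 < x ->
  pr [set w | x <= `|W w|] <= tail_const * (sigma * x `^ (- alpha)).
Proof.
move=> mf mW aW s0 fs x0.
have xa : 0 < x `^ (- alpha) by rewrite powR_gt0.
have x2 : 0 < x / 2 by rewrite divr_gt0.
pose e := Num.min (x / 2) (Num.min sigma (sigma * x `^ (- alpha))).
have e0 : 0 < e by rewrite !lt_min x2 s0 mulr_gt0.
have e1 : e <= x / 2 by rewrite ge_min lexx.
have e2 : e <= sigma by rewrite !ge_min lexx orbT.
have e3 : e <= sigma * x `^ (- alpha) by rewrite !ge_min lexx !orbT.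
have [s [vs sf sW]] := aW _ e0.
have pns := pn_near mf vs sf fs.
have mA : measurable [set w | e <= `|step_integral Z s w - W w|].
  by apply: measurable_norm_ge; exact: measurable_funB.
have mB : measurable [set w | x / 2 <= `|step_integral Z s w|] by exact: measurable_norm_ge.
have mC : measurable [set w | x <= `|W w|] by exact: measurable_norm_ge.
apply: (le_trans (le_pr P mC (measurableU _ _ mB mA) _)).
  move=> w /= xW; apply/orP; rewrite -implyNb; apply/implyP; rewrite -ltNge => lt1.
  have := ler_distD (step_integral Z s w) (W w) 0; rewrite !subr0 distrC; lra.
apply: (le_trans (prU _ mB mA)).
have c1 : 0 < 1 - cos (1 : R) by rewrite subr_gt0 cos1_lt1.
rewrite /tail_const mulrDl mul1r [leLHS]addrC; apply: lerD; first exact: le_trans e3.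
apply: (le_trans (step_tail vs x2)).
have -> : 64 / (1 - cos 1) * (sigma * x `^ (- alpha)) =
  2 / (1 - cos 1) * (4 * x `^ (- alpha) * (4 * (sigma + sigma))) by ring.
apply: ler_wpM2l; first by rewrite divr_ge0// ltW.
apply: ler_pM; rewrite ?powR_ge0 ?pn_ge0 ?half_powRN//.
by apply: (le_trans pns); rewrite ler_pM2l// lerD2l.
Qed.

Definition ball_const : R := 1 + (cos 1 ^+ 2)^-1.

Lemma ball_const_gt0 : 0 < ball_const.
Proof. by rewrite ltr_wpDr// invr_ge0 sqr_ge0. Qed.

(** Transfer from a close step integral, whose scale is at least sigma / 8: indeed sigma <= 4 (pn +
    e) and e <= sigma / 8. The summand 1 of [ball_const] pays for the approximation. *)
Lemma stab_approx_small_ball (f : R -> R) (W : T -> R) sigma (N : nat) xi :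
  measurable_fun [set: R] f -> measurable_fun [set: T] W -> stab_approx f W ->
  0 < sigma -> (sigma%:E <= pnorm f)%E -> (0 < N)%N -> 0 < xi ->
  pr [set w | `|W w| <= (N%:R * xi)^-1 / 2] <=
  ball_const * (N%:R^-1 + expR (- (xi `^ alpha * sigma / 8))).
Proof.
move=> mf mW aW s0 fs N0 xi0.
have N0R : 0 < N%:R :> R by rewrite ltr0n.
have Nx0 : 0 < (N%:R * xi)^-1 / 2 by rewrite divr_gt0// invr_gt0 mulr_gt0.
pose e := Num.min (sigma / 8) (Num.min N%:R^-1 ((N%:R * xi)^-1 / 2)).
have e0 : 0 < e by rewrite !lt_min Nx0 divr_gt0// invr_gt0 N0R.
have e1 : e <= sigma / 8 by rewrite ge_min lexx.
have e2 : e <= N%:R^-1 by rewrite !ge_min lexx orbT.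
have e3 : e <= (N%:R * xi)^-1 / 2 by rewrite !ge_min lexx !orbT.
have [s [vs sf sW]] := aW _ e0.
have pns := near_pn mf vs sf fs.
have mA : measurable [set w | e <= `|step_integral Z s w - W w|].
  by apply: measurable_norm_ge; exact: measurable_funB.
have mB : measurable [set w | `|step_integral Z s w| <= (N%:R * xi)^-1].
  exact: measurable_norm_le.
have mC : measurable [set w | `|W w| <= (N%:R * xi)^-1 / 2] by exact: measurable_norm_le.
apply: (le_trans (le_pr P mC (measurableU _ _ mB mA) _)).
  move=> w /= xW; apply/orP; rewrite -implyNb; apply/implyP; rewrite -ltNge => lt1.
  have := ler_distD (W w) (step_integral Z s w) 0; rewrite !subr0; lra.
apply: (le_trans (prU _ mB mA)).
rewrite /ball_const mulrDl mul1r [leLHS]addrC; apply: lerD.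
  by rewrite (le_trans sW)// (le_trans e2)// lerDl expR_ge0.
have a1 : 1 <= alpha by apply: ltW; case/andP: alpha12.
have H := SaS_small_ball a1 (pn_ge0 alpha s) (mI s) (fun k => step_cos alpha12 hZ k vs) N0 xi0.
apply: (le_trans H); apply: ler_wpM2l; first by rewrite invr_ge0 sqr_ge0.
rewrite lerD2l ler_expR lerN2 -mulrA; apply: ler_wpM2l; first exact: powR_ge0.
lra.
Qed.

(** Each kernel is cut by its window ]l, r]. The windows are disjoint, so [pr_all_small] applies to
    the near parts, while the far parts, of scale at most phi up to a factor, are handled one by one
    by the tail bound. If |W| <= x, the near part is at most 3 x unless the far part exceeds x or
    the approximation fails. *)
Lemma stab_approx_max : exists C t0 : R, [/\ 0 < C, 0 < t0 &
  forall (I : choiceType) (K : seq I) (f : I -> R -> R) (W : I -> T -> R)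
    (l r x nu phi : I -> R), uniq K ->
  (forall k, measurable_fun [set: R] (f k)) ->
  (forall k, measurable_fun [set: T] (W k)) ->
  (forall k, k \in K -> stab_approx (f k) (W k)) ->
  (forall k, k \in K -> l k <= r k) ->
  (forall k k', k \in K -> k' \in K -> k != k' -> (r k <= l k') || (r k' <= l k)) ->
  (forall k, k \in K -> [/\ 0 < x k, 0 < nu k & 0 < phi k]) ->
  (forall k, k \in K -> (pnorm (f k) <= (t0 * x k `^ alpha)%:E)%E) ->
  (forall k, k \in K ->
    ((nu k)%:E <= pnorm (fun s => f k s * \1_(`]l k, r k]%classic) s)%R)%E) ->
  (forall k, k \in K ->
    (pnorm (fun s => f k s * (1 - \1_(`]l k, r k]%classic) s))%R <= (phi k)%:E)%E) ->
  pr [set w | forall k, k \in K -> `|W k w| <= x k] <=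
  expR (- (C^-1 * \sum_(k <- K) nu k * x k `^ (- alpha))) +
  C * \sum_(k <- K) phi k * x k `^ (- alpha)].
Proof.
have [c [t [c0 t0 Hsmall]]] := pr_all_small alpha12 hZ.
have tc0 := tail_const_gt0.
(* 72 = 8 * 9, because the near scale is at least nu / 8 and (3 x)^alpha <= 9 x^alpha. The other
   summands cover the far parts and the approximation errors. *)
pose C := 72 / c + 4 * tail_const + 1.
have c72 : 0 < 72 / c by rewrite divr_gt0.
have C0 : 0 < C by rewrite /C; lra.
exists C, (t / 8); split => //; first by rewrite divr_gt0.
move=> I K f W l r x nu phi uK mf mW aW lr dis pos fx fnu fphi.
have a0 := alpha_gt0 alpha12.
pose xa k := x k `^ (- alpha).
have xa0 k : k \in K -> 0 < xa k by move=> kK; rewrite powR_gt0//; have [] := pos k kK.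
have x0 k : k \in K -> 0 < x k by move=> kK; have [] := pos k kK.
have nu0 k : k \in K -> 0 < nu k by move=> kK; have [] := pos k kK.
have phi0 k : k \in K -> 0 < phi k by move=> kK; have [] := pos k kK.
(* The five bounds serve, in this order, the lower scale of the near part, the deviation, the far
   scale, the probability of failure and the upper scale of the near part. *)
pose e k := Num.min (nu k / 8) (Num.min (x k) (Num.min (phi k) (Num.min (phi k * xa k) (t / 8 * x k `^ alpha)))).
have e0 k : k \in K -> 0 < e k.
  move=> kK; rewrite !lt_min divr_gt0 ?nu0// x0// phi0//= !mulr_gt0 ?phi0 ?xa0 ?powR_gt0 ?x0//.
have e1 k : e k <= nu k / 8 by rewrite ge_min lexx.
have e2 k : e k <= x k by rewrite !ge_min lexx !orbT.
have e3 k : e k <= phi k by rewrite !ge_min lexx !orbT.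
have e4 k : e k <= phi k * xa k by rewrite !ge_min lexx !orbT.
have e5 k : e k <= t / 8 * x k `^ alpha by rewrite !ge_min lexx !orbT.
have /choice[s Hs] : forall k, exists s, k \in K -> [/\ step_valid s,
    (pnorm (fun y => step_fun s y - f k y)%R <= (e k)%:E)%E &
    pr [set w | e k <= `|step_integral Z s w - W k w| ] <= e k].
  move=> k; have [kK|_] := boolP (k \in K); last by exists [::].
  by have [s ?] := aW k kK _ (e0 k kK); exists s.
have vs k : k \in K -> step_valid (s k) by move=> /Hs[].
have sf k : k \in K -> (pnorm (fun y => step_fun (s k) y - f k y)%R <= (e k)%:E)%E by move=> /Hs[].
pose near k := step_restrict (l k) (r k) (s k).
(* Appending the opposite of the restriction leaves the part outside the window. *)
pose far k := s k ++ step_scale (-1) (near k).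
have vn k : k \in K -> step_valid (near k) by move=> kK; apply: step_restrict_valid; exact: vs.
have vf k : k \in K -> step_valid (far k).
  by move=> kK; apply: step_cat_valid; [exact: vs|apply: step_scale_valid; exact: vn].
pose J k : R -> R := \1_(`]l k, r k]%classic).
have J01 k y : 0 <= J k y <= 1 by rewrite /J indicE; case: (_ \in _); rewrite ?lexx ?ler01.
have mJ k : measurable_fun [set: R] (J k) by exact: measurable_indic.
have nearE k y : k \in K -> step_fun (near k) y = step_fun (s k) y * J k y.
  by move=> kK; rewrite step_fun_restrict ?lr ?vs.
have farE k y : k \in K -> step_fun (far k) y = step_fun (s k) y * (1 - J k y).
  by move=> kK; rewrite step_fun_cat step_fun_scale nearE//; ring.
have near_f k : k \in K -> (pnorm (fun y => step_fun (near k) y - f k y * J k y)%R <= (e k)%:E)%E.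
  move=> kK; apply: le_trans (sf k kK); apply: (le_pnorm alpha12).
  - by apply: measurable_funB => //; exact: measurable_funM.
  - exact: measurable_funB.
  - move=> y; rewrite nearE// -mulrBl normrM ler_piMr//.
    by have /andP[j0 j1] := J01 k y; rewrite ger0_norm.
have far_f k : k \in K -> (pnorm (fun y => step_fun (far k) y - f k y * (1 - J k y))%R <= (e k)%:E)%E.
  move=> kK; apply: le_trans (sf k kK); apply: (le_pnorm alpha12).
  - by apply: measurable_funB => //; apply: measurable_funM => //; exact: measurable_funB.
  - exact: measurable_funB.
  - move=> y; rewrite farE// -mulrBl normrM ler_piMr//.
    by have /andP[j0 j1] := J01 k y; rewrite ger0_norm; lra.
have mfJ k : measurable_fun [set: R] (fun y => f k y * J k y) by exact: measurable_funM.
have mfJ' k : measurable_fun [set: R] (fun y => f k y * (1 - J k y)).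
  by apply: measurable_funM => //; exact: measurable_funB.
have pn_lo k : k \in K -> nu k / 8 <= pn (near k).
  move=> kK; have := near_pn (mfJ k) (vn k kK) (near_f k kK) (fnu k kK).
  by have := e1 k; lra.
have pn_hi k : k \in K -> pn (near k) <= t * (3 * x k) `^ alpha.
  move=> kK.
  have fJ : (pnorm (fun y => f k y * J k y)%R <= (t / 8 * x k `^ alpha)%:E)%E.
    apply: le_trans (fx k kK); apply: (le_pnorm alpha12) => // y.
    by rewrite normrM ler_piMr//; have /andP[j0 j1] := J01 k y; rewrite ger0_norm.
  have := pn_near (mfJ k) (vn k kK) (near_f k kK) fJ; have := e5 k.
  have : t * x k `^ alpha <= t * (3 * x k) `^ alpha.
    apply: ler_wpM2l; first exact: ltW.
    by apply: ge0_ler_powR; rewrite ?nnegrE ?mulr_ge0 ?(ltW a0) ?(ltW (x0 k kK))//; have := x0 k kK; lra.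
  lra.
have pn_far k : k \in K -> pn (far k) <= 8 * phi k.
  move=> kK; have := pn_near (mfJ' k) (vf k kK) (far_f k kK) (fphi k kK).
  by have := e3 k; lra.
pose A := [set w | forall k, k \in K -> `|step_integral Z (near k) w| <= 3 * x k].
pose B k := [set w | x k <= `|step_integral Z (far k) w|].
pose D k := [set w | e k <= `|step_integral Z (s k) w - W k w| ].
have mall (V : I -> T -> R) (y : I -> R) : (forall k, measurable_fun [set: T] (V k)) ->
    measurable [set w | forall k, k \in K -> `|V k w| <= y k].
  move=> mV; have -> : [set w | forall k, k \in K -> `|V k w| <= y k] =
      \big[setI/setT]_(k <- K) [set w | `|V k w| <= y k].
    by rewrite -bigcap_seq; apply/seteqP; split => w /= h k; exact: h.
  by apply: bigsetI_measurable => k _; exact: measurable_norm_le.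
have mA : measurable A by apply: mall => k; exact: mI.
have mB k : measurable (B k) by exact: measurable_norm_ge.
have mD k : measurable (D k) by apply: measurable_norm_ge; exact: measurable_funB.
have mBU : measurable (\big[setU/set0]_(k <- K) B k) by exact: bigsetU_measurable.
have mDU : measurable (\big[setU/set0]_(k <- K) D k) by exact: bigsetU_measurable.
apply: (@le_trans _ _ (pr A + (\sum_(k <- K) pr (B k) + \sum_(k <- K) pr (D k)))).
  apply: (le_trans (le_pr P (mall _ _ mW) (measurableU _ _ mA (measurableU _ _ mBU mDU)) _)).
    move=> w /= hW; have [/= [k kK Bk]|nB] := pselect (exists2 k, k \in K & B k w).
      by right; left; rewrite -bigcup_seq; exists k.
    have [/= [k kK Dk]|nD] := pselect (exists2 k, k \in K & D k w).
      by right; right; rewrite -bigcup_seq; exists k.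
    left => k kK /=.
    have Bk : `|step_integral Z (far k) w| < x k.
      by rewrite ltNge; apply/negP => h; apply: nB; exists k.
    have Dk : `|step_integral Z (s k) w - W k w| < e k.
      by rewrite ltNge; apply/negP => h; apply: nD; exists k.
    have -> : step_integral Z (near k) w = W k w + (step_integral Z (s k) w - W k w) -
        step_integral Z (far k) w.
      by rewrite step_integral_cat step_integral_scale; ring.
    apply: (le_trans (ler_normB _ _)); have := ler_normD (W k w) (step_integral Z (s k) w - W k w).
    by have := hW k kK; have := e2 k; move: Bk Dk; lra.
  apply: (le_trans (prU _ mA (measurableU _ _ mBU mDU))); rewrite lerD2l.
  apply: (le_trans (prU _ mBU mDU)); apply: lerD; exact: pr_bigcup.
have HA : pr A <= expR (- (C^-1 * \sum_(k <- K) nu k * x k `^ (- alpha))).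
  pose rr := [seq (3 * x k, near k) | k <- K].
  have := Hsmall rr.
  have -> : [set w | forall q, q \in rr -> `|step_integral Z q.2 w| <= q.1] = A.
    apply/seteqP; split => w /= h.
      by move=> k kK; apply: (h (3 * x k, near k)); apply/mapP; exists k.
    by move=> q /mapP[k kK ->]; exact: h.
  move=> H; apply: (le_trans (H _ _)).
  - by move=> q /mapP[k kK ->] /=; split; [exact: vn|rewrite mulr_gt0// x0|exact: pn_hi].
  - rewrite pairwise_map.
    have : {subset K <= K} by [].
    elim: {1 2 4}K uK => //= k K' IH /andP[kK' uK'] sub; rewrite IH//; last first.
      by move=> j jK'; apply: sub; rewrite inE jK' orbT.
    rewrite andbT; apply/allP => j jK'; apply/asboolP => y /=.
    have kK : k \in K by apply: sub; rewrite inE eqxx.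
    have jK : j \in K by apply: sub; rewrite inE jK' orbT.
    have kj : k != j by apply: contraNneq kK' => ->.
    rewrite !nearE// mulrACA (_ : J k y * J j y = 0) ?mulr0//.
    rewrite /J !indicE !mem_setE !in_itv/= -natrM mulnb.
    case/orP: (dis _ _ kK jK kj) => h.
      by case: (ltP (l k) y) (leP y (r k)) (ltP (l j) y) (leP y (r j)) => ? [] ? [] ? [] ? //=; lra.
    by case: (ltP (l k) y) (leP y (r k)) (ltP (l j) y) (leP y (r j)) => ? [] ? [] ? [] ? //=; lra.
  rewrite ler_expR lerN2 big_map/= !mulr_sumr big_seq [leRHS]big_seq; apply: ler_sum => k kK.
  have h3 : (3 * x k) `^ alpha <= 9 * x k `^ alpha.
    rewrite powRM ?(ltW (x0 k kK))//; apply: ler_wpM2r; first exact: powR_ge0.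
    have -> : 9 = 3 `^ 2%:R :> R by rewrite powR_mulrn// -natrX.
    by apply: ler_powR; rewrite ?ler1n//; case/andP: alpha12 => _ /ltW.
  have xk := powR_gt0 alpha (x0 k kK).
  apply: (@le_trans _ _ (c * ((nu k / 8) / (9 * x k `^ alpha)))).
    rewrite powRN.
    have -> : c * (nu k / 8 / (9 * x k `^ alpha)) = (c / 72) * (nu k / x k `^ alpha).
      by field; rewrite gt_eqF.
    apply: ler_wpM2r; first by rewrite divr_ge0// ltW// nu0.
    have -> : c / 72 = (72 / c)^-1 by rewrite invf_div.
    by rewrite lef_pV2 ?posrE// /C; lra.
  apply: ler_wpM2l; first exact: ltW.
  apply: ler_pM; rewrite ?divr_ge0 ?invr_ge0 ?mulr_ge0 ?(ltW xk) ?(ltW (nu0 k kK))//.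
    exact: pn_lo.
  by rewrite lef_pV2 ?posrE ?mulr_gt0// powR_gt0// mulr_gt0// x0.
apply: lerD => //; rewrite -big_split/= mulr_sumr big_seq [leRHS]big_seq.
apply: ler_sum => k kK.
have HB : pr (B k) <= tail_const / 8 * (xa k * (8 * phi k)).
  apply: (le_trans (step_tail (vf k kK) (x0 k kK))).
  apply: ler_pM.
  - by rewrite divr_ge0// subr_ge0 cos_le1.
  - by rewrite mulr_ge0 ?powR_ge0 ?pn_ge0.
  - rewrite /tail_const; have c1 : 0 < 1 - cos (1 : R) by rewrite subr_gt0 cos1_lt1.
    have : 0 < (1 - cos (1 : R))^-1 by rewrite invr_gt0.
    lra.
  - by apply: ler_wpM2l; [exact: powR_ge0|exact: pn_far].
have [_ _ HD] := Hs k kK.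
have := e4 k; move: HB HD; rewrite -/(D k) -/(xa k) /C.
have p : 0 <= phi k * xa k by rewrite mulr_ge0 ?ltW ?phi0 ?xa0.
have p1 : 0 <= 72 / c * (phi k * xa k) by rewrite mulr_ge0// divr_ge0// ltW.
have p2 : 0 <= tail_const * (phi k * xa k) by rewrite mulr_ge0// ltW.
lra.
Qed.

End stable_bounds.

(** * Riemann sums and integrals of powers *)

Section riemann_sums.
Context (R : realType).
Local Notation mu := (@lebesgue_measure R).

Definition riemann (g : R -> R) (c h : R) (m : nat) : R :=
  h / m.+1%:R * \sum_(i < m.+1) g (c + i%:R * (h / m.+1%:R)).

Lemma near_mesh (h e : R) : 0 < e -> \forall m \near \oo, h / m.+1%:R < e.
Proof.
move=> e0; exists (Num.truncn (`|h| / e)) => // m /= hm.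
rewrite ltr_pdivrMr// mulrC -ltr_pdivrMr//; apply: (@le_lt_trans _ _ (`|h| / e)).
  by rewrite ler_pM2r ?invr_gt0// ler_norm.
have /andP[_] := Num.Theory.truncn_itv (divr_ge0 (normr_ge0 h) (ltW e0)).
by move=> /lt_le_trans; apply; rewrite ler_nat.
Qed.

Lemma compact_support_bounded (g : R -> R) c h : 0 < h -> continuous g ->
  (forall t, t \notin `[c, c + h[ -> g t = 0) ->
  exists2 M, 0 <= M & forall t, `|g t| <= M.
Proof.
move=> h0 cg g0; have ch : c <= c + h by rewrite lerDl ltW.
have cg' : {within `[c, c + h], continuous (fun t => `|g t|)}.
  by apply: continuous_subspaceT => x; apply: continuous_comp; [exact: cg|exact: norm_continuous].
have [z _ zM] := EVT_max ch cg'.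
exists `|g z| => // t; have [tI|tI] := boolP (t \in `[c, c + h]); first exact: zM.
rewrite g0 ?normr0//; apply: contraNN tI; rewrite !in_itv/= => /andP[-> /ltW ->] //.
Qed.

(** The sum is the integral of the step function [G m], which converges pointwise by continuity and
    is dominated by a multiple of the indicator of [c, c + h]. *)
Lemma riemann_cvg (g : R -> R) c h : 0 < h -> continuous g ->
  (forall t, t \notin `[c, c + h[ -> g t = 0) ->
  riemann g c h m @[m --> \oo] --> (\int[mu]_t g t)%R.
Proof.
move=> h0 cg g0.
have [M M0 gM] := compact_support_bounded h0 cg g0.
have mg : measurable_fun [set: R] g by exact: continuous_measurable_fun.
pose dl m : R := h / m.+1%:R.
have dl0 m : 0 < dl m by rewrite divr_gt0.
pose J m (i : nat) : set R := `[c + i%:R * dl m, c + i.+1%:R * dl m[%classic.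
pose G m t := \sum_(i < m.+1) g (c + i%:R * dl m) * \1_(J m i) t.
have mG m : measurable_fun [set: R] (G m).
  apply: measurable_sum => i; apply: measurable_funM; first exact: measurable_cst.
  by apply: measurable_indic; exact: measurable_itv.
have dlm m : m.+1%:R * dl m = h by rewrite /dl mulrC divfK.
have Gin m t : t \in `[c, c + h[ -> exists i : 'I_m.+1,
    [/\ G m t = g (c + i%:R * dl m) & `|t - (c + i%:R * dl m)| <= dl m].
  rewrite in_itv/= => /andP[ct tc].
  have q0 : 0 <= (t - c) / dl m by rewrite divr_ge0 ?subr_ge0// ltW.
  have qt := Num.Theory.truncn_itv q0.
  have qm : (Num.truncn ((t - c) / dl m) < m.+1)%N.
    have /andP[q1 _] := qt; rewrite -(ltr_nat R); apply: (le_lt_trans q1).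
    by rewrite ltr_pdivrMr// dlm ltrBlDl.
  exists (Ordinal qm); split => /=.
    rewrite /G (bigD1 (Ordinal qm))//= big1 ?addr0.
      rewrite indicE mem_set ?mulr1//= /J /= in_itv/=; case/andP: qt.
      by rewrite ler_pdivlMr// ltr_pdivrMr// => q1 q2; rewrite -lerBrDl -ltrBlDl q1 q2.
    move=> i /eqP iq; rewrite indicE; case: (boolP (_ \in _)); rewrite ?mulr0//.
    rewrite inE /J /= in_itv/= -lerBrDl -ltrBlDl => /andP[i1 i2]; exfalso; apply: iq.
    apply/val_inj => /=; apply/esym/eqP; rewrite Num.Theory.truncn_eq//.
    by rewrite ler_pdivlMr// ltr_pdivrMr// i1.
  move: qt; set q := Num.truncn _; rewrite -(natr1 q) => /andP[].
  rewrite ler_pdivlMr// ltr_pdivrMr// mulrDl mul1r => q1 q2.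
  by rewrite ler_norml; apply/andP; split; move: q1 q2; have := dl0 m; lra.
have Gout m t : t \notin `[c, c + h[ -> G m t = 0.
  move=> tI; rewrite /G big1// => i _; rewrite indicE.
  case: (boolP (_ \in _)); rewrite ?mulr0// inE /J /= in_itv/= => /andP[i1 i2].
  exfalso; move/negP: tI; apply; rewrite in_itv/=; apply/andP; split.
    by rewrite (le_trans _ i1)// lerDl mulr_ge0// ltW.
  apply: (lt_le_trans i2); rewrite lerD2l -(dlm m); apply: ler_wpM2r; first exact: ltW.
  by rewrite ler_nat.
have GM m t : `|G m t| <= M * \1_(`[c, c + h]%classic) t.
  rewrite indicE; have [tI|tI] := boolP (t \in `[c, c + h[).
    rewrite mem_set ?mulr1; last first.
      by move: tI; rewrite /= !in_itv/= => /andP[-> /ltW ->].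
    by have [i [-> _]] := Gin m t tI.
  by rewrite Gout// normr0 mulr_ge0.
have Gcvg t : G m t @[m --> \oo] --> g t.
  have [tI|tI] := boolP (t \in `[c, c + h[); last first.
    by rewrite g0//; under eq_fun do rewrite Gout//; exact: cvg_cst.
  apply/cvgrPdist_le => e e0.
  have /cvgrPdist_le/(_ _ e0)/nbhs_ballP[r /= r0 hr] := cg t.
  near=> m; have [i [-> ti]] := Gin m t tI; apply: hr.
  rewrite /ball/=; apply: (le_lt_trans ti).
  by near: m; exact: near_mesh.
have ci : mu.-integrable setT (fun t => (M * \1_(`[c, c + h]%classic) t)%:E).
  under eq_fun do rewrite EFinM; apply: integrableZl => //.
  exact: integrable_indic_itv.
have [] := @dominated_convergence _ _ _ mu setT measurableT (fun m t => (G m t)%:E)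
    (fun t => (g t)%:E) (fun t => (M * \1_(`[c, c + h]%classic) t)%:E).
- by move=> m; apply/measurable_EFinP; exact: mG.
- exact/measurable_EFinP.
- by apply: aeW => t _; apply: cvg_EFin; [exact: nearW|exact: Gcvg].
- exact: ci.
- by apply: aeW => t m _; rewrite lee_fin.
move=> ig _ cvgG.
suff H : (riemann g c h m)%:E @[m --> \oo] --> (\int[mu]_t g t)%R%:E.
  exact: (fine_cvg H).
rewrite /Rintegral fineK; last exact: integrable_fin_num.
move: cvgG; apply: cvg_trans; apply: near_eq_cvg; apply: nearW => m /=.
apply/esym; rewrite /riemann /G mulr_sumr -sumEFin.
under [RHS]eq_integral do rewrite -sumEFin.
rewrite integral_sum//=; last first.
  move=> i; under eq_fun do rewrite EFinM; apply: integrableZl => //.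
  exact: integrable_indic_itv.
apply: eq_bigr => i _; under eq_integral do rewrite EFinM.
rewrite integralZl//; last exact: integrable_indic_itv.
rewrite integral_indic//; last exact: measurable_itv.
rewrite (_ : J m i `&` _ = J m i); last exact: setIT.
rewrite EFinM muleC; congr (_ * _)%E.
rewrite -[RHS]/(lebesgue_measure (J m i)) lebesgue_measure_itv/= lte_fin.
have lt : c + i%:R * dl m < c + i.+1%:R * dl m.
  by rewrite ltrD2l ltr_pM2r// ltr_nat.
rewrite lt -EFinB; congr EFin; rewrite -(natr1 i) /dl; ring.
Unshelve. all: by end_near.
Qed.

End riemann_sums.

Section affine_change_of_variable.
Context (R : realType).
Local Notation mu := (@lebesgue_measure R).

(** The rescaled image measure agrees with Lebesgue measure on the intervals ]a, b], which determine
    it. *)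
Lemma lebesgue_affine (c e : R) (A : set R) : 0 < c -> measurable A ->
  mu A = (c%:E * mu ((fun x => c * x + e)%R @^-1` A))%E.
Proof.
move=> c0 mA.
have mphi : measurable_fun [set: measurableTypeR R] (fun x => c * x + e : measurableTypeR R).
  by apply: measurable_funD => //; exact: mulrl_measurable.
pose phi (x : measurableTypeR R) : measurableTypeR R := c * x + e.
have c0' : 0 <= c by exact: ltW.
pose m' : {measure set (measurableTypeR R) -> \bar R} :=
  mscale (NngNum c0') (pushforward (@lebesgue_measure R) phi).
pose m := m' mphi.
have -> : (c%:E * mu ((fun x => c * x + e)%R @^-1` A))%E = m A by [].
apply: lebesgue_measure_unique => // _ [[a b]] _ <-.
rewrite /m /= /mscale /= /pushforward.
have -> : phi @^-1` `]a, b]%classic = `](a - e) / c, (b - e) / c]%classic.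
  by apply/seteqP; split => x /=; rewrite /phi !in_itv/= ltr_pdivrMr// ler_pdivlMr// ltrBlDr lerBrDr mulrC.
rewrite !lebesgue_measure_itv/= !lte_fin ltr_pM2r ?invr_gt0// ltrD2r.
case: ifPn => _; last by rewrite mule0.
by rewrite -!EFinB -EFinM; congr EFin; field; rewrite gt_eqF.
Qed.

Lemma ge0_integral_affine (c e : R) (g : R -> \bar R) : 0 < c ->
  measurable_fun [set: R] g -> (forall x, 0 <= g x)%E ->
  (\int[mu]_x g x = c%:E * \int[mu]_x g (c * x + e)%R)%E.
Proof.
move=> c0 mg g0.
have mphi : measurable_fun [set: measurableTypeR R] (fun x => c * x + e : measurableTypeR R).
  by apply: measurable_funD => //; exact: mulrl_measurable.
pose phi (x : measurableTypeR R) : measurableTypeR R := c * x + e.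
have c0' : 0 <= c by exact: ltW.
pose m' : {measure set (measurableTypeR R) -> \bar R} :=
  mscale (NngNum c0') (pushforward (@lebesgue_measure R) phi).
pose m := m' mphi.
transitivity (\int[m]_x g x)%E.
  by apply: eq_measure_integral => A mA _; exact: lebesgue_affine.
rewrite ge0_integral_mscale//; congr (_ * _)%E.
by rewrite ge0_integral_pushforward.
Qed.

End affine_change_of_variable.

Section power_tail.
Context (R : realType).
Local Notation mu := (@lebesgue_measure R).

Lemma powRN_cvgy (s : R) : 0 < s -> x `^ (- s) @[x --> +oo] --> 0.
Proof.
move=> s0; apply/cvgrPdist_le => e e0; near=> x.
have x0 : 0 < x by near: x; exact: nbhs_pinfty_gt.
rewrite sub0r normrN ger0_norm ?powR_ge0//.
have xe : e `^ (- s^-1) <= x by near: x; exact: nbhs_pinfty_ge.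
have -> : e = (e `^ (- s^-1)) `^ (- s).
  by rewrite -powRrM mulrNN mulVf ?gt_eqF// powRr1// ltW.
have h0 : 0 < e `^ (- s^-1) by rewrite powR_gt0.
rewrite [leLHS]powRN [leRHS]powRN lef_pV2 ?posrE ?powR_gt0//.
by apply: ge0_ler_powR; rewrite ?nnegrE ?(ltW s0) ?(ltW x0) ?(ltW h0).
Unshelve. all: by end_near.
Qed.

Lemma integral_powRN (r : R) : 1 < r ->
  (\int[mu]_(x in `[1%R, +oo[) (x `^ (- r))%:E)%E = ((r - 1)^-1)%:E.
Proof.
move=> r1; have r10 : 0 < r - 1 by rewrite subr_gt0.
pose F x : R := (- (r - 1)^-1) * x `^ (1 - r).
have dF x : 0 < x -> derivable F x 1.
  by move=> x0; apply: derivableM => //; apply: derivable_powR; rewrite in_itv/= x0.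
have cF (q x : R) : 0 < x -> {for x, continuous (fun x => x `^ q)}.
  move=> x0; apply: differentiable_continuous; apply/derivable1_diffP.
  by apply: derivable_powR; rewrite in_itv/= x0.
rewrite (@ge0_continuous_FTC2y _ (fun x => x `^ (- r)) F 1 0).
- by rewrite /F powR1 -EFinB; congr EFin; ring.
- by move=> x _; exact: powR_ge0.
- apply: continuous_in_subspaceT => x; rewrite inE/= in_itv/= andbT => x1.
  by apply: cF; exact: lt_le_trans x1.
- rewrite -(mulr0 (- (r - 1)^-1)); apply: cvgM; first exact: cvg_cst.
  by rewrite -opprB; exact: powRN_cvgy.
- by move=> x x1; apply: dF; exact: lt_trans x1.
- apply: cvg_at_right_filter; apply: cvgM; first exact: cvg_cst.
  exact: cF.
- move=> x; rewrite in_itv/= andbT => x1; have x0 := lt_trans ltr01 x1.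
  rewrite derive1E deriveM//; last by apply: derivable_powR; rewrite in_itv/= x0.
  rewrite derive_cst scaler0 addr0 -derive1E powR_derive1 ?in_itv/= ?x0//.
  rewrite /GRing.scale/= mulrA addrAC subrr add0r.
  by rewrite (_ : - (r - 1)^-1 * (1 - r) = 1) ?mul1r//; field; rewrite gt_eqF.
Qed.

(** The tail sits on the negative side because the wavelet kernel vanishes on [1, +oo[. *)
Definition tail_pow (r x : R) : R := \1_(`]-oo, (-1)]%classic) x * `|x| `^ (- r).

Lemma measurable_tail_pow r : measurable_fun [set: R] (tail_pow r).
Proof.
apply: measurable_funM; first by apply: measurable_indic; exact: measurable_itv.
exact: (measurableT_comp (@measurable_powR R (- r)) (@normr_measurable R setT)).
Qed.

Lemma integral_tail_pow (r : R) : 1 < r ->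
  (\int[mu]_x (tail_pow r x)%:E)%E = ((r - 1)^-1)%:E.
Proof.
move=> r1; rewrite -integral_powRN//.
pose f x : \bar R := (\1_(`[1, +oo[%classic) x * `|x| `^ (- r))%:E.
have mf : measurable_fun [set: R] f.
  apply/measurable_EFinP; apply: measurable_funM.
    by apply: measurable_indic; exact: measurable_itv.
  exact: (measurableT_comp (@measurable_powR R (- r)) (@normr_measurable R setT)).
have f0 x : (0 <= f x)%E by rewrite lee_fin mulr_ge0 ?powR_ge0// indicE ler0n.
transitivity (\int[mu]_(x in `[0%R, +oo[) f x)%E; last first.
  rewrite integral_mkcond [RHS]integral_mkcond; apply: eq_integral => x _.
  rewrite !patchE !mem_setE !in_itv/= !andbT /f indicE mem_setE in_itv/= andbT.
  case: (leP 1 x) => x1; last by rewrite mul0r; case: ifP.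
  by rewrite (le_trans ler01 x1) mul1r ger0_norm// (le_trans ler01 x1).
rewrite (ge0_integration_by_substitution0 mf f0).
rewrite [RHS]integral_mkcond; apply: eq_integral => x _.
rewrite patchE !mem_setE !in_itv/= /f /tail_pow !indicE !mem_setE !in_itv/= andbT normrN lerNr.
case: ifPn => // x0; rewrite (_ : (1 <= - x) = false) ?mul0r//.
apply/negbTE; apply: contraNN x0 => x1; rewrite -oppr_ge0.
exact: le_trans x1.
Qed.

End power_tail.

(** * The wavelet kernel *)

Section positive_part_power.
Context (R : realType) (kappa : R) (kappa01 : 0 < kappa < 1).

Let k0 : 0 < kappa. Proof. by case/andP: kappa01. Qed.
Let k1 : kappa < 1. Proof. by case/andP: kappa01. Qed.

Lemma pospow_ge0 x : 0 <= pospow x kappa.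
Proof. by rewrite /pospow; case: ifP => // _; exact: powR_ge0. Qed.

Lemma pospow_le0 x : x <= 0 -> pospow x kappa = 0.
Proof. by rewrite /pospow ltNge => ->. Qed.

Lemma pospow_powR x : 0 <= x -> pospow x kappa = x `^ kappa.
Proof.
rewrite le_eqVlt => /predU1P[<-|x0]; last by rewrite /pospow x0.
by rewrite pospow_le0// powR0// gt_eqF.
Qed.

Lemma le_pospow x y : x <= y -> pospow x kappa <= pospow y kappa.
Proof.
move=> xy; have [x0|x0] := leP x 0; first by rewrite pospow_le0// pospow_ge0.
have y0 := lt_le_trans x0 xy.
rewrite (pospow_powR (ltW x0)) (pospow_powR (ltW y0)).
by apply: ge0_ler_powR => //; rewrite ?nnegrE; exact: ltW.
Qed.

(** For u = s and u = t, u / (s + t) <= (u / (s + t))^kappa since kappa < 1; the left sides add up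
    to 1. *)
Lemma powR_subadd (s t : R) : 0 <= s -> 0 <= t ->
  (s + t) `^ kappa <= s `^ kappa + t `^ kappa.
Proof.
move=> s0 t0; have [st0|st] := eqVneq (s + t) 0.
  by rewrite st0 powR0 ?gt_eqF// addr_ge0// powR_ge0.
have stp : 0 < s + t by rewrite lt_neqAle eq_sym st addr_ge0.
have H u : 0 <= u -> u <= s + t -> u / (s + t) * (s + t) `^ kappa <= u `^ kappa.
  move=> u0 us; have [->|un] := eqVneq u 0; first by rewrite !mul0r powR_ge0.
  have up : 0 < u by rewrite lt_neqAle eq_sym un.
  rewrite -[X in _ <= X `^ _](@divfK _ (s + t))// powRM ?divr_ge0 ?(ltW stp)//.
  apply: ler_wpM2r; first exact: powR_ge0.
  by apply: ger1_powR; [rewrite divr_gt0//= ler_pdivrMr// mul1r|exact: ltW].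
have h1 : s <= s + t by rewrite lerDl.
have h2 : t <= s + t by rewrite lerDr.
have := lerD (H s s0 h1) (H t t0 h2).
by rewrite -mulrDl -mulrDl divff// mul1r.
Qed.

Lemma pospow_dist (s t : R) :
  `|pospow s kappa - pospow t kappa| <= `|s - t| `^ kappa.
Proof.
wlog st : s t / t <= s.
  by move=> H; have [/H//|/ltW/H] := leP t s; rewrite distrC [X in X `^ _]distrC.
rewrite !ger0_norm ?subr_ge0 ?le_pospow//.
have [t0|t0] := leP t 0.
  rewrite (pospow_le0 t0) subr0; have [s0|s0] := leP s 0.
    by rewrite pospow_le0// powR_ge0.
  rewrite (pospow_powR (ltW s0)); apply: ge0_ler_powR; rewrite ?nnegrE ?(ltW k0) ?(ltW s0)//; lra.
have s0 := lt_le_trans t0 st.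
rewrite (pospow_powR (ltW s0)) (pospow_powR (ltW t0)) lerBlDr.
by have := powR_subadd (_ : 0 <= s - t) (ltW t0); rewrite subrK; apply; rewrite subr_ge0.
Qed.

Lemma continuous_pospow : continuous (fun x => pospow x kappa).
Proof.
move=> x; apply/cvgrPdist_lt => e e0; near=> y.
apply: (le_lt_trans (pospow_dist _ _)).
have -> : e = (e `^ kappa^-1) `^ kappa by rewrite -powRrM mulVf ?gt_eqF// powRr1// ltW.
apply: gt0_ltr_powR; rewrite ?nnegrE ?powR_ge0//.
near: y; apply/nbhs_ballP; exists (e `^ kappa^-1); first by rewrite /= powR_gt0.
by move=> y; rewrite /ball.
Unshelve. all: by end_near.
Qed.

(** Young's inequality for (1 + t)^kappa and 1, with conjugate exponents 1 / kappa and 1 / (1 -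
    kappa). *)
Lemma bernoulli_le (t : R) : 0 <= t -> (1 + t) `^ kappa <= 1 + kappa * t.
Proof.
move=> t0; have p0 : 0 < kappa^-1 by rewrite invr_gt0.
have q0 : 0 < (1 - kappa)^-1 by rewrite invr_gt0 subr_gt0.
have := @conjugate_powR R ((1 + t) `^ kappa) 1 kappa^-1 (1 - kappa)^-1.
rewrite powR_ge0 ler01 p0 q0 !invrK addrCA subrr addr0 => /(_ isT isT isT isT erefl).
rewrite mulr1 -powRrM divff ?gt_eqF// powRr1 ?addr_ge0// powR1; lra.
Qed.

End positive_part_power.

(** The upper bound for the exponent 1 - kappa is inserted in (1 + t)^kappa = (1 + t) / (1 + t)^(1 -
    kappa). *)
Lemma bernoulli_ge (R : realType) (kappa t : R) : 0 < kappa < 1 -> 0 <= t ->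
  1 + kappa * t - t ^+ 2 <= (1 + t) `^ kappa.
Proof.
move=> k01 t0; have /andP[k0 k1] := k01.
have k01' : 0 < 1 - kappa < 1 by lra.
have B := bernoulli_le k01' t0.
have t1 : 0 < 1 + t by lra.
have E : (1 + t) `^ kappa * (1 + t) `^ (1 - kappa) = 1 + t.
  rewrite -powRD; last by rewrite (gt_eqF t1) implybT.
  by rewrite (_ : kappa + (1 - kappa) = 1) ?powRr1 ?(ltW t1)//; ring.
have D0 : 0 < 1 + (1 - kappa) * t by rewrite ltr_wpDr// mulr_ge0//; lra.
apply: (@le_trans _ _ ((1 + t) / (1 + (1 - kappa) * t))); last first.
  by rewrite ler_pdivrMr// -[leLHS]E; apply: ler_wpM2l; [exact: powR_ge0|].
rewrite ler_pdivlMr// -subr_ge0.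
have -> : 1 + t - (1 + kappa * t - t ^+ 2) * (1 + (1 - kappa) * t) =
  t ^+ 2 * ((1 - kappa) + kappa * kappa) + (1 - kappa) * t ^+ 3 by ring.
rewrite addr_ge0// mulr_ge0 ?exprn_ge0//; first by rewrite addr_ge0 ?mulr_ge0//; lra.
by lra.
Qed.

Section compact_support.
Context (R : realType).
Local Notation mu := (@lebesgue_measure R).
Implicit Types g : R -> R.

Lemma integrable_compact_support g c h : 0 < h -> continuous g ->
  (forall t, t \notin `[c, c + h[ -> g t = 0) ->
  mu.-integrable setT (EFin \o g).
Proof.
move=> h0 cg g0; have [M M0 gM] := compact_support_bounded h0 cg g0.
apply: (@le_integrable _ _ _ mu setT measurableT (EFin \o g)
  (fun t => (M * \1_(`[c, c + h]%classic) t)%:E)).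
- by apply/measurable_EFinP; exact: continuous_measurable_fun.
- move=> t _ /=; rewrite lee_fin [leRHS]ger0_norm ?mulr_ge0 ?indicE ?ler0n//.
  have [tI|tI] := boolP (t \in `[c, c + h[); last by rewrite g0// normr0 mulr_ge0.
  by rewrite mem_set ?mulr1//=; move: tI; rewrite !in_itv/= => /andP[-> /ltW ->].
- under eq_fun do rewrite EFinM; apply: integrableZl => //.
  exact: integrable_indic_itv.
Qed.

Lemma norm_integral_le g (B : R) : continuous g ->
  (forall t, t \notin `[0, 1[ -> g t = 0) ->
  (forall t, t \in `[0, 1[ -> `|g t| <= B) ->
  `|(\int[mu]_t g t)%R| <= B.
Proof.
move=> cg g0 gB.
have gB' t : `|g t| <= B.
  have [/gB//|tI] := boolP (t \in `[0, 1[); rewrite g0// normr0.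
  by apply: (le_trans (normr_ge0 (g 0))); apply: gB; rewrite in_itv/= lexx ltr01.
have g0' t : t \notin `[0, 0 + 1[ -> g t = 0 by rewrite add0r; exact: g0.
have H : `|riemann g 0 1 m| @[m --> \oo] --> `|(\int[mu]_t g t)%R|.
  by apply: cvg_norm; exact: riemann_cvg.
apply: (@cvgr_to_le _ _ _ _ _ _ _ H); apply: nearW => m; rewrite /riemann.
rewrite normrM ger0_norm ?divr_ge0// mul1r ler_pdivrMl//.
apply: (@le_trans _ _ (\sum_(i < m.+1) B)).
  by rewrite (le_trans (ler_norm_sum _ _ _))// ler_sum.
by rewrite sumr_const card_ord mulr_natl.
Qed.

End compact_support.

Section wavelet_kernel.
Context (R : realType) (psi : R -> R) (hpsi : analyzing_wavelet psi).
Local Notation mu := (@lebesgue_measure R).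

Let cpsi : continuous psi. Proof. by case: hpsi. Qed.

(** By continuity from the right of 1. This makes the support fit the half-open interval required by
    [riemann_cvg]. *)
Lemma wavelet1 : psi 1 = 0.
Proof.
apply/eqP; rewrite -normr_le0; apply/ler_addgt0Pl => e e0; rewrite addr0.
have /cvgrPdist_le/(_ _ e0)/nbhs_ballP[r /= r0 H] := @cpsi 1.
have := H (1 + r / 2); rewrite /ball/= opprD addNKr normrN ger0_norm ?divr_ge0 ?(ltW r0)//.
rewrite ltr_pdivrMr// ltr_pMr// ltr1n => /(_ isT).
case: hpsi => _ _ H0 _ _; rewrite (H0 (1 + r / 2)) ?subr0//.
by rewrite in_itv/= negb_and -!ltNge; apply/orP; right; rewrite ltrDl divr_gt0.
Qed.

Lemma wavelet_out y : y \notin `[0, 1[ -> psi y = 0.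
Proof.
have [->|y1] := eqVneq y 1; first by rewrite wavelet1.
case: hpsi => _ _ H _ _ yI; apply: H; apply: contraNN yI; rewrite !in_itv/=.
by move=> /andP[-> ?]; rewrite lt_neqAle y1.
Qed.

Lemma wavelet_bounded : exists2 M, 0 < M & forall y, `|psi y| <= M.
Proof.
have /(compact_support_bounded ltr01 cpsi)[M M0 pM] : forall t, t \notin `[0, 0 + 1[ -> psi t = 0.
  by move=> t; rewrite add0r; exact: wavelet_out.
by exists (M + 1); [rewrite ltr_wpDl|move=> y; rewrite (le_trans (pM y))// lerDl].
Qed.

Section fixed_exponent.
Context (kappa : R) (kappa01 : 0 < kappa < 1).

Definition kernel_integrand (x y : R) : R := pospow (y - x) kappa * psi y.

Definition wavelet_kernel (x : R) : R := (\int[mu]_y kernel_integrand x y)%R.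

Lemma continuous_kernel_integrand x : continuous (kernel_integrand x).
Proof.
move=> y; apply: cvgM; last exact: cpsi.
apply: (@continuous_comp _ _ _ (fun y => y - x) (fun z => pospow z kappa)).
  by apply: cvgB; [exact: cvg_id|exact: cvg_cst].
exact: continuous_pospow.
Qed.

Lemma kernel_integrand_out x y : y \notin `[0, 0 + 1[ -> kernel_integrand x y = 0.
Proof. by rewrite add0r /kernel_integrand => /wavelet_out ->; rewrite mulr0. Qed.

Lemma wavelet_kernel_riemann x :
  riemann (kernel_integrand x) 0 1 m @[m --> \oo] --> wavelet_kernel x.
Proof.
apply: riemann_cvg => //; first exact: continuous_kernel_integrand.
exact: kernel_integrand_out.
Qed.

Lemma measurable_pospow (f : R -> R) : measurable_fun [set: R] f ->
  measurable_fun [set: R] (fun x => pospow (f x) kappa).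
Proof.
move=> mf; apply: (@measurableT_comp _ _ _ _ _ _ (fun z => pospow z kappa)) => //.
by apply: continuous_measurable_fun; exact: continuous_pospow.
Qed.

Lemma measurable_wavelet_kernel : measurable_fun [set: R] wavelet_kernel.
Proof.
apply: (@measurable_fun_cvg _ _ _ setT (fun m x => riemann (kernel_integrand x) 0 1 m)).
  move=> m; apply: measurable_funM => //; apply: measurable_sum => i.
  apply: measurable_funM => //; apply: measurable_pospow.
  exact: measurable_funB.
by move=> x _; exact: wavelet_kernel_riemann.
Qed.

Lemma wavelet_kernel_right x : 1 <= x -> wavelet_kernel x = 0.
Proof.
move=> x1; rewrite /wavelet_kernel (_ : kernel_integrand x = cst 0).
  by rewrite Rintegral_cst// mul0r.
apply/funext => y; rewrite /kernel_integrand; have [yI|] := boolP (y \in `[0, 1[).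
  move: yI; rewrite in_itv/= => /andP[_ y1]; rewrite pospow_le0 ?mul0r//; lra.
by move=> /wavelet_out ->; rewrite mulr0.
Qed.

Lemma wavelet_kernel_mid M x : (forall y, `|psi y| <= M) -> -1 <= x ->
  `|wavelet_kernel x| <= 2 * M.
Proof.
move=> pM x1; apply: norm_integral_le; first exact: continuous_kernel_integrand.
  by move=> t tI; apply: kernel_integrand_out; rewrite add0r.
move=> t; rewrite in_itv/= => /andP[t0 t1]; rewrite normrM; apply: ler_pM => //.
rewrite ger0_norm ?pospow_ge0//; have /andP[k0 k1] := kappa01.
apply: (@le_trans _ _ (pospow 2 kappa)); first by apply: le_pospow => //; lra.
by rewrite pospow_powR// ler1_powR ?ler1n// ltW.
Qed.

(** The vanishing moments allow subtracting from (y + |x|)^kappa its first order Taylor polynomial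
    at y = 0; the Bernoulli bounds leave a remainder of at most |x|^kappa (y / |x|)^2. *)
Lemma wavelet_kernel_left M x : (forall y, `|psi y| <= M) -> x <= -1 ->
  `|wavelet_kernel x| <= M * `|x| `^ (kappa - 2).
Proof.
move=> pM x1; set X := `|x|.
have XE : X = - x by rewrite /X ler0_norm//; lra.
have X1 : 1 <= X by rewrite XE; lra.
have X0 : 0 < X by lra.
have /andP[k0 k1] := kappa01.
pose A := X `^ kappa; pose B := kappa * X `^ (kappa - 1).
pose g y := kernel_integrand x y - (A * psi y + B * (y * psi y)).
have cyp : continuous (fun y : R => y * psi y) by move=> y; apply: cvgM => //; exact: cpsi.
have ip : mu.-integrable setT (EFin \o psi).
  by apply: (integrable_compact_support ltr01 (c := 0)) => // t; rewrite add0r; exact: wavelet_out.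
have iyp : mu.-integrable setT (EFin \o (fun y => y * psi y)).
  apply: (integrable_compact_support ltr01 (c := 0)) => // t.
  by rewrite add0r => /wavelet_out ->; rewrite mulr0.
have ik : mu.-integrable setT (EFin \o kernel_integrand x).
  by apply: (integrable_compact_support ltr01 (c := 0));
    [exact: continuous_kernel_integrand|exact: kernel_integrand_out].
have iZ (c : R) (f : R -> R) : mu.-integrable setT (EFin \o f) ->
    mu.-integrable setT (EFin \o (fun y => c * f y)).
  by move=> h; rewrite (_ : _ \o _ = (fun y => c%:E * (EFin \o f) y)%E)//; exact: integrableZl.
have iAB : mu.-integrable setT (EFin \o (fun y => A * psi y + B * (y * psi y))).
  rewrite (_ : _ \o _ = (EFin \o (fun y => A * psi y)) \+ (EFin \o (fun y => B * (y * psi y))))//.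
  by apply: integrableD => //; exact: iZ.
have -> : wavelet_kernel x = (\int[mu]_y g y)%R.
  rewrite /g RintegralB// RintegralD//; [|exact: iZ|exact: iZ].
  rewrite !RintegralZl//; case: hpsi => _ _ _ -> ->.
  by rewrite !mulr0 addr0 subr0.
apply: norm_integral_le.
- move=> y; apply: cvgB; first exact: continuous_kernel_integrand.
  by apply: cvgD; apply: cvgM; [exact: cvg_cst|exact: cpsi|exact: cvg_cst|exact: cyp].
- move=> t tI; rewrite /g kernel_integrand_out ?add0r// wavelet_out//.
  by rewrite !mulr0 addr0 oppr0.
move=> y; rewrite in_itv/= => /andP[y0 y1].
have -> : g y = (pospow (y - x) kappa - A - B * y) * psi y by rewrite /g /kernel_integrand; ring.
rewrite normrM mulrC; apply: ler_pM => //.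
pose t := y / X; have t0 : 0 <= t by rewrite divr_ge0// ltW.
have E1 : pospow (y - x) kappa = A * (1 + t) `^ kappa.
  rewrite (pospow_powR kappa01); last by rewrite -XE addr_ge0// ltW.
  rewrite -XE /A -powRM ?(ltW X0)//; last by lra.
  by congr (_ `^ _); rewrite /t; field; rewrite gt_eqF.
have XB : X * X `^ (kappa - 1) = A by rewrite /A mulr_powRB1// ltW.
have E2 : B * y = A * (kappa * t).
  by rewrite /B /t -XB; field; rewrite gt_eqF.
rewrite E1 E2 (_ : _ - _ - _ = A * ((1 + t) `^ kappa - 1 - kappa * t)); last by ring.
have h1 := bernoulli_le kappa01 t0; have h2 := bernoulli_ge kappa01 t0.
have A0 : 0 < A by rewrite powR_gt0.
rewrite normrM (gtr0_norm A0).
apply: (@le_trans _ _ (A * t ^+ 2)).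
  by apply: ler_wpM2l; [exact: ltW|rewrite ler_norml; apply/andP; split; nra].
have -> : X `^ (kappa - 2) = A / X ^+ 2.
  by rewrite powRB ?(gt_eqF X0) ?implybT// -[2]/(2%:R) powR_mulrn ?(ltW X0).
apply: ler_wpM2l; first exact: ltW.
rewrite /t expr_div_n ler_pdivrMr ?exprn_gt0// mulVf ?gt_eqF ?exprn_gt0//.
by rewrite exprn_ile1// ltW.
Qed.

End fixed_exponent.
End wavelet_kernel.

(** * Upper bounds of the kernel in L^alpha, and a nonvanishing moment of psi *)

Section wavelet_kernel_norm.
Context (R : realType) (alpha : R) (alpha12 : 1 < alpha < 2).
Context (psi : R -> R) (hpsi : analyzing_wavelet psi).
Local Notation mu := (@lebesgue_measure R).
Local Notation pnorm := (pnorm alpha).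

Let a0 : 0 < alpha := alpha_gt0 alpha12.
Let cpsi : continuous psi. Proof. by case: hpsi. Qed.

Lemma ler_powR_alpha (x y : R) : 0 <= x -> x <= y -> x `^ alpha <= y `^ alpha.
Proof.
move=> x0 xy; apply: ge0_ler_powR => //; rewrite ?nnegrE ?(ltW a0)//.
exact: le_trans xy.
Qed.

Section upper.
Context (M : R) (M0 : 0 < M) (psiM : forall y, `|psi y| <= M).
Context (r : R) (r1 : 1 < r).
Context (kappa : R) (kappa01 : 0 < kappa < 1) (kappar : r <= (1 - kappa) * alpha).
Local Notation Phi := (wavelet_kernel psi kappa).

Let mPhi := measurable_wavelet_kernel hpsi kappa01.
Let mtail := @measurable_tail_pow R r.

Lemma tail_pow_ge0 x : 0 <= tail_pow r x.
Proof. by rewrite mulr_ge0 ?powR_ge0// indicE ler0n. Qed.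

(** |x|^((kappa - 2) alpha) splits into |x|^(- alpha), at most A^(- alpha), and |x|^(- (1 - kappa)
    alpha), at most |x|^(- r): the gain from the distance and an integrable factor free of kappa. *)
Lemma wavelet_kernel_tail A x : 1 <= A -> x <= - A ->
  `|Phi x| `^ alpha <= (2 * M) `^ alpha * A `^ (- alpha) * tail_pow r x.
Proof.
move=> A1 xA; have x1 : x <= -1 by lra.
have X1 : 1 <= `|x| by rewrite ler0_norm; lra.
have XA : A <= `|x| by rewrite ler0_norm; lra.
have H := wavelet_kernel_left hpsi kappa01 psiM x1.
rewrite /tail_pow indicE mem_set ?mul1r//=.
apply: (@le_trans _ _ ((M * `|x| `^ (kappa - 2)) `^ alpha)).
  exact: ler_powR_alpha.
rewrite powRM ?powR_ge0 ?(ltW M0)// -powRrM -mulrA.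
apply: ler_pM; rewrite ?powR_ge0//.
  by apply: ler_powR_alpha; have := M0; lra.
have -> : (kappa - 2) * alpha = - alpha + - ((1 - kappa) * alpha) by ring.
rewrite powRD; last by rewrite (gt_eqF (lt_le_trans ltr01 X1)) implybT.
apply: ler_pM; rewrite ?powR_ge0//.
  rewrite !powRN lef_pV2 ?posrE ?powR_gt0//; [|lra|lra].
  by apply: ler_powR_alpha; lra.
by apply: ler_powR => //; rewrite lerN2.
Qed.

Lemma wavelet_kernel_envelope x :
  `|Phi x| `^ alpha <= (2 * M) `^ alpha * (\1_(`](-1), 1]%classic) x + tail_pow r x).
Proof.
have [x1|x1] := leP x (-1).
  apply: (le_trans (wavelet_kernel_tail (lexx 1) x1)).
  rewrite powR1 mulr1; apply: ler_wpM2l; first exact: powR_ge0.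
  by rewrite lerDr indicE ler0n.
have [x2|x2] := leP x 1; last first.
  rewrite wavelet_kernel_right ?(ltW x2)// normr0 powR0 ?gt_eqF//.
  by rewrite mulr_ge0 ?powR_ge0// addr_ge0 ?tail_pow_ge0// indicE ler0n.
rewrite indicE mem_set//=; last by rewrite in_itv/= x1.
apply: (@le_trans _ _ ((2 * M) `^ alpha)).
  by apply: ler_powR_alpha => //; apply: wavelet_kernel_mid => //; exact: ltW.
by rewrite ler_peMr ?powR_ge0// lerDl tail_pow_ge0.
Qed.

(** 2 is the length of ]-1, 1] and (r - 1)^-1 the integral of [tail_pow r]. *)
Definition kernel_const : R := (2 * M) `^ alpha * (2 + (r - 1)^-1).

Lemma pnorm_wavelet_kernel : (pnorm Phi <= kernel_const%:E)%E.
Proof.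
have m1 : measurable_fun [set: R] (\1_(`](-1), 1]%classic) : R -> R) by exact: measurable_indic.
apply: (@le_trans _ _ (\int[mu]_x ((2 * M) `^ alpha * (\1_(`](-1), 1]%classic) x + tail_pow r x))%:E)%E).
  apply: ge0_le_integral => //.
  - exact: measurable_pow.
  - by apply/measurable_EFinP; apply: measurable_funM => //; exact: measurable_funD.
  - by move=> x _; rewrite lee_fin wavelet_kernel_envelope.
under eq_integral do rewrite EFinM EFinD.
rewrite ge0_integralZl_EFin//; last 3 first.
- by move=> x _; rewrite -EFinD lee_fin addr_ge0 ?tail_pow_ge0// indicE ler0n.
- by apply: emeasurable_funD; exact/measurable_EFinP.
- exact: powR_ge0.
rewrite ge0_integralD//; last 3 first.
- exact/measurable_EFinP.
- by move=> x _; rewrite lee_fin tail_pow_ge0.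
- exact/measurable_EFinP.
rewrite integral_tail_pow// integral_indic//.
rewrite (_ : _ `&` _ = `](-1), 1]%classic); last exact: setIT.
rewrite -[X in (_ * (X + _))%E]/(lebesgue_measure (`](-1), 1]%classic : set R)).
rewrite lebesgue_measure_itv/= lte_fin (_ : (-1 < 1 :> R) = true); last by lra.
by rewrite -EFinB -EFinD -EFinM lee_fin /kernel_const opprK.
Qed.

Lemma pnorm_wavelet_kernel_far A : 1 <= A ->
  (pnorm (fun x => Phi x * (1 - \1_(`](- A), 1]%classic) x))%R <=
    (kernel_const * A `^ (- alpha))%:E)%E.
Proof.
move=> A1.
have mJ : measurable_fun [set: R] (fun x => 1 - \1_(`](- A), 1]%classic) x : R).
  by apply: measurable_funB => //; exact: measurable_indic.
apply: (@le_trans _ _ (\int[mu]_x ((2 * M) `^ alpha * A `^ (- alpha) * tail_pow r x)%:E)%E).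
  apply: ge0_le_integral => //.
  - by apply: measurable_pow; exact: measurable_funM.
  - by apply/measurable_EFinP; exact: measurable_funM.
  move=> x _; rewrite lee_fin.
  have rhs0 : 0 <= (2 * M) `^ alpha * A `^ (- alpha) * tail_pow r x.
    by rewrite !mulr_ge0 ?powR_ge0 ?tail_pow_ge0.
  have [xA|xA] := leP x (- A).
    apply: le_trans (wavelet_kernel_tail A1 xA).
    rewrite indicE memNset ?subr0 ?mulr1//=; rewrite in_itv/= => /andP[+ _].
    by rewrite ltNge xA.
  have [x1|x1] := leP x 1.
    by rewrite indicE mem_set ?subrr ?mulr0 ?normr0 ?powR0 ?gt_eqF//= in_itv/= xA.
  by rewrite wavelet_kernel_right ?mul0r ?normr0 ?powR0 ?gt_eqF// ltW.
under eq_integral do rewrite EFinM.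
rewrite ge0_integralZl_EFin//; last 3 first.
- by move=> x _; rewrite lee_fin tail_pow_ge0.
- exact/measurable_EFinP.
- by rewrite mulr_ge0 ?powR_ge0.
rewrite integral_tail_pow// -EFinM lee_fin /kernel_const [leRHS]mulrAC.
apply: ler_wpM2l; first by rewrite mulr_ge0 ?powR_ge0.
by rewrite lerDr.
Qed.

End upper.

Section lower.

Definition sqpos (u : R) : R := Num.max u 0 ^+ 2.

(** The wavelet kernel at z with the exponent 2 in place of kappa. *)
Definition sqpos_moment (z : R) : R := (\int[mu]_y (sqpos (y - z) * psi y))%R.

Lemma sqposE u : sqpos u = if u <= 0 then 0 else u ^+ 2.
Proof. by rewrite /sqpos; case: leP => // _; rewrite expr0n. Qed.

Lemma continuous_sqpos (z : R) : continuous (fun y => sqpos (y - z)).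
Proof.
move=> y; rewrite /sqpos.
have c1 : Num.max (t - z) 0 @[t --> y] --> Num.max (y - z) 0.
  apply: (@continuous_max _ _ (fun t : R => t - z : R^o) (fun=> 0)); last exact: cvg_cst.
  by apply: cvgB; [exact: cvg_id|exact: cvg_cst].
exact: (cvgM c1 c1).
Qed.

(* Third difference of the truncated square: a B-spline. *)
Definition bump (h u : R) : R :=
  sqpos u - 3 * sqpos (u - h) + 3 * sqpos (u - 2 * h) - sqpos (u - 3 * h).

Lemma bump_cases h u : 0 < h -> bump h u =
  if u <= 0 then 0 else if u <= h then u ^+ 2 else
  if u <= 2 * h then h ^+ 2 + 2 * (u - h) * (2 * h - u) else
  if u <= 3 * h then (3 * h - u) ^+ 2 else 0.
Proof.
move=> h0; rewrite /bump !sqposE !subr_le0.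
have [u0|u0] := leP u 0; first by rewrite !ifT; [ring|lra..].
have [u1|u1] := leP u h; first by rewrite !ifT; [ring|lra..].
have [u2|u2] := leP u (2 * h); first by rewrite ifT; [ring|lra].
by have [u3|u3] := leP u (3 * h); ring.
Qed.

Lemma bump_out h u : 0 < h -> u <= 0 \/ 3 * h <= u -> bump h u = 0.
Proof.
move=> h0 [u0|hu]; first by rewrite bump_cases// u0.
rewrite bump_cases//; have [//|u0] := leP u 0.
have [u1|u1] := leP u h; first by exfalso; lra.
have [u2|u2] := leP u (2 * h); first by exfalso; lra.
case: leP => // uh; have -> : u = 3 * h by lra.
by rewrite subrr expr0n.
Qed.

Lemma bump_ge0 h u : 0 < h -> 0 <= bump h u.
Proof.
move=> h0; rewrite bump_cases//; have [//|u0] := leP u 0.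
have [u1|u1] := leP u h; first exact: sqr_ge0.
have [u2|u2] := leP u (2 * h); last by case: ifP => // _; exact: sqr_ge0.
by rewrite addr_ge0 ?sqr_ge0// !mulr_ge0//; lra.
Qed.

Lemma bump_mid h u : 0 < h -> h <= u <= 2 * h -> h ^+ 2 <= bump h u.
Proof.
move=> h0 /andP[u1 u2]; rewrite bump_cases// u2.
have [u0|u0] := leP u 0; first by exfalso; lra.
have [u3|u3] := leP u h; first by rewrite ler_sqr ?nnegrE; lra.
by rewrite lerDl !mulr_ge0//; lra.
Qed.

Lemma continuous_bump (h z : R) : continuous (fun y => bump h (y - z)).
Proof.
have E : (fun y => bump h (y - z)) = (fun y => sqpos (y - z) - 3 * sqpos (y - (z + h)) +
    3 * sqpos (y - (z + 2 * h)) - sqpos (y - (z + 3 * h))).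
  by apply/funext => y; rewrite /bump !opprD !addrA.
rewrite E => y; have c k : sqpos (t - k) @[t --> y] --> sqpos (y - k) := @continuous_sqpos k y.
have c3 k : 3 * sqpos (t - k) @[t --> y] --> 3 * sqpos (y - k).
  by apply: cvgM; [exact: cvg_cst|exact: c].
exact: (cvgB (cvgD (cvgB (c z) (c3 (z + h))) (c3 (z + 2 * h))) (c (z + 3 * h))).
Qed.

Lemma continuous_sqpos_psi z : continuous (fun y => sqpos (y - z) * psi y).
Proof. by move=> y; apply: cvgM; [exact: continuous_sqpos|exact: cpsi]. Qed.

Lemma sqpos_psi_out z y : y \notin `[0, 0 + 1[ -> sqpos (y - z) * psi y = 0.
Proof. by rewrite add0r => /(wavelet_out hpsi) ->; rewrite mulr0. Qed.

Lemma integrable_sqpos_psi z : mu.-integrable setT (EFin \o (fun y => sqpos (y - z) * psi y)).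
Proof.
by apply: (integrable_compact_support ltr01 (c := 0));
  [exact: continuous_sqpos_psi|exact: sqpos_psi_out].
Qed.

Lemma Rintegral_bump_psi h z : (\int[mu]_y (bump h (y - z) * psi y))%R =
  sqpos_moment z - 3 * sqpos_moment (z + h) + 3 * sqpos_moment (z + 2 * h) -
  sqpos_moment (z + 3 * h).
Proof.
pose g k y := sqpos (y - k) * psi y.
have ig k : mu.-integrable setT (EFin \o g k) := integrable_sqpos_psi k.
have iZ k : mu.-integrable setT (EFin \o (fun y => 3 * g k y)).
  by rewrite (_ : _ \o _ = (fun y => 3%:E * (EFin \o g k) y)%E)//; exact: integrableZl.
have i1 : mu.-integrable setT (EFin \o (fun y => g z y - 3 * g (z + h) y)).
  rewrite (_ : _ \o _ = ((EFin \o g z) \- (EFin \o (fun y => 3 * g (z + h) y)%R))%E)//.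
  exact: integrableB.
have i2 : mu.-integrable setT (EFin \o (fun y => g z y - 3 * g (z + h) y + 3 * g (z + 2 * h) y)).
  rewrite (_ : _ \o _ = ((EFin \o (fun y => g z y - 3 * g (z + h) y)%R) \+
    (EFin \o (fun y => 3 * g (z + 2 * h) y)%R))%E)//.
  exact: integrableD.
transitivity (\int[mu]_y (g z y - 3 * g (z + h) y + 3 * g (z + 2 * h) y - g (z + 3 * h) y))%R.
  apply: eq_Rintegral => y _; rewrite /g /bump !opprD !addrA; ring.
by rewrite RintegralB// RintegralD// RintegralB// !RintegralZl.
Qed.

(** By continuity near a point where psi is nonzero; [s] is the sign of psi there. The length 3 h
    leaves room for the support of [bump h]. *)
Lemma wavelet_interval : exists z h s c, [/\ 0 < z, z + 3 * h < 1, 0 < h, 0 < c &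
  (s = 1 \/ s = -1) /\ forall y, z <= y <= z + 3 * h -> c <= s * psi y].
Proof.
have [_ [y0 p0] _ _ _] := hpsi.
have yI : y0 \in `[0, 1[ by apply: contraNT p0 => /(wavelet_out hpsi) ->.
pose s : R := if 0 < psi y0 then 1 else -1.
have sp : s * psi y0 = `|psi y0|.
  rewrite /s; case: ltP => h; first by rewrite mul1r gtr0_norm.
  by rewrite mulN1r ler0_norm.
have n0 : 0 < `|psi y0| by rewrite normr_gt0.
have n2 : 0 < `|psi y0| / 2 by rewrite divr_gt0.
have /cvgrPdist_le/(_ _ n2)/nbhs_ballP[r /= r0 H] := @cpsi y0.
move: yI; rewrite in_itv/= => /andP[y00 y01].
pose q := Num.min r (1 - y0).
have q0 : 0 < q by rewrite lt_min r0 subr_gt0.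
have q1 : q <= r by rewrite ge_min lexx.
have q2 : q <= 1 - y0 by rewrite ge_min lexx orbT.
(* The interval ends at y0 + q / 2, inside the radius of continuity and before 1; it starts after y0
   >= 0, hence 0 < z. *)
exists (y0 + q / 8), (q / 8), s, (`|psi y0| / 2); split => //; [lra..| |].
  by rewrite divr_gt0.
split; first by rewrite /s; case: ifP; [left|right].
move=> y /andP[y1 y2]; have : `|psi y0 - psi y| <= `|psi y0| / 2.
  by apply: H; rewrite /ball/= ler0_norm ?opprB; lra.
rewrite -sp /s; case: ltP => _; rewrite ?mul1r ?mulN1r ler_norml => /andP[]; lra.
Qed.

(** The third difference of the moments at z, z + h, z + 2 h, z + 3 h is the integral of psi against
    a bump supported where psi keeps its sign. It is nonzero, so one of the four moments is. *)
Lemma sqpos_moment_neq0 : exists2 z, 0 < z < 1 & sqpos_moment z != 0.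
Proof.
have [z [h [s [c [z0 z1 h0 c0 [hs Hc]]]]]] := wavelet_interval.
have B0 : (\int[mu]_y (bump h (y - z) * psi y))%R != 0.
  have cb : continuous (fun y => bump h (y - z) * psi y).
    by move=> y; apply: cvgM; [exact: continuous_bump|exact: cpsi].
  have ob y : y \notin `[0, 0 + 1[ -> bump h (y - z) * psi y = 0.
    by rewrite add0r => /(wavelet_out hpsi) ->; rewrite mulr0.
  have ib := integrable_compact_support ltr01 cb ob.
  suff : 0 < s * (\int[mu]_y (bump h (y - z) * psi y))%R.
    by apply: contraTneq => ->; rewrite mulr0 ltxx.
  rewrite -RintegralZl//.
  pose J : set R := `[z + h, z + 2 * h]%classic.
  have iJ : mu.-integrable setT (EFin \o (fun y => (c * h ^+ 2) * \1_J y)).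
    rewrite (_ : _ \o _ = (fun y => (c * h ^+ 2)%:E * (EFin \o \1_J) y)%E)//.
    by apply: integrableZl => //; exact: integrable_indic_itv.
  apply: (@lt_le_trans _ _ (\int[mu]_y ((c * h ^+ 2) * \1_J y))%R).
    rewrite RintegralZl//; last exact: integrable_indic_itv.
    rewrite mulr_gt0 ?mulr_gt0 ?exprn_gt0// /Rintegral integral_indic//; last exact: measurable_itv.
    rewrite (_ : _ `&` _ = J); last exact: setIT.
    rewrite -[X in fine X]/(lebesgue_measure (J : set R)) /J lebesgue_measure_itv/= lte_fin.
    by rewrite ifT/=; lra.
  apply: le_Rintegral => //.
    rewrite (_ : _ \o _ = (fun y => s%:E * ((bump h (y - z) * psi y)%R)%:E)%E)//.
    exact: integrableZl.
  move=> y _; rewrite [leRHS]mulrCA.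
  have [yz|yz] := boolP (z <= y <= z + 3 * h); last first.
    rewrite bump_out//; last by move: yz; rewrite negb_and -!ltNge => /orP[]; [left|right]; lra.
    rewrite mul0r indicE memNset ?mulr0// /J/= in_itv/= => /andP[? ?].
    by move/negP: yz; apply; apply/andP; split; lra.
  have cy := Hc y yz.
  apply: (@le_trans _ _ (bump h (y - z) * c)); last first.
    apply: ler_wpM2l; [exact: bump_ge0|exact: cy].
  have -> : c * h ^+ 2 * \1_J y = (\1_J y * h ^+ 2) * c by ring.
  apply: ler_wpM2r; first exact: ltW.
  rewrite indicE; case: (boolP (_ \in _)); last by rewrite mul0r bump_ge0.
  rewrite inE /J /= in_itv/= mul1r => /andP[? ?].
  by apply: bump_mid => //; apply/andP; split; lra.
move: B0; rewrite Rintegral_bump_psi => B0.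
have [|] := boolP (sqpos_moment z != 0); first by exists z => //; lra.
have [|] := boolP (sqpos_moment (z + h) != 0); first by exists (z + h) => //; lra.
have [|] := boolP (sqpos_moment (z + 2 * h) != 0); first by exists (z + 2 * h) => //; lra.
rewrite !negbK => /eqP e2 /eqP e1 /eqP e0; exists (z + 3 * h); first lra.
by move: B0; rewrite e0 e1 e2 !mulr0 subr0 addr0 add0r oppr_eq0.
Qed.

End lower.
End wavelet_kernel_norm.

(** * A Beta integral and the lower bound of the kernel *)

Section beta_identity.
Context (R : realType) (psi : R -> R) (hpsi : analyzing_wavelet psi).
Context (kappa : R) (kappa01 : 0 < kappa < 1) (z : R) (z01 : 0 < z < 1).
Local Notation mu := (@lebesgue_measure R).
Local Notation Phi := (wavelet_kernel psi kappa).

Let kappa01' : 0 < 1 - kappa < 1. Proof. by move: kappa01; lra. Qed.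
Let k0 : 0 < kappa. Proof. by case/andP: kappa01. Qed.

(** Its integral over x is Euler's: B(2 - kappa, 1 + kappa) (y - z)_+^2. *)
Definition beta_integrand (y x : R) : R :=
  pospow (x - z) (1 - kappa) * pospow (y - x) kappa.

Definition unit_beta (t : R) : R := pospow t (1 - kappa) * pospow (1 - t) kappa.

Lemma pospow_le1 (q u : R) : 0 < q < 1 -> u <= 1 -> pospow u q <= 1.
Proof.
move=> q01 u1; apply: (le_trans (le_pospow q01 u1)).
by rewrite pospow_powR// powR1.
Qed.

Lemma measurable_beta_integrand y : measurable_fun [set: R] (beta_integrand y).
Proof.
by apply: measurable_funM; (apply: measurable_pospow => //); exact: measurable_funB.
Qed.

Lemma beta_integrand_ge0 y x : 0 <= beta_integrand y x.
Proof. by rewrite mulr_ge0// pospow_ge0. Qed.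

Lemma unit_beta_ge0 t : 0 <= unit_beta t.
Proof. by rewrite mulr_ge0// pospow_ge0. Qed.

Lemma measurable_unit_beta : measurable_fun [set: R] unit_beta.
Proof.
by apply: measurable_funM; (apply: measurable_pospow => //); exact: measurable_funB.
Qed.

Lemma integrable_unit_beta : mu.-integrable setT (EFin \o unit_beta).
Proof.
apply: (integrable_compact_support ltr01 (c := 0)).
- move=> t; apply: cvgM; first exact: continuous_pospow.
  apply: (@continuous_comp _ _ _ (fun t : R => 1 - t) (fun u : R => pospow u kappa)).
    by apply: cvgB; [exact: cvg_cst|exact: cvg_id].
  exact: continuous_pospow.
- move=> t; rewrite add0r in_itv/= negb_and -ltNge -leNgt /unit_beta => /orP[t0|t1].
    by rewrite pospow_le0 ?mul0r// ltW.
  by rewrite [X in _ * X]pospow_le0 ?mulr0//; lra.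
Qed.

Definition unit_beta_val : R := (\int[mu]_t unit_beta t)%R.

Lemma unit_beta_valE : (\int[mu]_t (unit_beta t)%:E)%E = unit_beta_val%:E.
Proof. by rewrite /unit_beta_val /Rintegral fineK// integrable_fin_num// integrable_unit_beta. Qed.

(** On [1/4, 3/4], of length 1/2, the integrand is at least t (1 - t) >= 3 / 16, whatever kappa
    is. *)
Lemma unit_beta_val_ge : 3 / 32 <= unit_beta_val.
Proof.
pose J : set R := `[4^-1, 3 / 4]%classic.
rewrite -lee_fin -unit_beta_valE.
apply: (@le_trans _ _ (\int[mu]_t (3 / 16 * \1_J t)%:E)%E); last first.
  apply: ge0_le_integral => //.
  - by apply/measurable_EFinP; apply: measurable_funM => //; apply: measurable_indic; exact: measurable_itv.
  - by apply/measurable_EFinP; exact: measurable_unit_beta.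
  move=> t _; rewrite lee_fin indicE; case: (boolP (_ \in _)); last by rewrite mulr0 unit_beta_ge0.
  rewrite inE /J /= in_itv/= mulr1 => /andP[t1 t2].
  rewrite /unit_beta (pospow_powR kappa01') ?(pospow_powR kappa01); [|lra|lra].
  have H (u q : R) : 0 < u -> u <= 1 -> q <= 1 -> u <= u `^ q.
    by move=> u0 u1 q1; apply: ger1_powR; rewrite ?u0.
  have h1 : t <= t `^ (1 - kappa) by apply: H; move: k0; lra.
  have h2 : 1 - t <= (1 - t) `^ kappa by apply: H; move/andP: kappa01 => [_]; lra.
  apply: (@le_trans _ _ (t * (1 - t))); last by apply: ler_pM => //; lra.
  have : 0 <= (t - 4^-1) * (3 / 4 - t) by rewrite mulr_ge0//; lra.
  lra.
under eq_integral do rewrite EFinM.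
rewrite ge0_integralZl_EFin//; last first.
  by apply/measurable_EFinP; apply: measurable_indic; exact: measurable_itv.
rewrite integral_indic//; last exact: measurable_itv.
rewrite (_ : _ `&` _ = J); last exact: setIT.
rewrite -[X in (_ <= _ * X)%E]/(lebesgue_measure (J : set R)) /J lebesgue_measure_itv/= lte_fin.
rewrite ifT; last by lra.
by rewrite -EFinB -EFinM lee_fin; lra.
Qed.

Lemma pospow_scale (L t q : R) : 0 < q < 1 -> 0 < L -> pospow (L * t) q = L `^ q * pospow t q.
Proof.
move=> q01 L0; have [t0|t0] := leP t 0.
  by rewrite !pospow_le0 ?mulr0// pmulr_rle0.
by rewrite !pospow_powR ?powRM// ?mulr_ge0// ltW.
Qed.

(** Substitution x = z + (y - z) t: the exponents 1 - kappa and kappa and the Jacobian add up to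
    2. *)
Lemma integral_beta y :
  (\int[mu]_x (beta_integrand y x)%:E)%E = (unit_beta_val * sqpos (y - z))%:E.
Proof.
rewrite sqposE; have [yz|yz] := leP (y - z) 0.
  rewrite mulr0; under eq_integral => x _.
    have -> : beta_integrand y x = 0.
      rewrite /beta_integrand; have [xz|xz] := leP (x - z) 0.
        by rewrite pospow_le0// mul0r.
      by rewrite [X in _ * X]pospow_le0 ?mulr0//; lra.
    over.
  by rewrite integral0.
set L := y - z in yz *.
rewrite (ge0_integral_affine z yz); last 2 first.
- by apply/measurable_EFinP; exact: measurable_beta_integrand.
- by move=> x; rewrite lee_fin beta_integrand_ge0.
under eq_integral => x _.
  have -> : beta_integrand y (L * x + z) = L * unit_beta x.
    rewrite /beta_integrand addrK (_ : y - (L * x + z) = L * (1 - x)); last by rewrite /L; ring.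
    rewrite !pospow_scale// mulrACA -powRD; last by rewrite (gt_eqF yz) implybT.
    by rewrite subrK powRr1// ltW.
  rewrite EFinM; over.
rewrite ge0_integralZl_EFin//; last 3 first.
- by move=> x _; rewrite lee_fin unit_beta_ge0.
- by apply/measurable_EFinP; exact: measurable_unit_beta.
- exact: ltW.
by rewrite unit_beta_valE -!EFinM; congr EFin; ring.
Qed.

(* Pairing Phi with (x - z)_+^(1 - kappa) replaces the exponent kappa by 2, which
   makes the lower bound of the norm of Phi uniform in kappa. *)
Lemma beta_identity : (\int[mu]_x (pospow (x - z) (1 - kappa) * Phi x)%:E)%E =
  (unit_beta_val * sqpos_moment psi z)%:E.
Proof.
have [M M0 pM] := wavelet_bounded hpsi.
pose T x := pospow (x - z) (1 - kappa).
have mT : measurable_fun [set: R] T by apply: measurable_pospow => //; exact: measurable_funB.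
(* Riemann sums in y replace Phi, which exchanges the two integrations by linearity and dominated
   convergence; the factors (x - z)_+ and (y - x)_+ confine x to [0, 1]. *)
pose F m x := T x * riemann (kernel_integrand psi kappa x) 0 1 m.
pose y m (i : nat) : R := 0 + i%:R * (1 / m.+1%:R).
have y01 m (i : 'I_m.+1) : 0 <= y m i < 1.
  rewrite /y add0r mulr_ge0//= mul1r ltr_pdivrMr// mul1r ltr_nat; exact: ltn_ord.
have FE m x : F m x = \sum_(i < m.+1) (1 / m.+1%:R * psi (y m i)) * beta_integrand (y m i) x.
  rewrite /F /riemann mulrA mulr_sumr; apply: eq_bigr => i _.
  by rewrite /kernel_integrand /beta_integrand /T; ring.
have mF m : measurable_fun [set: R] (F m).
  rewrite (_ : F m = (fun x => \sum_(i < m.+1) (1 / m.+1%:R * psi (y m i)) * beta_integrand (y m i) x));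
    last by apply/funext => x; exact: FE.
  by apply: measurable_sum => i; apply: measurable_funM => //; exact: measurable_beta_integrand.
have mPhi := measurable_wavelet_kernel hpsi kappa01.
have iJ : mu.-integrable setT (fun x => (M * \1_(`[0, 1]%classic) x)%:E).
  under eq_fun do rewrite EFinM; apply: integrableZl => //; exact: integrable_indic_itv.
have FM m x : `|F m x| <= M * \1_(`[0, 1]%classic) x.
  rewrite FE; have [xI|xI] := boolP (x \in `[0, 1]%classic); last first.
    rewrite big1 ?normr0 ?mulr_ge0 ?indicE ?ler0n ?(ltW M0)// => i _.
    move: xI; rewrite mem_setE in_itv/= negb_and -!ltNge /beta_integrand => /orP[x0|x1].
      by rewrite pospow_le0 ?mul0r ?mulr0//; move: z01; lra.
    by rewrite [X in _ * (_ * X)]pospow_le0 ?mulr0//; have := y01 m i; lra.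
  rewrite indicE xI mulr1; apply: (le_trans (ler_norm_sum _ _ _)).
  apply: (@le_trans _ _ (\sum_(i < m.+1) 1 / m.+1%:R * M)).
    apply: ler_sum => i _; rewrite -mulrA [leLHS]normrM ger0_norm ?divr_ge0//.
    apply: ler_wpM2l; first by rewrite divr_ge0.
    rewrite normrM -[leRHS]mulr1; apply: ler_pM => //.
    rewrite ger0_norm ?beta_integrand_ge0// -[leRHS]mulr1 /beta_integrand.
    move: xI; rewrite mem_setE in_itv/= => /andP[x0 x1].
    have /andP[_ yi1] := y01 m i.
    by apply: ler_pM; rewrite ?pospow_ge0//; apply: pospow_le1 => //; move: z01; lra.
  by rewrite sumr_const card_ord mul1r -mulrnAl -mulr_natl divff ?mul1r ?pnatr_eq0.
have [] := @dominated_convergence _ _ _ mu setT measurableT (fun m x => (F m x)%:E)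
    (fun x => (T x * Phi x)%:E) (fun x => (M * \1_(`[0, 1]%classic) x)%:E).
- by move=> m; apply/measurable_EFinP; exact: mF.
- by apply/measurable_EFinP; exact: measurable_funM.
- apply: aeW => x _; apply: cvg_EFin; first exact: nearW.
  by apply: cvgM; [exact: cvg_cst|exact: wavelet_kernel_riemann].
- exact: iJ.
- by apply: aeW => x m _; rewrite lee_fin; exact: FM.
move=> _ _ cvgF.
have ib u : mu.-integrable setT (EFin \o beta_integrand u).
  apply/integrableP; split; first by apply/measurable_EFinP; exact: measurable_beta_integrand.
  under eq_integral do rewrite /= ger0_norm ?beta_integrand_ge0//.
  by rewrite integral_beta ltry.
have FI m : (\int[mu]_x (F m x)%:E)%E =
    (unit_beta_val * riemann (fun y => sqpos (y - z) * psi y) 0 1 m)%:E.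
  under eq_integral do rewrite FE -sumEFin.
  rewrite integral_sum//=; last first.
    by move=> i; under eq_fun do rewrite EFinM; apply: integrableZl => //; exact: ib.
  rewrite /riemann mulr_sumr mulr_sumr -sumEFin; apply: eq_bigr => i _.
  under eq_integral do rewrite EFinM.
  rewrite integralZl//; last exact: ib.
  by rewrite integral_beta -EFinM; congr EFin; rewrite /y; ring.
have c2 : (\int[mu]_x (F m x)%:E)%E @[m --> \oo] --> (unit_beta_val * sqpos_moment psi z)%:E.
  under eq_fun do rewrite FI; apply: cvg_EFin; first exact: nearW.
  apply: cvgM; first exact: cvg_cst.
  by apply: riemann_cvg => //; [exact: continuous_sqpos_psi|exact: sqpos_psi_out].
exact: (cvg_unique _ cvgF c2).
Qed.

End beta_identity.

Section kernel_lower_bound.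
Context (R : realType) (alpha : R) (alpha12 : 1 < alpha < 2).
Context (psi : R -> R) (hpsi : analyzing_wavelet psi).
Local Notation mu := (@lebesgue_measure R).
Local Notation pnorm := (pnorm alpha).

(** Duality with (x - z)_+^(1 - kappa), which is at most 1 on ]0, 1]: [beta_identity] bounds the
    pairing below by g0, and splitting |Phi| at the level eta gives g0 <= eta + eta^(1 - alpha) q.
    With eta = g0 / 2 this yields q >= eta^alpha. Every window ]- A, 1] contains ]0, 1]. *)
Lemma pnorm_wavelet_kernel_near : exists2 c, 0 < c & forall kappa A, 0 < kappa < 1 -> 0 <= A ->
  (c%:E <= pnorm (fun x => wavelet_kernel psi kappa x * \1_(`](- A), 1]%classic) x)%R)%E.
Proof.
have [z z01 Gz] := sqpos_moment_neq0 hpsi.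
pose g0 := 3 / 32 * `|sqpos_moment psi z|.
have g00 : 0 < g0 by rewrite mulr_gt0// normr_gt0.
pose eta := g0 / 2; have eta0 : 0 < eta by rewrite divr_gt0.
have a0 := alpha_gt0 alpha12.
exists (eta `^ alpha); first by rewrite powR_gt0.
move=> kappa A kappa01 A0; set Phi := wavelet_kernel psi kappa.
have k01' : 0 < 1 - kappa < 1 by move: kappa01; lra.
have mPhi : measurable_fun [set: R] Phi := measurable_wavelet_kernel hpsi kappa01.
pose J : R -> R := \1_(`]0, 1]%classic).
have mJ : measurable_fun [set: R] J by apply: measurable_indic; exact: measurable_itv.
pose q := pnorm (fun x => Phi x * J x).
apply: (@le_trans _ _ q); last first.
  have mJA : measurable_fun [set: R] (\1_(`](- A), 1]%classic) : R -> R).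
    by apply: measurable_indic; exact: measurable_itv.
  apply: (le_pnorm alpha12); [exact: measurable_funM|exact: measurable_funM|].
  move=> x; rewrite !normrM; apply: ler_wpM2l => //; rewrite /J !indicE.
  have [|xI] := boolP (x \in `]0, 1]%classic); last by rewrite normr0.
  rewrite mem_setE in_itv/= => /andP[x0 x1].
  have -> // : x \in `](- A), 1]%classic.
  by rewrite mem_setE in_itv/= x1 andbT (le_lt_trans _ x0)// oppr_le0.
(* Where |Phi| > eta, alpha > 1 gives |Phi| <= eta^(1 - alpha) |Phi|^alpha. *)
have pw x : `|pospow (x - z) (1 - kappa) * Phi x| <=
    eta * J x + eta `^ (1 - alpha) * `|Phi x * J x| `^ alpha.
  have rhs0 : 0 <= eta * J x + eta `^ (1 - alpha) * `|Phi x * J x| `^ alpha.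
    by rewrite addr_ge0// mulr_ge0 ?powR_ge0 ?(ltW eta0)// indicE ler0n.
  have [x0|x0] := leP x z.
    have xz : x - z <= 0 by rewrite subr_le0.
    by apply: le_trans rhs0; rewrite (pospow_le0 _ xz) mul0r normr0.
  have [x1|x1] := leP x 1; last first.
    by apply: le_trans rhs0; rewrite /Phi (wavelet_kernel_right hpsi kappa (ltW x1)) mulr0 normr0.
  have -> : J x = 1.
    rewrite /J indicE (_ : x \in _)// mem_setE in_itv/= x1 andbT.
    by move: z01; lra.
  rewrite !mulr1; apply: (@le_trans _ _ `|Phi x|).
    rewrite normrM -[leRHS]mul1r; apply: ler_wpM2r => //.
    by rewrite ger0_norm ?pospow_ge0//; apply: pospow_le1 => //; move: z01; lra.
  have [h|h] := leP `|Phi x| eta.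
    by rewrite (le_trans h)// lerDl mulr_ge0 ?powR_ge0.
  have P0 : 0 < `|Phi x| by exact: lt_trans h.
  apply: (@le_trans _ _ (eta `^ (1 - alpha) * `|Phi x| `^ alpha)); last by rewrite lerDr ltW.
  have -> : `|Phi x| `^ alpha = `|Phi x| * `|Phi x| `^ (alpha - 1) by rewrite mulr_powRB1.
  rewrite mulrCA ler_peMr// -opprB powRN mulrC ler_pdivlMr ?powR_gt0// mul1r.
  apply: ge0_ler_powR; rewrite ?nnegrE ?(ltW h) ?(ltW eta0) ?(ltW P0)//.
  by move: alpha12; lra.
have bG : (g0%:E <= eta%:E + (eta `^ (1 - alpha))%:E * q)%E.
  have id := beta_identity hpsi kappa01 z01.
  have b1 := unit_beta_val_ge kappa01.
  apply: (@le_trans _ _ `|(\int[mu]_x (pospow (x - z) (1 - kappa) * Phi x)%:E)%E|%E).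
    rewrite id/= lee_fin normrM; apply: ler_wpM2r => //.
    by rewrite (le_trans b1)// ler_norm.
  have mT : measurable_fun [set: R] (fun x => pospow (x - z) (1 - kappa)).
    by apply: measurable_pospow => //; exact: measurable_funB.
  have mTP : measurable_fun [set: R] (fun x => pospow (x - z) (1 - kappa) * Phi x).
    exact: measurable_funM.
  apply: (le_trans (le_abse_integral _ _ _)) => //; first exact/measurable_EFinP.
  have mp : measurable_fun [set: R] (fun x => (`|Phi x * J x| `^ alpha)%:E).
    by apply: measurable_pow; exact: measurable_funM.
  have meJ : measurable_fun [set: R] (fun x => (eta * J x)%:E).
    by apply/measurable_EFinP; exact: measurable_funM.
  have mep : measurable_fun [set: R] (fun x => (eta `^ (1 - alpha))%:E * (`|Phi x * J x| `^ alpha)%:E)%E.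
    exact: measurable_funeM.
  apply: (@le_trans _ _ (\int[mu]_x ((eta * J x)%:E + (eta `^ (1 - alpha))%:E * (`|Phi x * J x| `^ alpha)%:E))%E).
    apply: ge0_le_integral => //.
    - by apply: measurableT_comp => //; exact/measurable_EFinP.
    - exact: emeasurable_funD.
    - by move=> x _; rewrite -EFinM -EFinD lee_fin; exact: pw.
  rewrite ge0_integralD//; last 2 first.
  - by move=> x _; rewrite lee_fin mulr_ge0 ?(ltW eta0)// /J indicE ler0n.
  - by move=> x _; rewrite -EFinM lee_fin mulr_ge0 ?powR_ge0.
  rewrite ge0_integralZl_EFin// ?powR_ge0// /q /pnorm; apply: leeD => //.
  under eq_integral do rewrite EFinM.
  rewrite ge0_integralZl_EFin//; last 3 first.
  - by move=> x _; rewrite lee_fin /J indicE ler0n.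
  - exact/measurable_EFinP.
  - exact: ltW.
  rewrite /J integral_indic// (_ : _ `&` _ = `]0, 1]%classic); last exact: setIT.
  rewrite -[X in (_ * X <= _)%E]/(lebesgue_measure (`]0, 1]%classic : set R)).
  by rewrite lebesgue_measure_itv/= lte_fin ltr01 -EFinB -EFinM subr0 mulr1.
have q0 : (0 <= q)%E by exact: pnorm_ge0.
case: q q0 bG => [q| |] q0 bG; [|by rewrite leey|by []].
move: q0 bG; rewrite -EFinM -EFinD !lee_fin => q0 bG.
have eq1 : eta <= eta `^ (1 - alpha) * q by rewrite /eta in bG *; lra.
have -> : eta `^ alpha = eta * eta `^ (alpha - 1) by rewrite mulr_powRB1// ltW.
apply: (@le_trans _ _ (eta `^ (1 - alpha) * q * eta `^ (alpha - 1))).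
  by apply: ler_wpM2r; [exact: powR_ge0|].
rewrite mulrAC -powRD; last by rewrite (gt_eqF eta0) implybT.
by rewrite (_ : 1 - alpha + (alpha - 1) = 0) ?powRr0 ?mul1r//; ring.
Qed.

End kernel_lower_bound.

(** * Wavelet coefficients of the field *)

Lemma pointwise_cvg_pr d (T : measurableType d) (R : realType) (P : probability T R)
    (V : nat -> T -> R) (W : T -> R) (e : R) : 0 < e ->
  (forall m, measurable_fun [set: T] (V m)) -> measurable_fun [set: T] W ->
  (forall w, V m w @[m --> \oo] --> W w) ->
  \forall m \near \oo, pr P [set w | e <= `|V m w - W w|] <= e.
Proof.
move=> e0 mV mW VW; pose A m := [set w | e <= `|V m w - W w|].
have mA m : measurable (A m) by apply: measurable_norm_ge; exact: measurable_funB.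
have [] := @dominated_convergence _ _ _ P setT measurableT
  (fun m w => (\1_(A m) w)%:E) (cst 0%E) (cst 1%E).
- by move=> m; apply/measurable_EFinP; exact: measurable_indic.
- exact: measurable_cst.
- apply: aeW => w _; apply: cvg_near_cst.
  have /cvgrPdist_lt/(_ _ e0) := VW w; apply: filterS => m h.
  by rewrite indicE memNset// /A /=; apply/negP; rewrite -ltNge distrC.
- by apply: finite_measure_integrable_cst.
- apply: aeW => w m _; rewrite /= lee_fin indicE; case: (_ \in _); rewrite ?normr1 ?normr0//.
move=> _ _; rewrite integral_cst// mul0e => H.
have H' : (P (A m)) @[m --> \oo] --> 0%E.
  move: H; apply: cvg_trans; apply: near_eq_cvg; apply: nearW => m /=.
  by rewrite integral_indic// setIT.
have := cvge0_near_le e0 H'; apply: filterS => m.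
by rewrite prE// lee_fin.
Qed.

Lemma cvg_powR0 (R : realType) (u : nat -> R) (l alpha : R) : 0 < alpha ->
  u m @[m --> \oo] --> l -> `|u m - l| `^ alpha @[m --> \oo] --> 0.
Proof.
move=> a0 ul; apply/cvgrPdist_le => e e0.
have ea : 0 < e `^ alpha^-1 by rewrite powR_gt0.
have /cvgrPdist_le/(_ _ ea) := ul; apply: filterS => m h.
rewrite sub0r normrN ger0_norm ?powR_ge0// distrC.
apply: (@le_trans _ _ ((e `^ alpha^-1) `^ alpha)).
  by apply: ge0_ler_powR; rewrite ?nnegrE ?powR_ge0 ?(ltW a0).
by rewrite -powRrM mulVf ?gt_eqF// powRr1// ltW.
Qed.

Section unit_coefficient.
Context (R : realType) (psi : R -> R) (hpsi : analyzing_wavelet psi).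
Local Notation mu := (@lebesgue_measure R).
Implicit Types y : R -> R.

Definition unit_coef y (u c : R) : R := (\int[mu]_s (y (u + c * s) * psi s))%R.

Let cpsi : continuous psi. Proof. by case: hpsi. Qed.

Lemma continuous_unit_integrand y (u c : R) : continuous y ->
  continuous (fun s => y (u + c * s) * psi s).
Proof.
move=> cy s; apply: cvgM; last exact: cpsi.
apply: (@continuous_comp _ _ _ (fun s : R => u + c * s) y); last exact: cy.
by apply: cvgD; [exact: cvg_cst|apply: cvgM; [exact: cvg_cst|exact: cvg_id]].
Qed.

Lemma unit_integrand_out y u c s : s \notin `[0, 0 + 1[ -> y (u + c * s) * psi s = 0.
Proof. by rewrite add0r => /(wavelet_out hpsi) ->; rewrite mulr0. Qed.

Lemma unit_coef_riemann y u c : continuous y ->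
  riemann (fun s => y (u + c * s) * psi s) 0 1 m @[m --> \oo] --> unit_coef y u c.
Proof.
move=> cy; apply: riemann_cvg => //; first exact: continuous_unit_integrand.
exact: unit_integrand_out.
Qed.

(** The change of variable t = 2^(- j) (k + s) is made on Riemann sums, whose sample points
    correspond exactly, and passes to the limit. *)
Lemma wavelet_coef_unit y (j : nat) (k : int) : continuous y ->
  wavelet_coef psi y j k = unit_coef y (2 ^- j * k%:~R) (2 ^- j).
Proof.
move=> cy; rewrite /wavelet_coef; set c : R := 2 ^- j; set u := c * _.
have c0 : 0 < c by rewrite invr_gt0 exprn_gt0.
have cj : 2 ^ Posz j * c = 1 by rewrite /c -exprnP divff// expf_neq0.
have back s : 2 ^ Posz j * (u + c * s) - k%:~R = s by rewrite /u -mulrDr mulrA cj mul1r addrAC subrr add0r.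
pose g t := y t * psi (2 ^ Posz j * t - k%:~R).
have cg : continuous g.
  move=> t; apply: cvgM; first exact: cy.
  apply: (@continuous_comp _ _ _ (fun t : R => 2 ^ Posz j * t - k%:~R) psi); last exact: cpsi.
  by apply: cvgB; [apply: cvgM; [exact: cvg_cst|exact: cvg_id]|exact: cvg_cst].
have g0 t : t \notin `[u, u + c[ -> g t = 0.
  move=> tI; rewrite /g (wavelet_out hpsi) ?mulr0//; apply: contraNN tI.
  rewrite !in_itv/= => /andP[t0 t1].
  have tE : t = u + c * (2 ^ Posz j * t - k%:~R).
    by rewrite mulrBr mulrA [c * _]mulrC cj mul1r /u addrC subrK.
  rewrite tE; apply/andP; split; first by rewrite lerDl mulr_ge0// ltW.
  by rewrite ltrD2l gtr_pMr.
have H := riemann_cvg c0 cg g0.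
have H2 : 2 ^ Posz j * riemann g u c m @[m --> \oo] --> 2 ^ Posz j * (\int[mu]_t g t)%R.
  by apply: cvgM; [exact: cvg_cst|exact: H].
suff E m : 2 ^ Posz j * riemann g u c m =
    riemann (fun s => y (u + c * s) * psi s) 0 1 m.
  have H3 : 2 ^ Posz j * riemann g u c m @[m --> \oo] --> unit_coef y u c.
    by under eq_fun do rewrite E; exact: unit_coef_riemann.
  exact: (cvg_unique _ H2 H3).
rewrite /riemann mulrA; congr (_ * _).
  by rewrite mulrA cj.
apply: eq_bigr => i _; rewrite add0r /g.
have -> : u + i%:R * (c / m.+1%:R) = u + c * (i%:R * (1 / m.+1%:R)) by ring.
by rewrite back.
Qed.

Lemma unit_coef_dist y1 y2 (u c M e : R) : continuous y1 -> continuous y2 -> 0 < c ->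
  (forall s, `|psi s| <= M) ->
  (forall t, u <= t <= u + c -> `|y1 t - y2 t| <= e) ->
  `|unit_coef y1 u c - unit_coef y2 u c| <= e * M.
Proof.
move=> c1 c2 c0 pM He; rewrite /unit_coef.
have int y : continuous y -> mu.-integrable setT (EFin \o (fun s => y (u + c * s) * psi s)).
  move=> cy; apply: (integrable_compact_support ltr01 (c := 0)).
    exact: continuous_unit_integrand.
  exact: unit_integrand_out.
rewrite -RintegralB//; [|exact: int|exact: int].
apply: norm_integral_le.
- by move=> s; apply: cvgB; exact: continuous_unit_integrand.
- by move=> s; rewrite -[X in `[0, X[]add0r => sI; rewrite !unit_integrand_out ?subr0.
move=> s; rewrite in_itv/= => /andP[s0 s1]; rewrite -mulrBl normrM ler_pM//.
apply: He; apply/andP; split; first by rewrite lerDl mulr_ge0// ltW.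
by rewrite lerD2l; apply: ler_piMr; exact: ltW.
Qed.

End unit_coefficient.

(** Continuity of X is relative to the strip of admissible exponents; the graph of [h] stays in that
    strip. *)
Lemma field_path_continuous (T : Type) (R : realType) (alpha : R)
    (X : R -> R -> T -> R) (h : R -> R) w : continuous_paths alpha X ->
  continuous h -> (forall t, alpha^-1 < h t < 1) -> continuous (fun t => X t (h t) w).
Proof.
move=> cX ch h01 t.
have At u : ([set: R] `*` `]alpha^-1, 1[%classic) (u, h u) by split => //=; rewrite in_itv/= h01.
have /subspace_continuousP/(_ (t, h t) (At t)) H := cX w.
apply: (cvg_comp (fun u => (u, h u)) (fun p : R * R => X p.1 p.2 w) _ H).
have c2 : (u, h u) @[u --> t] --> (t, h t).
  exact: (@cvg_pair _ _ _ (nbhs t) (nbhs t) (nbhs (h t)) _ _ _ id h cvg_id (ch t)).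
move=> Q QA; have H2 : \forall u \near t,
    ([set: R] `*` `]alpha^-1, 1[%classic) (u, h u) -> Q (u, h u) := c2 _ QA.
by apply: (filterS _ H2) => u; apply; exact: At.
Qed.

Section field_coefficient.
Context d (T : measurableType d) (R : realType) (P : probability T R).
Context (alpha : R) (alpha12 : 1 < alpha < 2).
Context (Z : R -> {RV P >-> R}).
Context (X : R -> R -> T -> R) (hX : lfsm_field alpha Z X).
Context (hXcont : continuous_paths alpha X).
Context (psi : R -> R) (hpsi : analyzing_wavelet psi).
Context (v : R) (hv : alpha^-1 < v < 1).
Local Notation mu := (@lebesgue_measure R).
Local Notation pnorm := (pnorm alpha).
Local Notation kappa := (v - alpha^-1).
Local Notation Phi := (wavelet_kernel psi kappa).

Let a0 : 0 < alpha := alpha_gt0 alpha12.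

Lemma kappa01 : 0 < kappa < 1.
Proof.
have ai : 0 < alpha^-1 by rewrite invr_gt0.
by move: hv => /andP[h1 h2]; apply/andP; split; lra.
Qed.

Definition lfsm_kernel (u s : R) : R := pospow (u - s) kappa - pospow (- s) kappa.

Lemma measurable_lfsm_kernel u : measurable_fun [set: R] (lfsm_kernel u).
Proof.
by apply: measurable_funB; (apply: (measurable_pospow kappa01)); [exact: measurable_funB|exact: measurable_funN].
Qed.

Lemma lfsm_path_continuous w : continuous (fun u => X u v w).
Proof. by apply: (field_path_continuous hXcont (h := fun=> v)) => // x; exact: cvg_cst. Qed.

Lemma pnorm_lfsm_kernel u : (pnorm (lfsm_kernel u) < +oo)%E.
Proof.
have [fL _ _] := hX u hv.
have a1 : 1 <= alpha by case/andP: alpha12 => /ltW.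
have /integrableP[_] := Lfun_integrable a1 fL.
by under eq_integral do rewrite gee0_abs ?lee_fin ?powR_ge0//.
Qed.

Lemma measurable_field u : measurable_fun [set: T] (X u v).
Proof. by have [] := hX u hv. Qed.

Definition field_coef (u c : R) (w : T) : R := unit_coef psi (fun t => X t v w) u c.

Lemma measurable_field_coef u c : measurable_fun [set: T] (field_coef u c).
Proof.
apply: (@measurable_fun_cvg _ _ _ setT
  (fun m w => riemann (fun s => X (u + c * s) v w * psi s) 0 1 m)).
  move=> m; apply: measurable_funM => //; apply: measurable_sum => i.
  by apply: measurable_funM => //; exact: measurable_field.
by move=> w _; apply: unit_coef_riemann => //; exact: lfsm_path_continuous.
Qed.

Definition coef_kernel (u c s : R) : R := c `^ kappa * Phi ((s - u) / c).

Lemma measurable_coef_kernel u c : measurable_fun [set: R] (coef_kernel u c).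
Proof.
apply: measurable_funM => //; apply: (measurableT_comp (measurable_wavelet_kernel hpsi kappa01)).
by apply: measurable_funM => //; exact: measurable_funB.
Qed.

Lemma le_lfsm_kernel u c t s : 0 < c -> u <= t <= u + c ->
  `|lfsm_kernel t s| <= `|lfsm_kernel u s| + `|lfsm_kernel (u + c) s|.
Proof.
move=> c0 /andP[ut tc].
have h1 : lfsm_kernel u s <= lfsm_kernel t s.
  by rewrite lerD2r; apply: (le_pospow kappa01); rewrite lerD2r.
have h2 : lfsm_kernel t s <= lfsm_kernel (u + c) s.
  by rewrite lerD2r; apply: (le_pospow kappa01); rewrite lerD2r.
have n1 := ler_norm (- lfsm_kernel u s); have n2 := ler_norm (lfsm_kernel (u + c) s).
have n3 := normr_ge0 (lfsm_kernel u s); have n4 := normr_ge0 (lfsm_kernel (u + c) s).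
by rewrite normrN in n1; rewrite ler_norml; apply/andP; split; lra.
Qed.

(** The Riemann sums in time are finite combinations of stable integrals. In the limit of the
    kernels the term (- s)_+^kappa is killed by the zeroth moment of psi, and homogeneity of the
    power produces the rescaled Phi. *)
Lemma field_coef_approx u c : 0 < c ->
  stab_approx alpha Z (coef_kernel u c) (field_coef u c).
Proof.
move=> c0.
have [M M0 pM] := wavelet_bounded hpsi.
pose y m (i : nat) : R := 0 + i%:R * (1 / m.+1%:R).
have y01 m (i : 'I_m.+1) : 0 <= y m i <= 1.
  rewrite /y add0r mulr_ge0//= mul1r ler_pdivrMr// mul1r ler_nat; exact: ltnW (ltn_ord i).
pose cf m (i : 'I_m.+1) := 1 / m.+1%:R * psi (y m i).
pose f m s := \sum_(i < m.+1) cf m i * lfsm_kernel (u + c * y m i) s.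
pose V m w := \sum_(i < m.+1) cf m i * X (u + c * y m i) v w.
have aV m : stab_approx alpha Z (f m) (V m).
  apply: (stab_approx_sum alpha12).
  - by move=> i; exact: measurable_lfsm_kernel.
  - by move=> i; exact: measurable_field.
  - by move=> i; apply: stable_integral_approx; exact: (hX _ hv).
have mf m : measurable_fun [set: R] (f m).
  by apply: measurable_sum => i; apply: measurable_funM => //; exact: measurable_lfsm_kernel.
have mV m : measurable_fun [set: T] (V m).
  by apply: measurable_sum => i; apply: measurable_funM => //; exact: measurable_field.
have mk := measurable_coef_kernel u c.
have mD := measurable_field_coef u c.
have VE m w : V m w = riemann (fun s => X (u + c * s) v w * psi s) 0 1 m.
  by rewrite /V /riemann mulr_sumr; apply: eq_bigr => i _; rewrite /cf -/(y m i); ring.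
have Vcvg w : V m w @[m --> \oo] --> field_coef u c w.
  under eq_fun do rewrite VE; apply: unit_coef_riemann => //; exact: lfsm_path_continuous.
have fcvg s : f m s @[m --> \oo] --> coef_kernel u c s.
  have fE m : f m s = c `^ kappa * riemann (kernel_integrand psi kappa ((s - u) / c)) 0 1 m -
      pospow (- s) kappa * riemann psi 0 1 m.
    rewrite /riemann !mulr_sumr -sumrB; apply: eq_bigr => i _.
    rewrite /cf /lfsm_kernel /kernel_integrand -/(y m i).
    have -> : u + c * y m i - s = c * (y m i - (s - u) / c).
      by field; rewrite gt_eqF.
    have ps q : pospow (c * q) kappa = c `^ kappa * pospow q kappa.
      have [q0|q0] := leP q 0.
        by rewrite !pospow_le0 ?mulr0// pmulr_rle0.
      by rewrite !(pospow_powR kappa01) ?powRM ?mulr_ge0 ?(ltW c0) ?(ltW q0).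
    by rewrite ps; ring.
  have H1 : c `^ kappa * riemann (kernel_integrand psi kappa ((s - u) / c)) 0 1 m
      @[m --> \oo] --> coef_kernel u c s.
    by apply: cvgM; [exact: cvg_cst|exact: (wavelet_kernel_riemann hpsi kappa01)].
  have H2 : pospow (- s) kappa * riemann psi 0 1 m @[m --> \oo] --> pospow (- s) kappa * 0.
    apply: cvgM; first exact: cvg_cst.
    have out t : t \notin `[0, 0 + 1[ -> psi t = 0.
      by rewrite add0r; exact: (wavelet_out hpsi).
    have cp : continuous psi by case: hpsi.
    have := riemann_cvg ltr01 cp out.
    by rewrite (_ : (\int[mu]_s psi s)%R = 0)//; case: hpsi.
  have E0 : coef_kernel u c s - pospow (- s) kappa * 0 = coef_kernel u c s by ring.
  rewrite -E0 (_ : f ^~ s = (fun m => c `^ kappa *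
      riemann (kernel_integrand psi kappa ((s - u) / c)) 0 1 m -
      pospow (- s) kappa * riemann psi 0 1 m)); last by apply/funext => m; exact: fE.
  exact: (cvgB H1 H2).
(* The kernel is monotone in t, so the two ends of the cell bound all Riemann sums: an L^alpha
   majorant. *)
pose g s := M * `|lfsm_kernel u s| + M * `|lfsm_kernel (u + c) s|.
have fg m s : `|f m s| <= g s.
  apply: (le_trans (ler_norm_sum _ _ _)).
  apply: (@le_trans _ _ (\sum_(i < m.+1) 1 / m.+1%:R * g s)); last first.
    by rewrite sumr_const card_ord mul1r -mulrnAl -mulr_natl divff ?mul1r ?pnatr_eq0.
  apply: ler_sum => i _; rewrite /cf -mulrA normrM ger0_norm ?divr_ge0//.
  apply: ler_wpM2l; first by rewrite divr_ge0.
  rewrite normrM /g -mulrDr; apply: ler_pM => //; apply: le_lfsm_kernel => //.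
  have /andP[y0 y1] := y01 m i.
  rewrite lerDl lerD2l (mulr_ge0 (ltW c0) y0)/=.
  by apply: ler_piMr => //; exact: ltW.
have kg s : `|coef_kernel u c s| <= g s.
  by apply: (@cvgr_to_le _ _ _ _ _ _ _ (cvg_norm (fcvg s))); apply: nearW => m; exact: fg.
have mg : measurable_fun [set: R] g.
  by apply: measurable_funD; apply: measurable_funM => //; apply: measurableT_comp => //; exact: measurable_lfsm_kernel.
have ng : (pnorm g < +oo)%E.
  have mn t : measurable_fun [set: R] (fun s => M * `|lfsm_kernel t s|).
    by apply: measurable_funM => //; apply: measurableT_comp => //; exact: measurable_lfsm_kernel.
  apply: (le_lt_trans (pnormD alpha12 (mn _) (mn _))).
  have nM t : (pnorm (fun s => M * `|lfsm_kernel t s|)%R < +oo)%E.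
    rewrite pnormZ; last by apply: measurableT_comp => //; exact: measurable_lfsm_kernel.
    rewrite lte_mul_pinfty ?lee_fin ?powR_ge0//.
    apply: le_lt_trans (pnorm_lfsm_kernel t); apply: (le_pnorm alpha12).
    - by apply: measurableT_comp => //; exact: measurable_lfsm_kernel.
    - exact: measurable_lfsm_kernel.
    - by move=> s; rewrite normr_id.
  by rewrite lte_mul_pinfty// lte_add_pinfty.
have pcvg : (pnorm (fun s => f m s - coef_kernel u c s)%R) @[m --> \oo] --> 0%E.
  have [] := @dominated_convergence _ _ _ mu setT measurableT
    (fun m s => (`|f m s - coef_kernel u c s| `^ alpha)%:E) (cst 0%E)
    (fun s => (4 * (`|g s| `^ alpha + `|g s| `^ alpha))%:E).
  - by move=> m; apply: measurable_pow; exact: measurable_funB.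
  - exact: measurable_cst.
  - apply: aeW => s _; apply: cvg_EFin; first exact: nearW.
    by apply: cvg_powR0 => //; exact: fcvg.
  - have mg4 : measurable_fun [set: R] (fun s => (4 * (`|g s| `^ alpha + `|g s| `^ alpha))%:E).
      apply/measurable_EFinP; apply: measurable_funM => //.
      have mga : measurable_fun [set: R] (fun s => (`|g s| `^ alpha)) by apply/measurable_EFinP; exact: (measurable_pow alpha mg).
      exact: measurable_funD.
    apply/integrableP; split=> //.
    have E8 t : `|(4 * (`|g t| `^ alpha + `|g t| `^ alpha))%:E|%E = (8%:E * (`|g t| `^ alpha)%:E)%E.
      by rewrite gee0_abs ?lee_fin ?mulr_ge0 ?addr_ge0 ?powR_ge0// -EFinM; congr EFin; ring.
    under eq_integral do rewrite E8.
    rewrite ge0_integralZl_EFin//; last exact: measurable_pow.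
    by rewrite -/(pnorm g) lte_mul_pinfty// lee_fin.
  - apply: aeW => s m _; rewrite lee_fin [leLHS]ger0_norm ?powR_ge0//.
    apply: (le_trans (powR_normD alpha12 _ _)); rewrite normrN ler_pM2l//.
    have Hg t : `|t| <= g s -> `|t| `^ alpha <= `|g s| `^ alpha.
      move=> tg; apply: ge0_ler_powR; rewrite ?nnegrE ?(ltW a0)//.
      by rewrite (le_trans tg)// ler_norm.
    by apply: lerD; apply: Hg; [exact: fg|exact: kg].
  by move=> _ _; rewrite integral0.
apply: (stab_approx_lim alpha12) => // e e0.
have /filterI/(_ (pointwise_cvg_pr P e0 mV mD Vcvg)) := cvge0_near_le e0 pcvg.
by move=> /filter_ex[m [h1 h2]]; exists (f m), (V m).
Qed.

End field_coefficient.

(** * Norms of the rescaled kernels, uniformly in the exponent *)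

Section coef_kernel_norm.
Context (R : realType) (alpha : R) (alpha12 : 1 < alpha < 2).
Context (psi : R -> R) (hpsi : analyzing_wavelet psi).
Local Notation mu := (@lebesgue_measure R).
Local Notation pnorm := (pnorm alpha).

(** The exponent is alpha (v - 1/alpha) from the factor plus 1 from the Jacobian. *)
Lemma pnorm_rescale (h : R -> R) (v u c : R) : 0 < c -> measurable_fun [set: R] h ->
  pnorm (fun s => c `^ (v - alpha^-1) * h ((s - u) / c)) = ((c `^ (v * alpha))%:E * pnorm h)%E.
Proof.
move=> c0 mh; have a0 := alpha_gt0 alpha12.
rewrite /pnorm (ge0_integral_affine u c0); last 2 first.
- apply: measurable_pow; apply: measurable_funM => //; apply: (measurableT_comp mh).
  by apply: measurable_funM => //; exact: measurable_funB.
- by move=> x; rewrite lee_fin powR_ge0.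
have E x : `|c `^ (v - alpha^-1) * h ((c * x + u - u) / c)| `^ alpha =
    c `^ (v * alpha - 1) * `|h x| `^ alpha.
  rewrite addrK [c * x]mulrC mulfK ?gt_eqF// normrM ger0_norm ?powR_ge0//.
  rewrite powRM ?powR_ge0// -powRrM mulrBl mulVf ?gt_eqF//.
under eq_integral do rewrite E EFinM.
rewrite ge0_integralZl_EFin//; last 2 first.
- exact: measurable_pow.
- exact: powR_ge0.
rewrite muleA -EFinM; congr (_%:E * _)%E.
rewrite -{1}(powRr1 (ltW c0)) -powRD; last by rewrite (gt_eqF c0) implybT.
by congr (_ `^ _); ring.
Qed.

(** The constants come before v because they must serve all cells at once. The window ]u - c A, u +
    c] is the image of ]- A, 1] under the rescaling. *)
Lemma coef_kernel_bounds (Hup : R) : Hup < 1 -> exists C c0 : R, [/\ 0 < C, 0 < c0 &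
  forall v u c, alpha^-1 < v <= Hup -> 0 < c ->
  [/\ (pnorm (coef_kernel alpha psi v u c) <= (C * c `^ (v * alpha))%:E)%E,
      ((c0 * c `^ (v * alpha))%:E <= pnorm (coef_kernel alpha psi v u c))%E &
  forall A, 1 <= A ->
    ((c0 * c `^ (v * alpha))%:E <=
      pnorm (fun s => coef_kernel alpha psi v u c s * \1_(`](u - c * A), u + c]%classic) s)%R)%E /\
    (pnorm (fun s => coef_kernel alpha psi v u c s * (1 - \1_(`](u - c * A), u + c]%classic) s))%R <=
      (C * A `^ (- alpha) * c `^ (v * alpha))%:E)%E]].
Proof.
move=> Hup1; have a0 := alpha_gt0 alpha12.
have [M M0 pM] := wavelet_bounded hpsi.
(* The decay exponent (1 - kappa) alpha equals 1 + alpha (1 - v); [r] is its value in the worst case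
   v = Hup. *)
pose r := 1 + alpha * (1 - Hup).
have r1 : 1 < r by rewrite ltrDl mulr_gt0// subr_gt0.
have [c0 c00 near] := pnorm_wavelet_kernel_near alpha12 hpsi.
have C0 : 0 < kernel_const alpha M r.
  by rewrite mulr_gt0 ?powR_gt0 ?mulr_gt0// addr_gt0// invr_gt0 subr_gt0.
exists (kernel_const alpha M r), c0; split => // v u c /andP[v1 v2] cp.
have v01 : alpha^-1 < v < 1 by rewrite v1 (le_lt_trans v2).
have k01 := kappa01 alpha12 v01.
have kr : r <= (1 - (v - alpha^-1)) * alpha.
  have -> : (1 - (v - alpha^-1)) * alpha = 1 + alpha * (1 - v) by field; rewrite gt_eqF.
  by rewrite lerD2l ler_pM2l// lerD2l lerN2.
have mPhi := measurable_wavelet_kernel hpsi k01.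
have cv0 : 0 <= c `^ (v * alpha) by exact: powR_ge0.
have indE A s : \1_(`](u - c * A), u + c]%classic) s = \1_(`](- A), 1]%classic) ((s - u) / c) :> R.
  rewrite !indicE !mem_setE !in_itv/= ltr_pdivlMr// ler_pdivrMr// mul1r.
  by congr ((_ && _)%:R); [rewrite mulNr ltrBrDl mulrC|rewrite lerBlDl].
have mJ A : measurable_fun [set: R] (\1_(`](- A), 1]%classic) : R -> R).
  by apply: measurable_indic; exact: measurable_itv.
have lo A : 1 <= A -> ((c0 * c `^ (v * alpha))%:E <=
      pnorm (fun s => coef_kernel alpha psi v u c s * \1_(`](u - c * A), u + c]%classic) s)%R)%E.
  move=> A1; under [X in (_ <= pnorm X)%E]eq_fun do rewrite /coef_kernel indE -mulrA.
  rewrite (@pnorm_rescale (fun x => wavelet_kernel psi (v - alpha^-1) x * \1_(`](- A), 1]%classic) x))//;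
    last exact: measurable_funM.
  rewrite mulrC EFinM; apply: lee_wpmul2l; first by rewrite lee_fin.
  by apply: near => //; rewrite (le_trans ler01).
split.
- rewrite (@pnorm_rescale (wavelet_kernel psi (v - alpha^-1)))// [X in (_ <= X%:E)%E]mulrC EFinM.
  apply: lee_wpmul2l; first by rewrite lee_fin.
  exact: pnorm_wavelet_kernel.
- apply: (le_trans (lo 1 (lexx 1))).
  have mk := measurable_coef_kernel alpha12 hpsi v01 u c.
  apply: (le_pnorm alpha12) => //.
    by apply: measurable_funM => //; apply: measurable_indic; exact: measurable_itv.
  move=> s; rewrite normrM ler_piMr// indicE; case: (_ \in _); rewrite ?normr1 ?normr0//.
move=> A A1; split; first exact: lo.
under [X in (pnorm X <= _)%E]eq_fun do rewrite /coef_kernel indE -mulrA.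
rewrite (@pnorm_rescale (fun x => wavelet_kernel psi (v - alpha^-1) x * (1 - \1_(`](- A), 1]%classic) x)))//;
  last by apply: measurable_funM => //; exact: measurable_funB.
rewrite [X in (_ <= X%:E)%E]mulrC EFinM; apply: lee_wpmul2l; first by rewrite lee_fin.
exact: pnorm_wavelet_kernel_far.
Qed.

End coef_kernel_norm.

(** * Probability estimates at one scale *)

Section borel_cantelli.
Context d (T : measurableType d) (R : realType) (P : probability T R).

(** The events before the rank where the bound starts are replaced by the empty set, so that a
    geometric series dominates the whole sum. *)
Lemma borel_cantelli_geometric (F : nat -> set T) (C q : R) :
  (forall j, measurable (F j)) -> 0 < q < 1 ->
  (\forall j \near \oo, pr P (F j) <= C * q ^+ j) ->
  {ae P, forall w, \forall j \near \oo, ~ F j w}.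
Proof.
move=> mF /andP[q0 q1] [N _ FN].
pose G j := if (N <= j)%N then F j else set0.
have mG j : measurable (G j) by rewrite /G; case: ifP.
have GC j : pr P (G j) <= `|C| * q ^+ j.
  rewrite /G; case: ifPn => [Nj|_].
    by rewrite (le_trans (FN _ Nj))// ler_wpM2r ?exprn_ge0 ?ler_norm// ltW.
  by rewrite /pr measure0/= mulr_ge0// exprn_ge0// ltW.
have sumG : (\sum_(n <oo) P (G n) < +oo)%E.
  apply: (@le_lt_trans _ _ (`|C| * (1 - q)^-1)%:E); last exact: ltry.
  apply: lime_le; first exact: is_cvg_nneseries.
  apply: nearW => n.
  apply: (@le_trans _ _ (\sum_(0 <= i < n) (`|C| * q ^+ i)%:E)%E).
    by apply: lee_sum => i _; rewrite prE// lee_fin.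
  rewrite sumEFin lee_fin.
  have q1' : `|q| < 1 by rewrite gtr0_norm.
  exact: (geometric_le_lim n (normr_ge0 C) q0 q1').
exists (lim_sup_set G); split; [| |move=> w /=].
- by apply: bigcap_measurableType => n _; exact: bigcup_measurable.
- exact: lim_sup_set_cvg0.
move=> nev n _ /=; apply: contrapT => nG; apply: nev.
exists (maxn n N) => // j /=; rewrite geq_max => /andP[nj Nj] Fj.
by apply: nG; exists j => //; rewrite /G Nj.
Qed.

End borel_cantelli.

Lemma sum_le_size (R : numDomainType) (I : eqType) (K : seq I) (F : I -> R) c :
  (forall k, k \in K -> F k <= c) -> \sum_(k <- K) F k <= (size K)%:R * c.
Proof.
elim: K => [|k K IH] Fc; first by rewrite big_nil mul0r.
rewrite big_cons/= -natr1 mulrDl mul1r addrC lerD ?Fc ?mem_head// IH// => i iK.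
by rewrite Fc// inE iK orbT.
Qed.

Section moment_and_count.
Context d (T : measurableType d) (R : realType) (P : probability T R).
Context (I : choiceType) (K : seq I) (W : I -> T -> R).
Context (mW : forall k, measurable_fun [set: T] (W k)).

Lemma measurable_forall_seq (A : I -> set T) : (forall k, measurable (A k)) ->
  measurable [set w | forall k, k \in K -> A k w].
Proof.
move=> mA.
rewrite [X in measurable X](_ : _ = \big[setI/setT]_(k <- K) A k).
  by apply: bigsetI_measurable => k _; exact: mA.
by rewrite -bigcap_seq; apply/seteqP; split => w /= h k; exact: h.
Qed.

Lemma pr_exists_le (A : I -> set T) : (forall k, measurable (A k)) ->
  measurable [set w | exists2 k, k \in K & A k w] /\
  pr P [set w | exists2 k, k \in K & A k w] <= \sum_(k <- K) pr P (A k).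
Proof.
move=> mA; have -> : [set w | exists2 k, k \in K & A k w] =
    \big[setU/set0]_(k <- K) A k.
  by rewrite -bigcup_seq; apply/seteqP; split => w [k kK Ak]; exists k.
by split; [exact: bigsetU_measurable|exact: pr_bigcup].
Qed.

(** As beta <= 1/2, passing from 4^i y to 4^(i+1) y multiplies the power by at most 2; x^beta is
    thus bounded through the levels that x exceeds, and a moment through finitely many tail
    events. *)
Lemma powR_min_dyadic (beta y x : R) (L : nat) : 0 < beta <= 2^-1 -> 0 < y ->
  0 <= x -> x <= 4 ^+ L * y ->
  x `^ beta <= y `^ beta *
    (1 + \sum_(i < L) 2 ^+ i.+1 * ((4 ^+ i * y <= x)%R)%:R).
Proof.
move=> /andP[b0 b2] y0 x0.
have le2 n : (4 ^+ n * y) `^ beta <= y `^ beta * 2 ^+ n.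
  rewrite (powRM _ (exprn_ge0 _ (ler0n R 4)) (ltW y0)) mulrC.
  rewrite (ler_wpM2l (powR_ge0 _ _))//.
  have p1 : 1 <= (2:R) ^+ n by rewrite exprn_ege1// ler1n.
  have p0 : 0 <= (2:R) ^+ n by exact: le_trans p1.
  have -> : (4:R) ^+ n = (2 ^+ n) `^ 2%:R.
    by rewrite powR_mulrn// -exprM mulnC exprM; congr (_ ^+ _); ring.
  rewrite -powRrM -[leRHS]powRr1// ler_powR//; lra.
elim: L => [|L IH] xL.
  by rewrite big_ord0 addr0 (le_trans (ge0_ler_powR _ _ _ xL))//;
    rewrite ?nnegrE ?ltW// ?mul1r// expr0 mul1r ?mulr1//.
rewrite big_ord_recr/=; case: (leP (4 ^+ L * y) x) => [Lx|xL'].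
  apply: (@le_trans _ _ (y `^ beta * 2 ^+ L.+1)).
    have z0 : 0 <= 4 ^+ L.+1 * y by rewrite mulr_ge0 ?exprn_ge0// ltW.
    by apply: (le_trans _ (le2 L.+1)); apply: ge0_ler_powR; rewrite ?nnegrE// ltW.
  rewrite (ler_wpM2l (powR_ge0 _ _))// mulr1 addrA lerDr; apply: addr_ge0 => //.
  by apply: sumr_ge0 => i _; apply: mulr_ge0 => //; exact: exprn_ge0.
by rewrite mulr0 addr0 IH// ltW.
Qed.

(** Markov's inequality for a bounded majorant. Truncating at 4^L y costs at most n B 4^(- L), which
    vanishes as L grows; the levels contribute the sum of 2^(i+1) B 4^(- i), at most 4 B. *)
Lemma pr_power_sum_ge (beta y B t : R) : 0 < beta <= 2^-1 -> 0 < y -> 0 <= B ->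
  0 < t -> (0 < size K)%N ->
  (forall k n, k \in K -> pr P [set w | 4 ^+ n * y <= `|W k w|] <= B * 4^-1 ^+ n) ->
  pr P [set w | t * (size K)%:R <= \sum_(k <- K) `|W k w| `^ beta] <=
    (1 + 4 * B) * y `^ beta / t.
Proof.
move=> bb y0 B0 t0 K0 WB; set n := (size K)%:R.
have n0 : 0 < n by rewrite ltr0n.
have mS : measurable [set w | t * n <= \sum_(k <- K) `|W k w| `^ beta].
  rewrite -[X in measurable X]setTI.
  have mf : measurable_fun setT (fun w => \sum_(k <- K) `|W k w| `^ beta).
    apply: measurable_sum => k.
    apply: (measurableT_comp (@measurable_powR R beta)).
    exact: (measurableT_comp (@normr_measurable R setT) (mW k)).
  have := mf measurableT _ (measurable_itv `[t * n, +oo[).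
  by congr (_ _); apply/seteqP; split => w /=; rewrite in_itv/= andbT.
have mge k x := measurable_norm_ge x (mW k).
suff H L : pr P [set w | t * n <= \sum_(k <- K) `|W k w| `^ beta] <=
    (1 + 4 * B) * y `^ beta / t + n * B * 4^-1 ^+ L.
  have : ((1 + 4 * B) * y `^ beta / t + n * B * 4^-1 ^+ L) @[L --> \oo] -->
      ((1 + 4 * B) * y `^ beta / t + n * B * 0).
    apply: cvgD; first exact: cvg_cst.
    apply: cvgM; first exact: cvg_cst.
    by apply: cvg_expr; rewrite ger0_norm// invf_lt1// ltr1n.
  rewrite mulr0 addr0 => /cvg_lim <-//.
  apply: limr_ge; last exact: nearW.
  apply: is_cvgD; first exact: is_cvg_cst.
  apply: is_cvgM; first exact: is_cvg_cst.
  by apply/cvg_ex; exists 0; apply: cvg_expr; rewrite ger0_norm// invf_lt1// ltr1n.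
pose g w := \sum_(k <- K) y `^ beta *
    (1 + \sum_(i < L) 2 ^+ i.+1 * \1_[set w | 4 ^+ i * y <= `|W k w|] w).
have bmi k (i : 'I_L) : bounded_measurable
    (fun w => 2 ^+ i.+1 * \1_[set w | 4 ^+ i * y <= `|W k w|] w : R).
  by apply: bmZ; exact: bm_indic.
have bk k : bounded_measurable (fun w => y `^ beta *
    (1 + \sum_(i < L) 2 ^+ i.+1 * \1_[set w | 4 ^+ i * y <= `|W k w|] w)).
  by apply: bmZ; apply: bmD; [exact: bm_cst|exact: bm_sum].
have bg : bounded_measurable g by exact: bm_sum.
have g0 w : 0 <= g w.
  apply: sumr_ge0 => k _; apply: mulr_ge0; first exact: powR_ge0.
  by apply: addr_ge0 => //; apply: sumr_ge0 => i _; apply: mulr_ge0.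
have Eg : Ex P g <= n * ((1 + 4 * B) * y `^ beta).
  rewrite /g Ex_sum//; apply: sum_le_size => k kK.
  rewrite ExZ; last by apply: bmD; [exact: bm_cst|exact: bm_sum].
  rewrite ExD; [|exact: bm_cst|exact: bm_sum].
  rewrite Ex_cst Ex_sum// mulrC ler_wpM2r ?powR_ge0// lerD2l.
  apply: (@le_trans _ _ (\sum_(0 <= i < L) (2 * B) * 2^-1 ^+ i)).
    rewrite big_mkord; apply: ler_sum => i _; rewrite ExZ; last exact: bm_indic.
    rewrite Ex_indic//.
    apply: (@le_trans _ _ (2 ^+ i.+1 * (B * 4^-1 ^+ i))); first by rewrite ler_pM2l ?exprn_gt0// WB.
    have -> : (4^-1 : R) = 2^-1 * 2^-1 by field.
    rewrite exprMn exprS [X in X <= _](_ : _ = 2 * B * 2^-1 ^+ i * (2 * 2^-1) ^+ i).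
      by rewrite divff// expr1n mulr1.
    by rewrite exprMn; ring.
  have h2 : `|(2^-1 : R)| < 1 by rewrite ger0_norm// invf_lt1// ltr1n.
  have := @geometric_le_lim R L (2 * B) 2^-1 (mulr_ge0 (ler0n _ 2) B0) _ h2.
  move=> /(_ _)/le_trans; apply; first by rewrite invr_gt0.
  have -> : (1 - 2^-1 : R)^-1 = 2 by field.
  lra.
pose D := [set w | exists2 k, k \in K & 4 ^+ L * y <= `|W k w|].
have [mD pD] := pr_exists_le (fun k => mge k (4 ^+ L * y)).
have mG : measurable [set w | t * n <= g w].
  have := (bg.1) measurableT _ (measurable_itv `[t * n, +oo[).
  by rewrite setTI; congr (_ _); apply/seteqP; split => w /=; rewrite in_itv/= andbT.
apply: (@le_trans _ _ (pr P ([set w | t * n <= g w] `|` D))).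
  apply: le_pr => //; first exact: measurableU.
  move=> w /= tn; have [Dw|nD] := pselect (D w); first by right.
  left; rewrite (le_trans tn)// /g big_seq [leRHS]big_seq ler_sum// => k kK.
  apply: (le_trans (powR_min_dyadic (L := L) bb y0 (normr_ge0 _) _)).
    by rewrite leNgt; apply/negP => /ltW yW; apply: nD; exists k.
  rewrite ler_wpM2l ?powR_ge0// lerD2l ler_sum// => i _.
  rewrite indicE (_ : (w \in _) = (4 ^+ i * y <= `|W k w|)%R)//.
  by apply/idP/idP; rewrite inE.
apply: (le_trans (prU _ _ _)) => //; apply: lerD.
  have tn0 : 0 < t * n by rewrite mulr_gt0.
  apply: (le_trans (pr_markov P mG bg tn0 g0 _)) => //.
  by rewrite ler_pdivrMr// (le_trans Eg)// le_eqVlt; apply/orP; left; apply/eqP; field; rewrite gt_eqF.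
apply: (le_trans pD); rewrite -mulrA; apply: sum_le_size => k kK; exact: WB.
Qed.

(** Markov's inequality for the number of small values; dependence between them does not matter. *)
Lemma pr_count_ge (x : I -> R) (p : R) : (0 < size K)%N ->
  (forall k, k \in K -> pr P [set w | `|W k w| <= x k] <= p) ->
  measurable [set w | (size K)%:R <= 
    2 * \sum_(k <- K) \1_[set w | `|W k w| <= x k] w :> R] /\
  pr P [set w | (size K)%:R <= 
    2 * \sum_(k <- K) \1_[set w | `|W k w| <= x k] w :> R] <= 2 * p.
Proof.
move=> K0 Wp; set n := (size K)%:R; have n0 : 0 < n :> R by rewrite ltr0n.
have bi k : bounded_measurable (\1_[set w | `|W k w| <= x k] : T -> R).
  by apply: bm_indic; exact: measurable_norm_le.
pose g w : R := 2 * \sum_(k <- K) \1_[set w | `|W k w| <= x k] w.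
have bg : bounded_measurable g by apply: bmZ; exact: bm_sum.
have mG : measurable [set w | n <= g w].
  have := (bg.1) measurableT _ (measurable_itv `[n, +oo[).
  by rewrite setTI; congr (_ _); apply/seteqP; split => w /=; rewrite in_itv/= andbT.
split => //.
have g0 w : 0 <= g w by rewrite mulr_ge0// sumr_ge0.
apply: (le_trans (pr_markov P mG bg n0 g0 _)) => //.
rewrite ler_pdivrMr// /g ExZ; last exact: bm_sum.
rewrite -mulrA ler_wpM2l// Ex_sum// mulrC; apply: sum_le_size => k kK.
rewrite Ex_indic; last exact: measurable_norm_le.
exact: Wp.
Qed.

End moment_and_count.

Section powR_positive_base.
Context (R : realType) (c : R) (c0 : 0 < c).

Lemma powR_addp x y : c `^ (x + y) = c `^ x * c `^ y.
Proof. by rewrite powRD// (gt_eqF c0) implybT. Qed.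

Lemma le_powR_base x y : c <= 1 -> y <= x -> c `^ x <= c `^ y.
Proof.
by move=> c1 yx; apply: ger_powR => //; rewrite c0 c1.
Qed.

End powR_positive_base.

Lemma sum_cst_seq (R : pzRingType) (I : Type) (K : seq I) (c : R) :
  \sum_(k <- K) c = (size K)%:R * c.
Proof. by rewrite big_const_seq count_predT iter_addr_0 mulr_natl. Qed.

(** * Tail, small ball and maximum of the coefficients of the field *)

Section coefficient_probabilities.
Context d (T : measurableType d) (R : realType) (P : probability T R).
Context (alpha : R) (alpha12 : 1 < alpha < 2).
Context (Z : R -> {RV P >-> R}) (hZ : SaS_Levy_process alpha Z).
Context (X : R -> R -> T -> R) (hX : lfsm_field alpha Z X).
Context (hXcont : continuous_paths alpha X).
Context (psi : R -> R) (hpsi : analyzing_wavelet psi).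
Context (Hup : R) (hHup : Hup < 1).

Let alpha0 : 0 < alpha. Proof. by case/andP: alpha12; lra. Qed.

Lemma exponent_range v : alpha^-1 < v <= Hup -> alpha^-1 < v < 1.
Proof. by move=> /andP[-> vH]; exact: le_lt_trans vH hHup. Qed.

Lemma field_coef_tail : exists2 C : R, 0 < C &
  forall v u c x : R, alpha^-1 < v <= Hup -> 0 < c -> 0 < x ->
  pr P [set w | x <= `|field_coef X psi v u c w|] <=
    C * (c `^ (v * alpha) * x `^ (- alpha)).
Proof.
have [C [c0 [C0 c00 HC]]] := coef_kernel_bounds alpha12 hpsi hHup.
exists (tail_const R * C); first by rewrite mulr_gt0// tail_const_gt0.
move=> v u c x hv pc px; have hv1 := exponent_range hv.
have [ub _ _] := HC v u c hv pc.
have s0 : 0 < C * c `^ (v * alpha) by rewrite mulr_gt0// powR_gt0.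
have := stab_approx_tail alpha12 hZ (measurable_coef_kernel alpha12 hpsi hv1 u c)
  (measurable_field_coef hX hXcont hpsi hv1 u c)
  (field_coef_approx alpha12 hX hXcont hpsi hv1 u pc) s0 ub px.
by rewrite !mulrA.
Qed.

(** [N] of order c^(- eps / 2) and xi = c^(- v - eps / 2): then N xi is of order c^(- v - eps), and
    xi^alpha times the scale is of order c^(- alpha eps / 2), so both terms of the small ball bound
    are O(c^(eps / 2)). *)
Lemma field_coef_small_ball (eps : R) : 0 < eps -> exists2 C : R, 0 < C &
  forall v u c : R, alpha^-1 < v <= Hup -> 0 < c <= 1 ->
  pr P [set w | `|field_coef X psi v u c w| <= 2 * c `^ (v + eps)] <=
    C * c `^ (eps / 2).
Proof.
move=> e0; have [C [c0 [_ c00 HC]]] := coef_kernel_bounds alpha12 hpsi hHup.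
have bc0 := ball_const_gt0 R.
have D0 : 0 < ball_const R * (8 + 8 / c0) by rewrite mulr_gt0// addr_gt0// divr_gt0.
exists (4 + ball_const R * (8 + 8 / c0)) => [|v u c hv /andP[pc c1]].
  by rewrite addr_gt0.
have hv1 := exponent_range hv.
have mW := measurable_field_coef hX hXcont hpsi hv1 u c.
set z := c `^ (eps / 2).
have z0 : 0 < z by rewrite powR_gt0.
(* For z > 1/4 the claimed bound exceeds 1; otherwise truncn (1 / (4 z)) is a positive [N]. *)
have [z4|z4] := ltP (4^-1) z.
  apply: (le_trans (pr_le1 P (measurable_norm_le _ mW))).
  have : 0 < ball_const R * (8 + 8 / c0) * z by rewrite mulr_gt0.
  rewrite mulrDl; lra.
have zi : z * z^-1 = 1 by rewrite divff// gt_eqF.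
have zi4 : 1 <= z^-1 / 4 by rewrite ler_pdivlMr// mul1r -(ler_pM2l z0) zi; lra.
have [N N0 /andP[N1 N2]] : exists2 N : nat, (0 < N)%N &
    N%:R <= z^-1 / 4 < N.+1%:R.
  exists (Num.truncn (z^-1 / 4)); first by rewrite truncn_gt0.
  exact: truncn_itv (le_trans ler01 zi4).
have Nr : 1 <= N%:R :> R by rewrite ler1n.
have Nz : N%:R^-1 <= 8 * z.
  move: N2; rewrite -[N.+1%:R]natr1 -(ltr_pM2l z0) mulrA zi => N2.
  have zN : z <= z * N%:R by rewrite ler_peMr// ltW.
  by rewrite -[leLHS]mul1r ler_pdivrMr ?ltr0n//; lra.
pose xi := c `^ (- v - eps / 2).
have xi0 : 0 < xi by rewrite powR_gt0.
have [_ lb _] := HC v u c hv pc.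
have s0 : 0 < c0 * c `^ (v * alpha) by rewrite mulr_gt0// powR_gt0.
have := stab_approx_small_ball alpha12 hZ (measurable_coef_kernel alpha12 hpsi hv1 u c)
  mW (field_coef_approx alpha12 hX hXcont hpsi hv1 u pc) s0 lb N0 xi0.
have th : 2 * c `^ (v + eps) <= (N%:R * xi)^-1 / 2.
  rewrite ler_pdivlMr// -div1r ler_pdivlMr; last by rewrite mulr_gt0// ltr0n.
  have -> : 2 * c `^ (v + eps) * 2 * (N%:R * xi) = 4 * N%:R * (c `^ (v + eps) * xi) by ring.
  rewrite -powR_addp// (_ : v + eps + _ = eps / 2); last by field.
  rewrite -/z; have : N%:R * z <= z^-1 / 4 * z by rewrite ler_wpM2r// ltW.
  have -> : z^-1 / 4 * z = 4^-1 by rewrite -[RHS]mul1r -zi; ring.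
  lra.
have sub : [set w | `|field_coef X psi v u c w| <= 2 * c `^ (v + eps)] `<=`
    [set w | `|field_coef X psi v u c w| <= (N%:R * xi)^-1 / 2].
  by move=> w /= h; exact: le_trans th.
move=> hb; apply: (le_trans (le_pr P (measurable_norm_le _ mW) (measurable_norm_le _ mW) sub)).
apply: (le_trans hb).
have -> : xi `^ alpha * (c0 * c `^ (v * alpha)) / 8 = c0 / 8 * c `^ (- (alpha * (eps / 2))).
  rewrite /xi -powRrM mulrCA mulrAC -powR_addp//.
  by rewrite (_ : (- v - eps / 2) * alpha + v * alpha = - (alpha * (eps / 2))); last by ring.
set y := c0 / 8 * _.
have y0 : 0 < y by rewrite mulr_gt0 ?powR_gt0// divr_gt0.
have ey : expR (- y) <= y^-1.
  rewrite expRN lef_pV2 ?posrE ?expR_gt0//.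
  by rewrite (le_trans _ (expR_ge1Dx y))// lerDr.
have yz : y^-1 <= 8 / c0 * z.
  rewrite /y invfM invf_div ler_pM2l ?divr_gt0// powRN invrK.
  apply: le_powR_base => //; case/andP: alpha12 => a1 _.
  by rewrite ler_peMl ?ltW// divr_gt0.
rewrite [leRHS]mulrDl -[leLHS]add0r; apply: lerD; first by rewrite mulr_ge0// ltW.
rewrite -mulrA; apply: (ler_wpM2l (ltW bc0)).
by rewrite [leRHS]mulrDl; apply: lerD => //; exact: le_trans yz.
Qed.

(* With windows of A = c^(- delta) cells the members of K have essentially
   disjoint near parts; eps < delta makes the far parts negligible and
   delta < alpha * eps makes the exponent (size K) c^(1 - alpha eps) large. *)
Lemma field_coef_max (eps k1 k2 : R) : 0 < eps -> alpha * eps < 1 ->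
  0 < k1 -> 0 < k2 ->
  exists C c1 : R, [/\ 0 < C, 0 < c1 &
  forall (c : R) (K : seq int) (u v : int -> R),
    0 < c <= 1 -> c <= c1 ->
    let delta := eps * (1 + alpha) / 2 in
    k1 * c `^ (delta - 1) <= (size K)%:R <= k2 * c^-1 ->
    uniq K -> (forall k, alpha^-1 < v k <= Hup) ->
    (forall k k', k \in K -> k' \in K -> k != k' ->
      (u k + c <= u k' - c * c `^ (- delta)) ||
      (u k' + c <= u k - c * c `^ (- delta))) ->
    pr P [set w | forall k, k \in K ->
      `|field_coef X psi (v k) (u k) c w| <= 2 * c `^ (v k - alpha^-1 + eps)] <=
    C * c `^ (eps * (alpha - 1) / 2)].
Proof.
move=> e0 ea k10 k20; have [C [c0 [C0 c00 HC]]] := coef_kernel_bounds alpha12 hpsi hHup.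
have [D [t0 [D0 t00 HD]]] := stab_approx_max alpha12 hZ.
have /andP[a1 a2] := alpha12.
have ea0 : 0 < 1 - eps * alpha by rewrite subr_gt0 mulrC.
(* Below [c1] the relative scale C c^(1 - alpha eps) is at most [t0], the smallness that
   [stab_approx_max] asks for. *)
pose c1 := (t0 / C) `^ (1 - eps * alpha)^-1.
have E0 : 0 < 4 * D / (c0 * k1) by rewrite divr_gt0// mulr_gt0.
exists (4 * D / (c0 * k1) + D * C * k2), c1; split.
- by rewrite addr_gt0// !mulr_gt0.
- by rewrite powR_gt0// divr_gt0.
move=> c K u v /andP[pc c_le1] c_c1 delta /andP[K1 K2] uK hv sepK.
have de : eps <= delta by rewrite /delta ler_pdivlMr// ler_wpM2l ?(ltW e0)//; lra.
pose A := c `^ (- delta).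
have A1 : 1 <= A.
  by rewrite -(powRr0 c) /A; apply: le_powR_base => //; rewrite oppr_le0 (le_trans (ltW e0)).
pose x k := 2 * c `^ (v k - alpha^-1 + eps).
have x0 k : 0 < x k by rewrite mulr_gt0// powR_gt0.
(* The exponent v cancels between the scale and the threshold, so cells with different exponents
   contribute equally. *)
pose y := 2 `^ (- alpha) * c `^ (1 - eps * alpha).
have xE k : c `^ (v k * alpha) * x k `^ (- alpha) = y.
  rewrite /x powRM ?powR_ge0// -powRrM mulrCA -powR_addp// /y; congr (_ * _ `^ _).
  by field; rewrite gt_eqF.
have h2 : 1 <= 2 :> R by rewrite ler1n.
have y4 : 2 `^ (- alpha) <= 1 :> R.
  by rewrite powRN invf_le1 ?powR_gt0// -[leLHS](powRr0 2); apply: ler_powR => //; exact: ltW.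
have y1 : 4^-1 <= 2 `^ (- alpha) :> R.
  rewrite powRN lef_pV2 ?posrE ?powR_gt0// (_ : 4 = 2 `^ 2%:R).
    by apply: ler_powR => //; exact: ltW.
  by rewrite powR_mulrn//; ring.
set q := c `^ (eps * (alpha - 1) / 2).
have q0 : 0 < q by rewrite powR_gt0.
pose Q := c `^ (1 - eps * alpha).
have Q0 : 0 < Q by rewrite powR_gt0.
(* [delta] is the midpoint of eps and alpha eps. The far parts have the exponent alpha (delta - eps)
   >= delta - eps, the near parts delta - alpha eps; here delta - eps = alpha eps - delta = eps
   (alpha - 1) / 2. *)
have Qc : c^-1 * A `^ (- alpha) * Q <= q.
  rewrite /A /Q -powRrM -(powR_inv1 (ltW pc)) -!powR_addp//.
  apply: le_powR_base => //; rewrite /delta.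
  have : 0 <= eps * (alpha - 1) * (alpha - 1).
    by rewrite !mulr_ge0 ?subr_ge0// ltW.
  nra.
have QS : q^-1 = c `^ (delta - 1) * Q.
  rewrite /q /Q -powR_addp// -powRN; congr (_ `^ _); rewrite /delta; by field.
have := HD int K (fun k => coef_kernel alpha psi (v k) (u k) c)
  (fun k => field_coef X psi (v k) (u k) c)
  (fun k => u k - c * A) (fun k => u k + c) x
  (fun k => c0 * c `^ (v k * alpha)) (fun k => C * A `^ (- alpha) * c `^ (v k * alpha))
  uK.
have hv1 k := exponent_range (hv k).
move=> /(_ (fun k => measurable_coef_kernel alpha12 hpsi (hv1 k) (u k) c)).
move=> /(_ (fun k => measurable_field_coef hX hXcont hpsi (hv1 k) (u k) c)).
move=> /(_ (fun k _ => field_coef_approx alpha12 hX hXcont hpsi (hv1 k) (u k) pc)).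
have s1 k : k \in K -> u k - c * A <= u k + c.
  by move=> _; rewrite lerD2l (le_trans _ (ltW pc))// oppr_le0 mulr_ge0 ?powR_ge0// ltW.
move=> /(_ s1 sepK).
have s2 k : k \in K -> [/\ 0 < x k, 0 < c0 * c `^ (v k * alpha) &
    0 < C * A `^ (- alpha) * c `^ (v k * alpha)].
  by move=> _; split => //; rewrite !mulr_gt0 ?powR_gt0// (lt_le_trans ltr01 A1).
move=> /(_ s2).
have s3 k : k \in K -> (pnorm alpha (coef_kernel alpha psi (v k) (u k) c) <=
    (t0 * x k `^ alpha)%:E)%E.
  move=> _; have [ub _ _] := HC (v k) (u k) c (hv k) pc.
  apply: (le_trans ub); rewrite lee_fin.
  rewrite -ler_pdivrMr ?powR_gt0// -powRN -mulrA xE /y.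
  apply: (@le_trans _ _ (C * Q)).
    by rewrite ler_pM2l// ler_piMl// ltW.
  rewrite mulrC -ler_pdivlMr//.
  have -> : t0 / C = c1 `^ (1 - eps * alpha).
    by rewrite /c1 -powRrM mulVf ?gt_eqF// powRr1// ltW// divr_gt0.
  by rewrite ge0_ler_powR ?nnegrE ?powR_ge0// ltW.
move=> /(_ s3).
have s4 k : k \in K -> ((c0 * c `^ (v k * alpha))%:E <=
    pnorm alpha (fun s => (coef_kernel alpha psi (v k) (u k) c s *
      \1_(`]u k - c * A, u k + c]%classic) s)%R))%E.
  by move=> _; have [_ _ /(_ A A1)[]] := HC (v k) (u k) c (hv k) pc.
move=> /(_ s4).
have s5 k : k \in K -> (pnorm alpha (fun s => (coef_kernel alpha psi (v k) (u k) c s *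
      (1 - \1_(`]u k - c * A, u k + c]%classic) s))%R) <=
      (C * A `^ (- alpha) * c `^ (v k * alpha))%:E)%E.
  by move=> _; have [_ _ /(_ A A1)[]] := HC (v k) (u k) c (hv k) pc.
move=> /(_ s5)/le_trans; apply.
under eq_bigr do rewrite -mulrA xE.
under [X in _ + D * X]eq_bigr do rewrite -mulrA xE.
rewrite 2!sum_cst_seq.
rewrite mulrDl; apply: lerD.
  set z := D^-1 * _.
  have zq : (4 * D / (c0 * k1))^-1 * q^-1 <= z.
    rewrite QS /z invf_div.
    have -> : c0 * k1 / (4 * D) * (c `^ (delta - 1) * Q) =
      D^-1 * (k1 * c `^ (delta - 1) * (c0 * (4^-1 * Q))) by field; rewrite gt_eqF.
    rewrite ler_pM2l ?invr_gt0//; apply: ler_pM => //.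
    + by rewrite mulr_ge0 ?powR_ge0// ltW.
    + by rewrite !mulr_ge0// ltW.
    + by rewrite ler_pM2l// /y ler_pM2r.
  have z0 : 0 < z by rewrite (lt_le_trans _ zq)// mulr_gt0// invr_gt0.
  (* The crude bound exp (- z) <= 1 / z suffices, since 1 / z is at most a multiple of [q]. *)
  apply: (@le_trans _ _ z^-1).
    rewrite expRN lef_pV2 ?posrE ?expR_gt0//.
    by rewrite (le_trans _ (expR_ge1Dx z))// lerDr.
  have zq' : z^-1 <= ((4 * D / (c0 * k1))^-1 * q^-1)^-1.
    by rewrite lef_pV2 ?posrE// mulr_gt0// invr_gt0.
  by rewrite (le_trans zq')// -invfM invrK.
have yQ : y <= Q by rewrite ler_piMl// ltW.
have yA : C * A `^ (- alpha) * y <= C * A `^ (- alpha) * Q.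
  by apply: ler_wpM2l yQ; rewrite mulr_ge0 ?powR_ge0// ltW.
apply: (@le_trans _ _ (D * ((k2 * c^-1) * (C * A `^ (- alpha) * Q)))).
  apply: (ler_wpM2l (ltW D0)); apply: ler_pM => //.
  by rewrite !mulr_ge0 ?powR_ge0// ltW// mulr_gt0// powR_gt0.
have -> : D * (k2 / c * (C * A `^ (- alpha) * Q)) =
    D * C * k2 * (c^-1 * A `^ (- alpha) * Q) by ring.
by apply: ler_wpM2l Qc; rewrite !mulr_ge0// ltW.
Qed.

End coefficient_probabilities.

(** * Dyadic cells *)

Section dyadic_indices.
Context (R : realType).
Implicit Types (a b : R) (j : nat) (k : int).

Let pow2_gt0 j : 0 < (2 : R) ^+ j. Proof. by rewrite exprn_gt0. Qed.

Lemma nu_setE a b j :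
  [set k | `[2 ^- j * k%:~R, 2 ^- j * (k + 1)%:~R]%classic `<=` `[a, b]%classic] =
  [set k | a * 2 ^+ j <= k%:~R /\ (k + 1)%:~R <= b * 2 ^+ j].
Proof.
have hd k : 2 ^- j * k%:~R <= 2 ^- j * (k + 1)%:~R :> R.
  by rewrite ler_pM2l ?invr_gt0// ler_int lerDl.
apply/seteqP; split => k /=.
  move=> sub; split.
    have := sub (2 ^- j * k%:~R); rewrite /= !in_itv/= lexx hd => /(_ isT)/andP[ak _].
    by move: ak; rewrite ler_pdivlMl// mulrC.
  have := sub (2 ^- j * (k + 1)%:~R); rewrite /= !in_itv/= lexx hd => /(_ isT)/andP[_].
  by rewrite ler_pdivrMl// mulrC.
move=> [ak kb] x; rewrite /= !in_itv/= => /andP[x1 x2]; apply/andP; split.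
  by rewrite (le_trans _ x1)// ler_pdivlMl// mulrC.
by rewrite (le_trans x2)// ler_pdivrMl// mulrC.
Qed.

Lemma nu_finite a b j : finite_set
  [set k | a * 2 ^+ j <= k%:~R /\ (k + 1)%:~R <= b * 2 ^+ j].
Proof.
pose M := (Num.truncn (Num.max `|a * 2 ^+ j| `|b * 2 ^+ j|)).+1.
have HM : Num.max `|a * 2 ^+ j| `|b * 2 ^+ j| < M%:R.
  have h : 0 <= Num.max `|a * 2 ^+ j| `|b * 2 ^+ j| by rewrite le_max normr_ge0.
  by have /andP[] := truncn_itv h.
apply: (@sub_finite_set _ _ ((fun i : nat => i%:Z - M%:Z) @` `I_(M + M))); last first.
  exact/finite_image/finite_II.
move=> k /= [ak kb].
have k1 : (- M%:Z <= k)%R.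
  rewrite -(ler_int R) rmorphN/= (le_trans _ ak)// lerNl.
  by rewrite (le_trans (ler_norm _))// normrN ltW// (le_lt_trans _ HM)// le_max lexx.
have k2 : (k < M%:Z)%R.
  rewrite -(ltr_int R) (lt_le_trans (y := (k + 1)%:~R))// ?ltr_int ?ltrDl//.
  rewrite (le_trans kb)// (le_trans (ler_norm _))// ltW// (le_lt_trans _ HM)//.
  by rewrite le_max lexx orbT.
exists (absz (k + M%:Z)); last by rewrite gez0_abs ?addrK// -lerBlDr sub0r.
have kM : (0 <= k + M%:Z)%R by rewrite -lerBlDr sub0r.
by rewrite /= -ltz_nat gez0_abs// PoszD ltrD2r.
Qed.

Lemma mem_nu a b j k :
  (k \in nu a b j) = (a * 2 ^+ j <= k%:~R) && ((k + 1)%:~R <= b * 2 ^+ j).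
Proof.
rewrite /nu nu_setE in_fset_set; last exact: nu_finite.
by apply/idP/andP => [/set_mem//|h]; exact/mem_set.
Qed.

Definition arith_seq k (q m : nat) : seq int := [seq k + (q * i)%:Z | i <- iota 0 m].

Lemma size_nu_le a b j : a <= b -> #|` nu a b j|%:R <= (b - a) * 2 ^+ j.
Proof.
move=> ab; have L0 : 0 <= (b - a) * 2 ^+ j by rewrite mulr_ge0 ?subr_ge0// ltW.
have /andP[h1 h2] := truncn_itv L0; apply: le_trans h1; rewrite ler_nat.
set m := Num.truncn _ in h2 *.
rewrite -[leqRHS](_ : size (arith_seq (Num.ceil (a * 2 ^+ j)) 1 m) = m).
  apply: uniq_leq_size => [|k]; first exact: fset_uniq.
  rewrite mem_nu => /andP[k1 k2].
  have ck : (Num.ceil (a * 2 ^+ j) <= k)%R by rewrite ceil_le_int.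
  apply/mapP; exists (absz (k - Num.ceil (a * 2 ^+ j))); last first.
    by rewrite mul1n gez0_abs ?subr_ge0// subrKC.
  rewrite mem_iota add0n leq0n/= -ltz_nat gez0_abs ?subr_ge0//.
  have : (k + 1 - Num.ceil (a * 2 ^+ j))%:~R < (m.+1)%:~R :> R.
    by apply: le_lt_trans h2; rewrite rmorphB/= mulrBl lerB// ceil_ge.
  by rewrite ltr_int addrAC -[m.+1]addn1 PoszD ltrD2r.
by rewrite size_map size_iota.
Qed.

Lemma nu_gt0 a b j : 2 <= (b - a) * 2 ^+ j -> (0 < #|` nu a b j|)%N.
Proof.
move=> ab; rewrite cardfs_gt0; apply/fset0Pn; exists (Num.ceil (a * 2 ^+ j)).
have : (Num.ceil (a * 2 ^+ j))%:~R < a * 2 ^+ j + 1.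
  by rewrite -ltrBlDr -(rmorphB _ _ 1) ceilB1_lt.
by rewrite mem_nu ceil_ge/= rmorphD/=; lra.
Qed.

(** An arithmetic progression of step [q] from the ceiling of a 2^j. It has truncn ((L - 1) / q) >
    (L - 1) / q - 1 terms, and L >= 2 q + 2 makes this at least L / (2 q). *)
Lemma nu_spaced a b j (q : nat) : (0 < q)%N -> 2 * q%:R + 2 <= (b - a) * 2 ^+ j ->
  exists K : seq int, [/\ uniq K, {subset K <= nu a b j},
    (forall k k', k \in K -> k' \in K -> k != k' ->
       (k + q%:Z <= k') || (k' + q%:Z <= k)) &
    (b - a) * 2 ^+ j / (2 * q%:R) <= (size K)%:R <= (b - a) * 2 ^+ j].
Proof.
move=> q0; set L := (b - a) * 2 ^+ j => qL.
have qR : 0 < q%:R :> R by rewrite ltr0n.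
have q1 : 1 <= q%:R :> R by rewrite ler1n.
have L0 : 0 <= (L - 1) / q%:R by rewrite divr_ge0//; lra.
have /andP[m1 m2] := truncn_itv L0; set m := Num.truncn _ in m1 m2 *.
set k0 := Num.ceil (a * 2 ^+ j).
have k01 : k0%:~R < a * 2 ^+ j + 1.
  by rewrite -ltrBlDr -(rmorphB _ _ 1) ceilB1_lt.
have k02 : a * 2 ^+ j <= k0%:~R by exact: ceil_ge.
rewrite ler_pdivlMr// in m1; rewrite ltr_pdivrMr// in m2.
exists (arith_seq k0 q m); split.
- rewrite map_inj_uniq ?iota_uniq// => i i' /addrI/eqP.
  by rewrite eqz_nat eqn_pmul2l// => /eqP.
- move=> k /mapP[i]; rewrite mem_iota add0n => /andP[_ im] ->; rewrite mem_nu.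
  have qi : (q%:R * i.+1%:R <= q%:R * m%:R :> R) by rewrite ler_pM2l// ler_nat.
  have h : q%:R * i.+1%:R = q%:R * i%:R + q%:R :> R by rewrite -natr1 mulrDr mulr1.
  have q2 : 0 <= q%:R * i%:R :> R by rewrite mulr_ge0.
  have e : (k0 + (q * i)%:Z)%:~R = k0%:~R + q%:R * i%:R :> R.
    by rewrite rmorphD/= -pmulrn natrM.
  rewrite [(_ + 1)%:~R]rmorphD/= e; move: m1; rewrite /L => m1.
  apply/andP; split; nra.
- move=> k k' /mapP[i _ ->] /mapP[i' _ ->]; rewrite (inj_eq (addrI _)) eqz_nat.
  rewrite eqn_pmul2l// neq_ltn => /orP[] ii; apply/orP; [left|right].
    by rewrite -addrA lerD2l -PoszD lez_nat addnC -mulnS leq_mul2l ii orbT.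
  by rewrite -addrA lerD2l -PoszD lez_nat addnC -mulnS leq_mul2l ii orbT.
rewrite size_map size_iota; apply/andP; split.
  rewrite ler_pdivrMr ?mulr_gt0//; move: m2; rewrite -[m.+1%:R]natr1; nra.
by have := mulr_ge0 (ler0n R m) (_ : 0 <= q%:R - 1); nra.
Qed.

Lemma nu_subset a b a' b' j : a <= a' -> b' <= b -> {subset nu a' b' j <= nu a b j}.
Proof.
move=> aa bb k; rewrite !mem_nu => /andP[h1 h2]; apply/andP; split.
  by apply: le_trans h1; rewrite ler_pM2r.
by apply: (le_trans h2); rewrite ler_pM2r.
Qed.

End dyadic_indices.

(** * Almost sure estimates *)

Section dyadic_scales.
Context (R : realType).
Implicit Types (x e : R) (j : nat).

Lemma dyadic_gt0 j : 0 < (2 : R) ^- j.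
Proof. by rewrite invr_gt0 exprn_gt0. Qed.

Lemma dyadic_le1 j : (2 : R) ^- j <= 1.
Proof. by rewrite invf_le1 ?exprn_gt0// exprn_ege1// ler1n. Qed.

Lemma powR_dyadic x j : (2 ^- j) `^ x = (2 `^ (- x)) ^+ j :> R.
Proof.
have -> : 2 ^- j = 2 `^ (- j%:R) :> R by rewrite powRN powR_mulrn.
rewrite -powRrM -[RHS]powR_mulrn ?powR_ge0// -powRrM; congr (_ `^ _); ring.
Qed.

Lemma dyadic_ratio x : 0 < x -> 0 < (2 : R) `^ (- x) < 1.
Proof.
move=> x0; rewrite powR_gt0//= powRN invf_lt1 ?powR_gt0//.
rewrite -[ltLHS](_ : 1 `^ x = 1); last by rewrite powR1.
by rewrite gt0_ltr_powR ?nnegrE ?ltr1n.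
Qed.

Lemma near_dyadic_le x e : 0 < x -> 0 < e ->
  \forall j \near \oo, (2 ^- j) `^ x <= e.
Proof.
move=> x0 e0; have /andP[q0 q1] := dyadic_ratio x0.
have : (2 `^ (- x)) ^+ j @[j --> \oo] --> (0 : R).
  by apply: cvg_expr; rewrite gtr0_norm.
move=> /cvgrPdist_le/(_ e e0); apply: filterS => j.
by rewrite sub0r normrN powR_dyadic ger0_norm// exprn_ge0// ltW.
Qed.

Lemma near_dyadic_ge x e : 0 < x -> \forall j \near \oo, e <= x * 2 ^+ j.
Proof.
move=> x0; have e0 : 0 < `|e| + 1 by rewrite ltr_pwDr.
apply: filterS (near_dyadic_le ltr01 (divr_gt0 x0 e0)) => j.
have p2 : 0 < (2 : R) ^+ j by rewrite exprn_gt0.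
rewrite powRr1 ?(ltW (dyadic_gt0 j))// ler_pdivlMr// ler_pdivrMl// mulrC.
by apply: le_trans; rewrite (le_trans (ler_norm _))// lerDl.
Qed.

End dyadic_scales.

Section almost_sure_estimates.
Context d (T : measurableType d) (R : realType) (P : probability T R).
Context (alpha : R) (alpha12 : 1 < alpha < 2).
Context (Z : R -> {RV P >-> R}) (hZ : SaS_Levy_process alpha Z).
Context (X : R -> R -> T -> R) (hX : lfsm_field alpha Z X).
Context (hXcont : continuous_paths alpha X).
Context (psi : R -> R) (hpsi : analyzing_wavelet psi).
Context (Hup : R) (hHup : Hup < 1).
Context (H : R -> R) (hH : forall t, alpha^-1 < H t <= Hup).

Definition local_coef j (k : int) (w : T) : R :=
  field_coef X psi (H (2 ^- j * k%:~R)) (2 ^- j * k%:~R) (2 ^- j) w.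

Lemma measurable_local_coef j k : measurable_fun [set: T] (local_coef j k).
Proof.
exact: (measurable_field_coef hX hXcont hpsi (exponent_range hHup (hH _))).
Qed.

Lemma nu_mem_itv (a b : R) j k : k \in nu a b j -> a <= 2 ^- j * k%:~R <= b.
Proof.
have p2 : 0 < (2 : R) ^+ j by rewrite exprn_gt0.
rewrite mem_nu => /andP[h1 h2]; rewrite ler_pdivlMl// mulrC h1/=.
rewrite ler_pdivrMl// mulrC; apply: le_trans h2.
by rewrite ler_int lerDl.
Qed.

Section upper.
Context (a b m eps : R) (hab : a <= b) (he : 0 < eps).
Context (hm : forall t, a <= t <= b -> m <= H t).

Let tail : exists2 C : R, 0 < C & forall j k (x : R), k \in nu a b j -> 0 < x ->
  pr P [set w | x <= `|local_coef j k w|] <=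
    C * ((2 ^- j) `^ (m * alpha) * x `^ (- alpha)).
Proof.
have [C C0 HC] := field_coef_tail alpha12 hZ hX hXcont hpsi hHup.
exists C => // j k x kn x0.
apply: (le_trans (HC _ _ _ _ (hH _) (dyadic_gt0 R j) x0)).
rewrite ler_pM2l// ler_wpM2r ?powR_ge0//.
apply: le_powR_base; [exact: dyadic_gt0|exact: dyadic_le1|].
rewrite ler_pM2r; last by case/andP: alpha12; lra.
by apply: hm; exact: nu_mem_itv.
Qed.

(** Union bound: at most (b - a) 2^j cells, each with probability at most C 2^(- j (1 + alpha
    eps)). *)
Lemma local_coef_max_le : {ae P, forall w, \forall j \near \oo,
  forall k, k \in nu a b j ->
    `|local_coef j k w| < (2 ^- j) `^ (m - alpha^-1 - eps)}.
Proof.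
have [C C0 HC] := tail; have /andP[a1 a2] := alpha12.
pose A j k := [set w | (2 ^- j) `^ (m - alpha^-1 - eps) <= `|local_coef j k w|].
have mA j k : measurable (A j k).
  by apply: measurable_norm_ge; exact: measurable_local_coef.
have q01 := dyadic_ratio (mulr_gt0 (lt_trans ltr01 a1) he).
have := @borel_cantelli_geometric _ _ _ P
  (fun j => [set w | exists2 k, k \in (nu a b j : seq int) & A j k w])
  ((b - a) * C) _ _ q01.
have mE j : measurable [set w | exists2 k, k \in (nu a b j : seq int) & A j k w].
  by have [] := pr_exists_le P (nu a b j) (mA j).
move=> /(_ mE) BC; apply: filterS (BC _).
  move=> w; apply: filterS => j nE k kn; rewrite ltNge; apply/negP => Ak.
  by apply: nE; exists k.
apply: nearW => j; have [_ le1] := pr_exists_le P (nu a b j) (mA j).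
apply: (le_trans le1); rewrite -powR_dyadic.
apply: (@le_trans _ _ (#|` nu a b j|%:R * (C * ((2 ^- j) `^ (1 + alpha * eps))))).
  apply: sum_le_size => k kn.
  apply: (le_trans (HC _ _ _ kn _)); first by rewrite powR_gt0// dyadic_gt0.
  rewrite -powRrM -powR_addp ?dyadic_gt0// le_eqVlt; apply/orP; left; apply/eqP.
  by congr (_ * _ `^ _); field; rewrite gt_eqF// (lt_trans ltr01).
rewrite powR_addp ?dyadic_gt0// powRr1 ?(ltW (dyadic_gt0 R j))//.
rewrite (_ : (b - a) * C * _ = (b - a) * 2 ^+ j * (C * (2 ^- j * (2 ^- j) `^ (alpha * eps)))).
  apply: ler_wpM2r; last exact: size_nu_le.
  by rewrite !mulr_ge0 ?powR_ge0 ?(ltW (dyadic_gt0 R j))// ltW.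
rewrite [RHS](_ : _ = (2 ^+ j * 2 ^- j) * ((b - a) * C * (2 ^- j) `^ (alpha * eps))).
  by rewrite divff ?mul1r// gt_eqF// exprn_gt0.
by ring.
Qed.

(** [pr_power_sum_ge] at y = 2^(- j m): the tail at 4^n y is at most C 4^(- n alpha), and y^beta / t
    = 2^(- j beta eps) is summable. *)
Lemma local_coef_mean_le (beta : R) : a < b -> 0 < beta <= 2^-1 ->
  {ae P, forall w, \forall j \near \oo,
  \sum_(k <- nu a b j) `|local_coef j k w| `^ beta <
    (2 ^- j) `^ (beta * (m - eps)) * #|` nu a b j|%:R}.
Proof.
move=> ab hb; have [b0 b2] := andP hb.
have [C C0 HC] := tail; have /andP[a1 a2] := alpha12.
have q01 := dyadic_ratio (mulr_gt0 b0 he).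
(* The estimate needs at least one cell; without any, the bad event is declared empty, and [nu_gt0]
   rules this case out for large j. *)
pose F j := if (0 < #|` nu a b j|)%N then
  [set w | (2 ^- j) `^ (beta * (m - eps)) * (size (nu a b j : seq int))%:R <=
    \sum_(k <- nu a b j) `|local_coef j k w| `^ beta] else set0.
have mF j : measurable (F j).
  rewrite /F; case: ifP => // _.
  have mf : measurable_fun setT (fun w => \sum_(k <- nu a b j) `|local_coef j k w| `^ beta).
    apply: measurable_sum => k.
    apply: (measurableT_comp (@measurable_powR R beta)).
    exact: (measurableT_comp (@normr_measurable R setT) (@measurable_local_coef j k)).
  have := mf measurableT _ (measurable_itv
    `[(2 ^- j) `^ (beta * (m - eps)) * (size (nu a b j : seq int))%:R, +oo[).
  by rewrite setTI; congr (_ _); apply/seteqP; split => w /=; rewrite in_itv/= andbT.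
have := @borel_cantelli_geometric _ _ _ P F (1 + 4 * C) _ mF q01.
move=> BC; apply: filterS (BC _).
  move=> w; apply: filter_app.
  have ba : 0 < b - a by rewrite subr_gt0.
  apply: filterS (near_dyadic_ge 2 ba) => j nb nE.
  rewrite ltNge; apply/negP => Ak.
  by apply: nE; rewrite /F nu_gt0.
apply: nearW => j; rewrite /F; case: ifPn => [n0|_]; last first.
  by rewrite /pr measure0/= mulr_ge0 ?exprn_ge0 ?powR_ge0// addr_ge0// mulr_ge0// ltW.
have := pr_power_sum_ge (P := P) (@measurable_local_coef j) hb
  (y := (2 ^- j) `^ m) (B := C) _ (ltW C0) (t := (2 ^- j) `^ (beta * (m - eps))) _ n0.
rewrite powR_gt0 ?dyadic_gt0// powR_gt0 ?dyadic_gt0// => /(_ isT isT) le1.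
apply: (le_trans (le1 _)).
  move=> k n kn; have p4 : 0 < (4 : R) ^+ n by rewrite exprn_gt0.
  apply: (le_trans (HC _ _ _ kn _)); first by rewrite mulr_gt0 ?powR_gt0 ?dyadic_gt0.
  rewrite ler_pM2l// (powRM _ (ltW p4) (powR_ge0 _ _)) mulrCA -powRrM.
  rewrite -(powR_addp (dyadic_gt0 _ _)) mulrN subrr powRr0 mulr1 exprVn powRN.
  rewrite lef_pV2 ?posrE ?powR_gt0// -[leLHS]powRr1 ?(ltW p4)//.
  apply: ler_powR; last exact: ltW.
  by rewrite exprn_ege1// ler1n.
rewrite -powRrM -mulrA -powRN -(powR_addp (dyadic_gt0 _ _)) -powR_dyadic.
by rewrite le_eqVlt; apply/orP; left; apply/eqP; congr (_ * _ `^ _); ring.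
Qed.

End upper.

Section lower.
Context (a b eps : R) (hab : a < b) (he : 0 < eps).

(** Meant for a subinterval where H is close to its minimum: more than half of its cells have a
    coefficient that is not small. *)
Lemma local_coef_count : {ae P, forall w, \forall j \near \oo,
  2 * \sum_(k <- nu a b j)
    \1_[set w | `|local_coef j k w| <=
      2 * (2 ^- j) `^ (H (2 ^- j * k%:~R) + eps)] w < #|` nu a b j|%:R :> R}.
Proof.
have ba : 0 < b - a by rewrite subr_gt0.
have [C C0 HC] := field_coef_small_ball alpha12 hZ hX hXcont hpsi hHup he.
pose x j (k : int) := 2 * (2 ^- j) `^ (H (2 ^- j * k%:~R) + eps).
pose F j := if (0 < #|` nu a b j|)%N then
  [set w | (size (nu a b j : seq int))%:R <= 2 * \sum_(k <- nu a b j)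
    \1_[set w | `|local_coef j k w| <= x j k] w :> R] else set0.
have Hp j k : k \in (nu a b j : seq int) ->
    pr P [set w | `|local_coef j k w| <= x j k] <= C * (2 ^- j) `^ (eps / 2).
  by move=> _; apply: HC => //; rewrite dyadic_gt0 dyadic_le1.
have mF j : measurable (F j).
  rewrite /F; case: ifP => // n0.
  by have [] := pr_count_ge (P := P) (@measurable_local_coef j) n0 (Hp j).
have := @borel_cantelli_geometric _ _ _ P F (2 * C) _ mF (dyadic_ratio (divr_gt0 he (ltr0n _ 2))).
move=> BC; apply: filterS (BC _).
  move=> w; apply: filter_app; apply: filterS (near_dyadic_ge 2 ba) => j nb nE.
  rewrite ltNge; apply/negP => Ak.
  by apply: nE; rewrite /F nu_gt0.
apply: nearW => j; rewrite /F; case: ifPn => [n0|_]; last first.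
  by rewrite /pr measure0/= mulr_ge0 ?exprn_ge0 ?powR_ge0// mulr_ge0// ltW.
have [_ le1] := pr_count_ge (P := P) (@measurable_local_coef j) n0 (Hp j).
by apply: (le_trans le1); rewrite -powR_dyadic mulrA.
Qed.

(** Only a thinned family of cells is used, spaced so that the windows of [field_coef_max] are
    disjoint. *)
Lemma local_coef_max_ge : alpha * eps < 1 -> {ae P, forall w, \forall j \near \oo,
  exists2 k, k \in nu a b j &
    2 * (2 ^- j) `^ (H (2 ^- j * k%:~R) - alpha^-1 + eps) < `|local_coef j k w|}.
Proof.
move=> ea; have /andP[a1 a2] := alpha12.
have ba : 0 < b - a by rewrite subr_gt0.
(* There are at least L / (2 q) spaced cells with q <= 3 A, hence the 6. *)
have k10 : 0 < (b - a) / 6 by rewrite divr_gt0.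
have [C [c1 [C0 c10 HC]]] :=
  field_coef_max alpha12 hZ hX hXcont hpsi hHup he ea k10 ba.
pose x j (k : int) := 2 * (2 ^- j) `^ (H (2 ^- j * k%:~R) - alpha^-1 + eps).
pose F j := [set w | forall k, k \in (nu a b j : seq int) -> `|local_coef j k w| <= x j k].
have mle j k : measurable [set w | `|local_coef j k w| <= x j k].
  by apply: measurable_norm_le; exact: measurable_local_coef.
have mF j : measurable (F j).
  by apply: (@measurable_forall_seq _ _ _ _ (fun k => [set w | `|local_coef j k w| <= x j k])).
have q01 : 0 < (2 : R) `^ (- (eps * (alpha - 1) / 2)) < 1.
  by apply: dyadic_ratio; rewrite divr_gt0// mulr_gt0// subr_gt0.
have BC := @borel_cantelli_geometric _ _ _ P F C _ mF q01.
apply: filterS (BC _).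
  move=> w; apply: filterS => j nE; apply: contrapT => nex; apply: nE => k kn.
  by rewrite leNgt; apply/negP => lt; apply: nex; exists k.
pose delta := eps * (1 + alpha) / 2.
have d1 : 0 < 1 - delta.
  rewrite /delta subr_gt0 ltr_pdivrMr//.
  have : eps * 1 < eps * alpha by rewrite ltr_pM2l.
  rewrite mulrDr; lra.
have d0 : 0 <= delta by rewrite divr_ge0// mulr_ge0 ?(ltW he)//; lra.
near=> j.
have c0 := dyadic_gt0 R j; have cle1 := dyadic_le1 R j.
pose A := (2 ^- j) `^ (- delta).
have A1 : 1 <= A.
  by rewrite -(powRr0 (2 ^- j)) /A; apply: le_powR_base => //; rewrite oppr_le0.
have A0 : 0 < A by apply: lt_le_trans A1.
have /andP[A2 A3] := truncn_itv (ltW A0).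
(* A window reaches c A to the left of the cell's left end and c to its right, so q >= A + 1
   separates them; A >= 1 gives q <= 3 A. *)
pose q := (Num.truncn A).+2.
have qA : A + 1 <= q%:R by move: A3; rewrite /q -[_.+2%:R]natr1; lra.
have q3 : q%:R <= 3 * A by move: A2; rewrite /q -addn2 natrD; lra.
have cj : 2 ^- j * A = (2 ^- j) `^ (1 - delta).
  by rewrite powR_addp// powRr1// ltW.
have small : (2 ^- j) `^ (1 - delta) <= (b - a) / 8.
  by near: j; apply: near_dyadic_le => //; rewrite divr_gt0.
have jV : 2 ^+ j * 2 ^- j = 1 :> R by rewrite divff// gt_eqF// exprn_gt0.
have p2 : 0 < (2 : R) ^+ j by rewrite exprn_gt0.
have LA : 8 * A <= (b - a) * 2 ^+ j.
  have := ler_wpM2l (ltW p2) small; rewrite -cj mulrA jV mul1r; lra.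
have L2 : 2 * q%:R + 2 <= (b - a) * 2 ^+ j by lra.
have [K [uK Ksub Ksep /andP[K1 K2]]] := nu_spaced (ltn0Sn _ : (0 < q)%N) L2.
have sub : F j `<=` [set w | forall k, k \in K -> `|local_coef j k w| <= x j k].
  by move=> w /= Fw k kK; apply: Fw; exact: Ksub.
have mK : measurable [set w | forall k, k \in K -> `|local_coef j k w| <= x j k].
  by apply: (@measurable_forall_seq _ _ _ _ (fun k => [set w | `|local_coef j k w| <= x j k])).
apply: (le_trans (le_pr P (mF j) mK sub)); rewrite -powR_dyadic.
apply: (HC _ K (fun k => 2 ^- j * k%:~R) (fun k => H (2 ^- j * k%:~R))) => //.
- by rewrite c0 cle1.
- by rewrite -[leLHS](powRr1 (ltW c0)); near: j; exact: near_dyadic_le.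
- rewrite -/delta invrK K2 andbT; apply: le_trans K1.
  rewrite powRB; last by rewrite (gt_eqF c0) implybT.
  rewrite (powRr1 (ltW c0)) invrK.
  have -> : (2 ^- j) `^ delta = A^-1 by rewrite /A powRN invrK.
  rewrite [leRHS]mulrC [leLHS](_ : _ = (6 * A)^-1 * ((b - a) * 2 ^+ j)); last first.
    by rewrite invfM; ring.
  rewrite ler_wpM2r ?(mulr_ge0 (ltW ba) (ltW p2))// lef_pV2 ?posrE ?mulr_gt0 ?ltr0n//.
  lra.
move=> k k' kK k'K kk'; rewrite -/delta -/A.
have sep (n n' : int) : n + q%:Z <= n' ->
    2 ^- j * n%:~R + 2 ^- j <= 2 ^- j * n'%:~R - 2 ^- j * A.
  rewrite -(ler_int R) rmorphD/= => nn'.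
  rewrite -mulrBr -{2}[2 ^- j]mulr1 -mulrDr ler_pM2l//.
  by move: nn'; rewrite -pmulrn; lra.
by case/orP: (Ksep _ _ kK k'K kk') => /sep ->//; rewrite orbT.
Unshelve. all: by end_near.
Qed.

End lower.
End almost_sure_estimates.

(** * Consistency *)

Section one_level.
Context (R : realType) (I : choiceType).

Lemma sum_subset_le (S S' : seq I) (F : I -> R) : uniq S -> uniq S' ->
  {subset S' <= S} -> (forall k, 0 <= F k) ->
  \sum_(k <- S') F k <= \sum_(k <- S) F k.
Proof.
move=> uS uS' sub F0; have -> : \sum_(k <- S') F k = \sum_(k <- S | k \in S') F k.
  rewrite -[RHS]big_filter; apply: perm_big; apply: uniq_perm => //.
    exact: filter_uniq.
  move=> k; rewrite mem_filter; case: (boolP (k \in S')) => //= kS'.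
  by rewrite sub.
rewrite big_mkcond/=; apply: ler_sum => k _.
by case: ifP.
Qed.

Lemma level_estimates (S S' : seq I) (W d v : I -> R)
    (alpha beta gam m eps kap c Cw : R) :
  0 < alpha -> 0 < beta < 1 -> 0 < eps -> 0 < kap -> 0 < c <= 1 ->
  uniq S -> uniq S' -> {subset S' <= S} -> (0 < size S)%N ->
  kap * (size S)%:R <= (size S')%:R ->
  (forall k, k \in S' -> v k <= m + eps) ->
  Cw * c `^ gam <= c `^ (m + 2 * eps) ->
  c `^ (beta * eps) <= kap / 2 -> c `^ (beta * eps) <= 2^-1 -> c `^ eps <= 2^-1 ->
  (forall k, k \in S -> `|d k - W k| <= Cw * c `^ gam) ->
  (forall k, k \in S -> `|W k| < c `^ (m - alpha^-1 - eps)) ->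
  \sum_(k <- S) `|W k| `^ beta < c `^ (beta * (m - eps)) * (size S)%:R ->
  2 * \sum_(k <- S') (`|W k| <= 2 * c `^ (v k + eps))%R%:R < (size S')%:R :> R ->
  (exists2 k, k \in S' & 2 * c `^ (v k - alpha^-1 + eps) < `|W k|) ->
  [/\ c `^ (beta * (m + 3 * eps)) <=
        (size S)%:R^-1 * \sum_(k <- S) `|d k| `^ beta,
      (size S)%:R^-1 * \sum_(k <- S) `|d k| `^ beta <= c `^ (beta * (m - 2 * eps)),
      c `^ (m - alpha^-1 + 3 * eps) <= \big[Num.max/0]_(k <- S) `|d k| &
      \big[Num.max/0]_(k <- S) `|d k| <= c `^ (m - alpha^-1 - 2 * eps)].
Proof.
move=> a0 /andP[b0 b1] e0 k0 /andP[c0 c1] uS uS' sub S0 nn hv hC hk hb he hd hW hM hN hX.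
have n0 : 0 < (size S)%:R :> R by rewrite ltr0n.
have ai0 : 0 < alpha^-1 by rewrite invr_gt0.
have be0 : 0 < beta * eps by rewrite mulr_gt0.
have dist k : k \in S -> `|d k - W k| <= c `^ (m + 2 * eps).
  by move=> kS; apply: (le_trans (hd _ kS)).
have d_le k : k \in S -> `|d k| <= `|W k| + c `^ (m + 2 * eps).
  move=> kS; rewrite -[d k](subrK (W k)) addrC (le_trans (ler_normD _ _))//.
  by rewrite lerD2l dist.
have W_le k : k \in S -> `|W k| <= `|d k| + c `^ (m + 2 * eps).
  move=> kS; rewrite -[W k](subrK (d k)) addrC (le_trans (ler_normD _ _))//.
  by rewrite lerD2l distrC dist.
have ler_c x y : y <= x -> c `^ x <= c `^ y by exact: le_powR_base.
split.
- rewrite [leRHS]mulrC ler_pdivlMr//.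
  apply: (@le_trans _ _ (kap / 2 * (size S)%:R * c `^ (beta * (m + 2 * eps)))).
    rewrite (_ : beta * (m + 3 * eps) = beta * eps + beta * (m + 2 * eps)); last by ring.
    rewrite powR_addp// mulrAC ler_wpM2r ?powR_ge0//.
    by rewrite ler_wpM2r// ltW.
  apply: (@le_trans _ _ (\sum_(k <- S') `|d k| `^ beta)); last first.
    by apply: sum_subset_le => // k; exact: powR_ge0.
  (* More than half of [S'] has |W| > 2 c^(v + eps), hence |d| >= c^(m + 2 eps); the factor 2 pays
     for the freezing error. *)
  apply: (@le_trans _ _ (\sum_(k <- S')
      (1 - (`|W k| <= 2 * c `^ (v k + eps))%R%:R) * c `^ (beta * (m + 2 * eps)))).
    rewrite -mulr_suml ler_wpM2r ?powR_ge0// sumrB sum_cst_seq mulr1; lra.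
  rewrite big_seq [leRHS]big_seq; apply: ler_sum => k kS'.
  case: (leP `|W k| (2 * c `^ (v k + eps))) => [_|Wk]; first by rewrite mulr1n subrr mul0r powR_ge0.
  rewrite mulr0n subr0 mul1r mulrC powRrM.
  apply: ge0_ler_powR; rewrite ?nnegrE ?powR_ge0 ?(ltW b0)//.
  have h1 := W_le _ (sub _ kS').
  have h2 : c `^ (m + 2 * eps) <= c `^ (v k + eps).
    by apply: ler_c; have := hv _ kS'; lra.
  lra.
- rewrite [leLHS]mulrC ler_pdivrMr//.
  apply: (@le_trans _ _ (\sum_(k <- S) (`|W k| `^ beta + c `^ (beta * (m - eps))))).
    rewrite big_seq [leRHS]big_seq; apply: ler_sum => k kS.
    have b01 : 0 < beta < 1 by rewrite b0 b1.
    apply: (@le_trans _ _ ((`|W k| + c `^ (m + 2 * eps)) `^ beta)).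
      by apply: ge0_ler_powR; rewrite ?nnegrE ?(ltW b0)// ?addr_ge0 ?powR_ge0// d_le.
    (* Since beta < 1, the power is subadditive and the freezing error splits off. *)
    apply: (le_trans (powR_subadd b01 (normr_ge0 _) (powR_ge0 _ _))).
    rewrite lerD2l -powRrM; apply: ler_c.
    by rewrite [leRHS]mulrC ler_pM2l//; lra.
  rewrite big_split/= sum_cst_seq.
  have -> : beta * (m - eps) = beta * eps + beta * (m - 2 * eps) by ring.
  have h1 : c `^ (beta * (m - eps)) * 2 <= c `^ (beta * (m - 2 * eps)).
    have -> : beta * (m - eps) = beta * eps + beta * (m - 2 * eps) by ring.
    rewrite powR_addp// mulrAC ler_piMl ?powR_ge0//; lra.
  have := ler_wpM2r (ltW n0) h1; move: hM.
  have -> : beta * (m - eps) = beta * eps + beta * (m - 2 * eps) by ring.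
  lra.
- have [k kS' Wk] := hX; have kS := sub _ kS'.
  apply: (@le_trans _ _ `|d k|); last exact: (le_bigmax_seq 0 k xpredT (fun i => `|d i|) kS isT).
  have h1 : c `^ (m - alpha^-1 + 3 * eps) <= c `^ (m - alpha^-1 + 2 * eps).
    by apply: ler_c; lra.
  have h2 : c `^ (m - alpha^-1 + 2 * eps) <= c `^ (v k - alpha^-1 + eps).
    by apply: ler_c; have := hv _ kS'; lra.
  have h3 : c `^ (m + 2 * eps) <= c `^ (m - alpha^-1 + 2 * eps).
    by apply: ler_c; lra.
  have := W_le _ kS; lra.
rewrite big_seq; apply: bigmax_le => [|k kS]; first exact: powR_ge0.
have h3 : c `^ (m + 2 * eps) <= c `^ (m - alpha^-1 - eps) by apply: ler_c; lra.
have h1 : c `^ (m - alpha^-1 - eps) * 2 <= c `^ (m - alpha^-1 - 2 * eps).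
  have -> : m - alpha^-1 - eps = eps + (m - alpha^-1 - 2 * eps) by ring.
  rewrite powR_addp// mulrAC ler_piMl ?powR_ge0//; lra.
have := d_le _ kS; have := hW _ kS; lra.
Qed.

End one_level.

Section logarithms.
Context (R : realType).
Implicit Types x y : R.

Lemma ln2_gt0 : 0 < ln 2 :> R.
Proof. by rewrite ln_gt0// ltr1n. Qed.

Lemma le_log2 x y : 0 < x -> x <= y -> log2 x <= log2 y.
Proof.
move=> x0 xy; rewrite /log2 ler_pM2r ?invr_gt0 ?ln2_gt0//.
by rewrite ler_ln ?posrE// (lt_le_trans x0).
Qed.

Lemma log2_dyadic j x : log2 ((2 ^- j) `^ x) = - (j%:R * x).
Proof.
have := ln2_gt0; rewrite /log2 ln_powR lnV ?posrE ?exprn_gt0// lnXn// => l0.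
by rewrite -[ln 2 *+ j]mulr_natl mulrN mulNr mulrA mulfK ?gt_eqF// mulrC.
Qed.

(** Were half the length at most 2^(- j), then minus twice its logarithm would be at least 2 j >
    j. *)
Lemma log2_ge_nu_gt0 (a b : R) j : a < b -> - 2 * log2 (2^-1 * (b - a)) <= j%:R ->
  (0 < j)%N -> (0 < #|` nu a b j|)%N.
Proof.
move=> ab hj j0; apply: nu_gt0.
have ba : 0 < 2^-1 * (b - a) by rewrite mulr_gt0 ?subr_gt0// invr_gt0.
have p2 : 0 < (2 : R) ^+ j by rewrite exprn_gt0.
suff : 2 ^- j <= 2^-1 * (b - a).
  by rewrite -[2 ^- j]mul1r ler_pdivrMr//; lra.
rewrite leNgt; apply/negP => /ltW/(le_log2 ba) h.
have := log2_dyadic j 1; rewrite powRr1 ?(ltW (dyadic_gt0 R j))// mulr1 => e.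
rewrite e in h; have : 0 < j%:R :> R by rewrite ltr0n.
lra.
Qed.

(** Here m cancels: [H_hat] lies between m - 2 eps and m + 3 eps, the other term between 1/alpha - m
    - 3 eps and 1/alpha - m + 2 eps. *)
Lemma alpha_hat_inv_dist (alpha beta a b m eps : R) (dd : int -> int -> R) j :
  (0 < j)%N -> 0 < beta -> 0 < eps ->
  let S := nu a b j in
  [/\ (2 ^- j) `^ (beta * (m + 3 * eps)) <=
        (#|` S|%:R)^-1 * \sum_(k <- S) `|dd j k| `^ beta,
      (#|` S|%:R)^-1 * \sum_(k <- S) `|dd j k| `^ beta <=
        (2 ^- j) `^ (beta * (m - 2 * eps)),
      (2 ^- j) `^ (m - alpha^-1 + 3 * eps) <= D_max a b dd j &
      D_max a b dd j <= (2 ^- j) `^ (m - alpha^-1 - 2 * eps)] ->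
  `|(H_hat beta a b dd j + j%:R^-1 * log2 (D_max a b dd j)) - alpha^-1| <= 5 * eps.
Proof.
move=> j0 b0 e0 S [m1 m2 D1 D2].
have jR : 0 < j%:R :> R by rewrite ltr0n.
have p x : 0 < (2 ^- j) `^ x :> R by rewrite powR_gt0// dyadic_gt0.
have l1 := le_log2 (p _) m1; have l2 := le_log2 (lt_le_trans (p _) m1) m2.
have l3 := le_log2 (p _) D1; have l4 := le_log2 (lt_le_trans (p _) D1) D2.
rewrite log2_dyadic in l1; rewrite log2_dyadic in l2.
rewrite log2_dyadic in l3; rewrite log2_dyadic in l4.
have jb : 0 < j%:R * beta by rewrite mulr_gt0.
have h1 : H_hat beta a b dd j <= m + 3 * eps.
  rewrite /H_hat invrN mulNr -mulrN ler_pdivrMl//; move: l1; rewrite -/S; lra.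
have h2 : m - 2 * eps <= H_hat beta a b dd j.
  rewrite /H_hat invrN mulNr -mulrN ler_pdivlMl//; move: l2; rewrite -/S; lra.
have h3 : - (m - alpha^-1 + 3 * eps) <= j%:R^-1 * log2 (D_max a b dd j).
  by rewrite ler_pdivlMl// mulrN.
have h4 : j%:R^-1 * log2 (D_max a b dd j) <= - (m - alpha^-1 - 2 * eps).
  by rewrite ler_pdivrMl// mulrN.
rewrite ler_norml; lra.
Qed.

End logarithms.

Section frozen_exponent.
Context d (T : measurableType d) (R : realType) (P : probability T R).
Context (alpha : R) (X : R -> R -> T -> R).
Context (hXcont : continuous_paths alpha X) (hXlip : lipschitz_paths alpha X).
Context (psi : R -> R) (hpsi : analyzing_wavelet psi).
Context (Hlow Hup : R) (hHlow : alpha^-1 < Hlow) (hHup : Hup < 1).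
Context (H : R -> R) (hHcont : continuous H) (hHran : forall t, H t \in `[Hlow, Hup]).
Context (a b gam L : R) (gam0 : 0 <= gam).
Context (hHol : forall t1 t2, t1 \in `[a, b] -> t2 \in `[a, b] ->
  `|H t1 - H t2| / `|t1 - t2| `^ gam <= L).

(** Within a cell H moves by O(2^(- j gam)), X is Lipschitz in its exponent and psi is bounded. [Cw]
    may depend on the path, not on j or k. *)
Lemma lfsm_coef_dist (w : T) : exists Cw : R, forall j k, k \in nu a b j ->
  `|wavelet_coef psi (fun t => X t (H t) w) j k - local_coef X psi H j k w| <=
    Cw * (2 ^- j) `^ gam.
Proof.
have [M M0 HM] := wavelet_bounded hpsi.
have [Lw HL] := hXlip w a b hHlow hHup.
have Hr t : alpha^-1 < H t < 1.
  have := hHran t; rewrite in_itv/= => /andP[h1 h2].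
  by rewrite (lt_le_trans hHlow h1) (le_lt_trans h2 hHup).
have lipX t v1 v2 : t \in `[a, b] -> v1 \in `[Hlow, Hup] -> v2 \in `[Hlow, Hup] ->
    `|X t v1 w - X t v2 w| <= `|Lw| * `|v1 - v2|.
  (* At equal exponents the quotient is 0 by convention and carries no information, hence the
     separate case. *)
  move=> tab v1H v2H; have [->|v12] := eqVneq v1 v2.
    by rewrite subrr normr0 mulr_ge0.
  rewrite -ler_pdivrMr ?normr_gt0 ?subr_eq0//.
  by apply: le_trans (ler_norm _); apply: HL; exists t, v1, v2.
have holH t1 t2 : t1 \in `[a, b] -> t2 \in `[a, b] ->
    `|H t1 - H t2| <= `|L| * `|t1 - t2| `^ gam.
  move=> t1ab t2ab; have [->|t12] := eqVneq t1 t2.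
    by rewrite subrr normr0 mulr_ge0 ?powR_ge0.
  rewrite -ler_pdivrMr ?powR_gt0 ?normr_gt0 ?subr_eq0//.
  by apply: le_trans (ler_norm _); exact: hHol.
exists (`|Lw| * `|L| * M) => j k kn.
have c0 := dyadic_gt0 R j.
have y1 := field_path_continuous (w := w) hXcont hHcont Hr.
have y2 : continuous (fun t => X t (H (2 ^- j * k%:~R)) w).
  apply: (field_path_continuous (h := fun=> H (2 ^- j * k%:~R)) hXcont) => [t|t].
    exact: cvg_cst.
  exact: Hr.
rewrite (wavelet_coef_unit hpsi)// /local_coef /field_coef.
have -> : `|Lw| * `|L| * M * (2 ^- j) `^ gam = `|Lw| * (`|L| * (2 ^- j) `^ gam) * M by ring.
apply: (unit_coef_dist hpsi) => // t /andP[t1 t2].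
move: kn; rewrite mem_nu => /andP[k1 k2].
have p2 : 0 < (2 : R) ^+ j by rewrite exprn_gt0.
have u1 : a <= 2 ^- j * k%:~R by rewrite ler_pdivlMl// mulrC.
have u2 : 2 ^- j * k%:~R + 2 ^- j <= b.
  move: k2; rewrite rmorphD/= => k2.
  by rewrite -[X in _ + X]mulr1 -mulrDr ler_pdivrMl// mulrC.
have tab : t \in `[a, b] by rewrite in_itv/= (le_trans u1 t1) (le_trans t2 u2).
have uab : 2 ^- j * k%:~R \in `[a, b].
  by rewrite in_itv/= u1 (le_trans _ u2)// lerDl ltW.
apply: (le_trans (lipX _ _ _ tab (hHran _) (hHran _))).
apply: ler_wpM2l => //; apply: (le_trans (holH _ _ tab uab)).
apply: ler_wpM2l => //; apply: ge0_ler_powR; rewrite ?nnegrE ?(ltW c0)//.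
by rewrite ger0_norm ?subr_ge0// lerBlDl.
Qed.

End frozen_exponent.

Section consistency.
Context d (T : measurableType d) (R : realType) (P : probability T R).
Context (alpha : R) (alpha12 : 1 < alpha < 2).
Context (Z : R -> {RV P >-> R}) (hZ : SaS_Levy_process alpha Z).
Context (X : R -> R -> T -> R) (hX : lfsm_field alpha Z X).
Context (hXcont : continuous_paths alpha X) (hXlip : lipschitz_paths alpha X).
Context (Hlow Hup : R) (hHlow : alpha^-1 < Hlow) (hHup : Hup < 1).
Context (H : R -> R) (hHcont : continuous H) (hHran : forall t, H t \in `[Hlow, Hup]).
Context (psi : R -> R) (hpsi : analyzing_wavelet psi).
Context (a b : R) (hab : a < b).
Context (gam L : R) (gam0 : 0 <= gam).
Context (hHol : forall t1 t2, t1 \in `[a, b] -> t2 \in `[a, b] ->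
  `|H t1 - H t2| / `|t1 - t2| `^ gam <= L).
Context (t0 : R) (ht0 : t0 \in `[a, b]) (hmin : forall t, t \in `[a, b] -> H t0 <= H t).
Context (beta : R) (hbeta : 0 < beta < alpha / 4).

(** Continuity at the minimizer [t0], which may be an end of [a, b]; hence the truncation by [a] and
    [b]. *)
Lemma subinterval_le eps : 0 < eps -> exists a' b' : R,
  [/\ a <= a', b' <= b, a' < b' & forall t, a' <= t <= b' -> H t <= H t0 + eps].
Proof.
move=> e0; have := @hHcont t0 => /cvgrPdist_le/(_ _ e0)[r /= r0 Hr].
move: ht0; rewrite in_itv/= => /andP[at0 t0b].
exists (Num.max a (t0 - r / 2)), (Num.min b (t0 + r / 2)); split.
- by rewrite le_max lexx.
- by rewrite ge_min lexx.
- rewrite gt_max !lt_min hab/=; lra.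
move=> t; rewrite ge_max le_min => /andP[/andP[_ h1] /andP[_ h2]].
have : `|t0 - t| < r by rewrite ltr_norml; lra.
move=> /Hr; rewrite ler_norml; lra.
Qed.

(** The condition 2 eps < gam - H t0 makes the freezing error Cw 2^(- j gam) eventually smaller than
    2^(- j (m + 2 eps)), with m = H t0. *)
Lemma alpha_hat_inv_near eps : 0 < eps -> alpha * eps < 1 ->
  2 * eps < gam - H t0 ->
  {ae P, forall w, \forall j \near \oo,
    `|(alpha_hat beta a b (wavelet_coef psi (fun t => X t (H t) w)) j)^-1
      - alpha^-1| <= 5 * eps}.
Proof.
move=> e0 ea eg; have /andP[b0 b4] := hbeta; have /andP[a1 a2] := alpha12.
have [a' [b' [aa' bb' ab' Hle]]] := subinterval_le e0.
have hH t : alpha^-1 < H t <= Hup.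
  have := hHran t; rewrite in_itv/= => /andP[h1 h2].
  by rewrite (lt_le_trans hHlow h1) h2.
have hm t : a <= t <= b -> H t0 <= H t by move=> tab; apply: hmin; rewrite in_itv.
(* From beta < alpha / 4 and alpha < 2: the range required by the layers of ratio 4. *)
have hb : 0 < beta <= 2^-1 by rewrite b0/=; lra.
have E1 := local_coef_max_le alpha12 hZ hX hXcont hpsi hHup hH (ltW hab) e0 hm.
have E2 := local_coef_mean_le alpha12 hZ hX hXcont hpsi hHup hH e0 hm hab hb.
have E3 := local_coef_count alpha12 hZ hX hXcont hpsi hHup hH ab' e0.
have E4 := local_coef_max_ge alpha12 hZ hX hXcont hpsi hHup hH ab' e0 ea.
apply: filter_app E1; apply: filter_app E2; apply: filter_app E3.
apply: filterS E4 => w E4 E3 E2 E1.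
(* The path is now fixed, and the rank from which the bounds hold depends on it through [Cw]. *)
have [Cw HCw] := lfsm_coef_dist hXcont hXlip hpsi hHlow hHup hHcont hHran gam0 hHol w.
have ba : 0 < b - a by rewrite subr_gt0.
have ba' : 0 < b' - a' by rewrite subr_gt0.
(* [a', b'] contains at least (b' - a') 2^j / 2 cells and [a, b] at most (b - a) 2^j. *)
pose kap := (b' - a') / (2 * (b - a)).
have k0 : 0 < kap by rewrite divr_gt0// mulr_gt0.
have be0 : 0 < beta * eps by rewrite mulr_gt0.
have g0 : 0 < gam - H t0 - 2 * eps by rewrite subr_gt0.
have C0 : 0 < (`|Cw| + 1)^-1 by rewrite invr_gt0 ltr_pwDr.
have kap2 : 0 < kap / 2 by rewrite divr_gt0.
have h2 : 0 < 2^-1 :> R by rewrite invr_gt0.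
apply: filter_app E1; apply: filter_app E2; apply: filter_app E3; apply: filter_app E4.
apply: filter_app (near_dyadic_le g0 C0).
apply: filter_app (near_dyadic_le be0 kap2).
apply: filter_app (near_dyadic_le be0 h2).
apply: filter_app (near_dyadic_le e0 h2).
apply: filter_app (near_dyadic_ge 2 ba).
apply: filter_app (near_dyadic_ge 4 ba').
apply: filterS (nbhs_infty_gt 0%N) => j j0 L4 L2 S1 S2 S3 S4 E4 E3 E2 E1.
rewrite /alpha_hat invrK.
have c0 := dyadic_gt0 R j.
have p2 : 0 < (2 : R) ^+ j by rewrite exprn_gt0.
have n0 := nu_gt0 L2.
have L4' : 2 * 1 + 2 <= (b' - a') * 2 ^+ j by lra.
(* Spacing 1 serves only to bound the number of cells of [a', b'] from below. *)
have [K [uK Ksub _ /andP[K1 _]]] := @nu_spaced R a' b' j 1 isT L4'.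
have Kn : (size K <= #|` nu a' b' j|)%N by exact: uniq_leq_size.
have nn : kap * #|` nu a b j|%:R <= #|` nu a' b' j|%:R.
  rewrite -(ler_nat R) in Kn; apply: le_trans Kn; apply: le_trans K1.
  apply: (le_trans (ler_wpM2l (ltW k0) (size_nu_le j (ltW hab)))).
  rewrite le_eqVlt; apply/orP; left; apply/eqP; rewrite /kap; field.
  by rewrite gt_eqF.
apply: (alpha_hat_inv_dist (m := H t0) (alpha := alpha)) => //.
apply: (level_estimates (S := nu a b j) (S' := nu a' b' j)
  (W := fun k => local_coef X psi H j k w)
  (v := fun k => H (2 ^- j * k%:~R)) (gam := gam) (kap := kap) (Cw := Cw)) => //.
- exact: lt_trans a1.
- rewrite b0/=; lra.
- by rewrite c0 dyadic_le1.
- exact: nu_subset.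
- by move=> k kn; apply: Hle; exact: nu_mem_itv.
- have -> : (2 ^- j) `^ gam =
      (2 ^- j) `^ (gam - H t0 - 2 * eps) * (2 ^- j) `^ (H t0 + 2 * eps).
    by rewrite -powR_addp//; congr (_ `^ _); ring.
  rewrite mulrA ler_piMl ?powR_ge0//; apply: (@le_trans _ _ ((`|Cw| + 1) * (`|Cw| + 1)^-1)).
    apply: (@le_trans _ _ ((`|Cw| + 1) * (2 ^- j) `^ (gam - H t0 - 2 * eps))).
      by rewrite ler_wpM2r ?powR_ge0// (le_trans (ler_norm _))// lerDl.
    by rewrite ler_pM2l// ltr_pwDr.
  by rewrite divff// gt_eqF// ltr_pwDr.
- by move=> k; exact: HCw.
- move: E3; congr (_ * _ < _); apply: eq_bigr => k _; rewrite indicE.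
  by congr ((nat_of_bool _)%:R); apply/idP/idP => [/set_mem//|h]; exact/mem_set.
Qed.

(** The tolerance runs through e0 / (n + 1), so that only countably many null sets are discarded;
    the inverse converges to 1/alpha and can be inverted back as alpha is nonzero. *)
Lemma alpha_hat_cvg : H t0 < gam -> {ae P, forall w,
  alpha_hat beta a b (wavelet_coef psi (fun t => X t (H t) w)) j
    @[j --> \oo] --> alpha}.
Proof.
move=> tg; have /andP[a1 a2] := alpha12.
(* 1/4 ensures alpha e < 1, because alpha < 2; the other bound ensures 2 e < gam - H t0. *)
pose e0 := Num.min (4^-1) ((gam - H t0) / 4).
have e00 : 0 < e0 by rewrite /e0 lt_min invr_gt0 ltr0n/= divr_gt0// subr_gt0.
have e01 : e0 <= 4^-1 by rewrite /e0 ge_min lexx.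
have e02 : e0 <= (gam - H t0) / 4 by rewrite /e0 ge_min lexx orbT.
have en (n : nat) : e0 / n.+1%:R <= e0.
  by rewrite ler_pdivrMr ?ltr0n// ler_peMr ?(ltW e00)// ler1n.
have : {ae P, forall w, forall n : nat, \forall j \near \oo,
    `|(alpha_hat beta a b (wavelet_coef psi (fun t => X t (H t) w)) j)^-1
      - alpha^-1| <= 5 * (e0 / n.+1%:R)}.
  apply: ae_foralln => n; have := en n.
  have : 0 < e0 / n.+1%:R by rewrite divr_gt0 ?ltr0n.
  move: (e0 / _) => e e_gt0 ee0; apply: alpha_hat_inv_near => //; last by lra.
  have : alpha * e < 2 * e by rewrite ltr_pM2r.
  lra.
apply: filterS => w Hw.
have ai : (alpha_hat beta a b (wavelet_coef psi (fun t => X t (H t) w)) j)^-1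
    @[j --> \oo] --> alpha^-1.
  apply/cvgrPdist_le => e e_gt0.
  have [n Hn] : exists n : nat, 5 * (e0 / n.+1%:R) <= e.
    have h : 0 <= 5 * e0 / e by rewrite divr_ge0 ?mulr_ge0// ltW.
    have /andP[_ /ltW h2] := truncn_itv h.
    exists (Num.truncn (5 * e0 / e)).
    by rewrite mulrA ler_pdivrMr ?ltr0n// [leRHS]mulrC -ler_pdivrMr.
  by apply: filterS (Hw n) => j hj; rewrite distrC (le_trans hj).
have a0 : alpha != 0 by rewrite gt_eqF// (lt_trans ltr01).
by apply/(cvgVP _ a0).
Qed.

End consistency.

Theorem theorem1p2 (R : realType) (disp : measure_display)
  (Omega : measurableType disp) (P : probability Omega R)
  (alpha : R) (halpha : 1 < alpha < 2)
  (Z : R -> {RV P >-> R}) (hZ : SaS_Levy_process alpha Z)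
  (X : R -> R -> Omega -> R) (hX : lfsm_field alpha Z X)
  (hXcont : continuous_paths alpha X) (hXlip : lipschitz_paths alpha X)
  (Hlow Hup : R) (hHlow : alpha^-1 < Hlow) (hHle : Hlow <= Hup) (hHup : Hup < 1)
  (H : R -> R) (hHcont : continuous H) (hHran : forall t, H t \in `[Hlow, Hup])
  (psi : R -> R) (hpsi : analyzing_wavelet psi)
  (a b : R) (hab : a < b)
  (hrho : sup [set H t | t in `[a, b]] < unif_Holder_exponent H a b)
  (beta : R) (hbeta : 0 < beta < alpha / 4) :
  (forall j : nat, (0 < j)%N -> - 2 * log2 (2^-1 * (b - a)) <= j%:R ->
     (1 <= #|` nu a b j|)%N) /\
  {ae P, forall w,
     alpha_hat beta a b (wavelet_coef psi (fun t => X t (H t) w)) j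
       @[j --> \oo] --> alpha}.
Proof.
split=> [j j0 hj|]; first exact: log2_ge_nu_gt0.
have hsub t : t \in `[a, b] -> H t <= sup [set H t | t in `[a, b]].
  move=> tab; apply: ub_le_sup; last by exists t.
  exists Hup => _ [s _ <-]; by have := hHran s; rewrite in_itv/= => /andP[].
have aab : a \in `[a, b] by rewrite in_itv/= lexx ltW.
have [alpha1 alpha2] := andP halpha.
have supH0 : 0 < sup [set H t | t in `[a, b]].
  apply: lt_le_trans (hsub _ aab); have := hHran a; rewrite in_itv/= => /andP[+ _].
  apply: lt_le_trans; apply: lt_trans hHlow.
  by rewrite invr_gt0 (lt_trans ltr01).
(* If no exponent were admissible, the supremum would be 0 by convention, against [hrho] and the
   positivity of H. *)
have : [set gamma : R | 0 <= gamma <= 1 /\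
    has_ubound [set r : R | exists t1 t2 : R,
      [/\ t1 \in `[a, b], t2 \in `[a, b] &
          r = `|H t1 - H t2| / `|t1 - t2| `^ gamma]]] !=set0.
  apply/set0P/eqP => E; move: hrho; rewrite /unif_Holder_exponent E sup0.
  by rewrite ltNge (ltW supH0).
(* The supremum need not be attained; an admissible exponent strictly above the supremum of H is
   picked instead. *)
move=> /sup_gt/(_ hrho)[gam [/andP[gam0 _] [L HL]] gamH].
have hHol t1 t2 : t1 \in `[a, b] -> t2 \in `[a, b] ->
    `|H t1 - H t2| / `|t1 - t2| `^ gam <= L.
  by move=> t1ab t2ab; apply: HL; exists t1, t2.
have [t0 ht0 hmin] := EVT_min (ltW hab) (continuous_subspaceT hHcont).
apply: (alpha_hat_cvg halpha hZ hX hXcont hXlip hHlow hHup hHcont hHran hpsi hab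
  gam0 hHol ht0 hmin hbeta).
exact: le_lt_trans (hsub _ ht0) gamH.
Qed.
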